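(* Let $d=2$ and $r\geqslant1$. There exists an odd $L\in\mathbb N$, sufficiently large and depending only on $r$, such that the following holds. For every $g\in(0,1]$, there exists an event $\Omega_g\subset\Omega$ (the one given explicitly in the context) such that $\mathbf P(\Omega_g)\geqslant1-Ce^{-cg^{-2}}$. On $\Omega_g$, the equation $$(-\underline\Delta_{H,-N})\,u_N=\big(g\,\underline\xi_N+r_N\big)u_N+1\quad\text{on }\Lambda_{-N},\qquad r_N=r-(1-L^{-2})\,N\,g^2,$$ with renormalised mass $r$ and renormalised coupling constant $g$, admits a unique solution $u_N$ on $\Lambda_{-N}$, for every $N\in\mathbb N$. Moreover, there exists a function $u^\star\in\mathcal C^{1-}(\mathbb T^2)$ such that $$u_N\to u^\star\quad\text{in }\mathcal C^{1-}(\mathbb T^2),\quad\text{as }N\to\infty .$$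
   Context: Conventions: $\mathbb N=\{0,1,2,\dots\}$, $d=2$, $\alpha=2-d/2=1$, $L\geqslant3$ is an odd integer, $\kappa_{\mathrm s}>0$ is a small fixed parameter, $\mathbb T^d=[-\tfrac12,\tfrac12)^d$ is the torus, and $\xi$ is a white noise on $\mathbb T^d$ on a fixed probability space $(\Omega,\mathcal F,\mathbf P)$. The constants $c,C>0$ do not depend on $g$. Fine lattices. $\Lambda^n=\{-\tfrac12(L^n-1),\dots,-1,0,1,\dots,\tfrac12(L^n-1)\}^d$ and $\Lambda_{-n}=L^{-n}\Lambda^n\subset\mathbb T^d$ for $n\in\mathbb N$. For $x\in\Lambda_{-n}$, $\square_{-n}(x)\subset\mathbb T^d$ is the cube of side length $L^{-n}$ centred at $x$. Averaging operator: $\underline Q_{-n}f(x)=L^{dn}\int_{\square_{-n}(x)}f(y)\,dy$, $x\in\Lambda_{-n}$, for distributions $f$ on $\mathbb T^d$; on functions $f$ on $\Lambda_{-N}$, $N\geqslant n$, it acts as $\underline Q_{-n}f(x)=L^{-(N-n)d}\sum_{y\in\square_{-n}(x)\cap\Lambda_{-N}}f(y)$. Fluctuation operator: $\underline P_{-n}=\underline Q_{-n}-\underline Q_{-n+1}$ for $n\geqslant1$ (where a function on a coarser lattice is evaluated at a point via the cube containing that point). Hierarchical Laplacian on functions on $\Lambda_{-N}$: $-\underline\Delta_{H,-N}=\sum_{n=1}^NL^{2n}\underline P_{-n}$. Regularised noise: $\underline\xi_N=\underline Q_{-N}\xi$, a family of i.i.d. $\mathcal N(0,L^{2(2-\alpha)N})$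 variables indexed by $x\in\Lambda_{-N}$. The function $u_N$ is embedded into $\mathbb T^d$ by linear interpolation between lattice points. Hölder spaces. For $\beta\in\mathbb R$, $\mathcal C^\beta(\mathbb T^d)$ is the completion of smooth functions under the norm $\|w\|_{\mathcal C^\beta}=|\underline Q_0w|+\sup_{n\geqslant1}L^{\beta n}\sup_{x\in\mathbb T^d}|\underline P_{-n}w(x)|$. The exponent $1-$ has its usual meaning: $1-\kappa$ with $\kappa>0$ arbitrarily small. Unit lattices. For $0\leqslant k\leqslant n$, $\Lambda^n$ is partitioned into blocks of side length $L^k$ centred at the points of $L^k\Lambda^{n-k}$; $\square_k(x)$ is the block containing $x$. For $f:\Lambda^n\to\mathbb R$ set $Q_kf(x)=L^{-dk}\sum_{y\in\square_k(x)}f(y)$ and $P_k=Q_{k-1}-Q_k$; $S_kQ_kf:\Lambda^{n-k}\to\mathbb R$ is $S_kQ_kf(x)=(Q_kf)(L^kx)$. The unit-lattice noise is $\xi_{-n}(x)=L^{(-2+\alpha)n}\underline\xi_n(L^{-n}x)$, $x\in\Lambda^n$ (i.i.d. $\mathcal N(0,1)$ for each $n$). For centred jointly Gaussian $X,Y$ write $X\diamond Y=XY-\mathbf E[XY]$ (pointwise for fields). With $\Gamma_m=\sum_{k=1}^mL^{2(k-1)}P_k$, define for $0\leqslant n\leqslant N$ $$\mathcal T^{(N)}_{-n}=L^{(2-2\alpha)(N-n)}S_{N-n}Q_{N-n}\big(\xi_{-N}\diamond\Gamma_{N-n}\xi_{-N}\big):\Lambda^n\to\mathbb R,$$ and $\mathcal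 T^{(N)}_{-n}=0$ for $n>N$. Set $\xi^{(N)}_{-n}=\xi_{-n}$ for $n\leqslant N$ and $\xi^{(N)}_{-n}=0$ for $n>N$. Event. $$\Omega_g=\Big\{\sup_{N\in\mathbb N}\sup_{n\in\mathbb N}L^{-\kappa_{\mathrm s}n}\Big(\sup_{x\in\Lambda^n}|\xi^{(N)}_{-n}(x)|\vee\sup_{x\in\Lambda^n}|\mathcal T^{(N)}_{-n}(x)|^{1/2}\Big)\leqslant(2g)^{-1}\Big\}.$$
   Formalization: u_N is placed on the torus as constant on cubes, not by linear interpolation; C^{1-} is the completion of locally constant, not smooth, functions; and u_N → u* is asserted for almost every point of Ω_g. As stated, the convergence fails since u* jumps across cube boundaries. *)

(* Defs.v *)
From HB Require Import structures.
From mathcomp Require Import all_boot all_order all_algebra.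
From mathcomp Require Import all_classical all_reals all_analysis.
Import Order.TTheory GRing.Theory Num.Theory.
Import numFieldNormedType.Exports.

Set Implicit Arguments.
Unset Strict Implicit.
Unset Printing Implicit Defensive.

Local Open Scope classical_set_scope.
Local Open Scope ring_scope.

(* Throughout d = 2 and alpha = 2 - d/2 = 1. *)

(* The index i : 'I_(L ^ n) stands for the centred coordinate
   i - (L ^ n - 1) / 2, an integer when L is odd.  Thus [site L n] indexes both
   the unit lattice Lambda^n and the fine lattice Lambda_{-n} =
   L^{-n} Lambda^n, the rescaling x |-> L^{-n} x being the identity on
   indices. *)
Definition site (L n : nat) : finType := ('I_(L ^ n) * 'I_(L ^ n))%type.

Section UnitLattice.
Context {R : realType} (L : nat).

(* The block of side L ^ k centred at L ^ k z, z in Lambda^(n-k) of index j,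
   consists of the points of Lambda^n whose indices i satisfy
   i %/ L ^ k = j (in both directions). *)
Definition same_block (n k : nat) (x y : site L n) : bool :=
  (x.1 %/ L ^ k == y.1 %/ L ^ k)%N && (x.2 %/ L ^ k == y.2 %/ L ^ k)%N.

Definition Qop (n k : nat) (f : site L n -> R) (x : site L n) : R :=
  (L%:R ^+ (2 * k))^-1 * \sum_(y : site L n | same_block k x y) f y.

Definition Pop (n k : nat) (f : site L n -> R) (x : site L n) : R :=
  Qop k.-1 f x - Qop k f x.

(* S_k Q_k f (x) = (Q_k f) (L ^ k x), the average of f over the block centred
   at L ^ k x; it is used with f on Lambda^N and x in Lambda^n, n = N - k. *)
Definition SQop (N k n : nat) (f : site L N -> R) (x : site L n) : R :=
  (L%:R ^+ (2 * k))^-1 *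
  \sum_(y : site L N | (y.1 %/ L ^ k == x.1)%N && (y.2 %/ L ^ k == x.2)%N) f y.

Definition Gamma (n m : nat) (f : site L n -> R) (x : site L n) : R :=
  \sum_(1 <= k < m.+1) L%:R ^+ (2 * k.-1) * Pop k f x.

(* For n <= N, a cube of side L^{-n} meets Lambda_{-N} in a block of
   L ^ (N - n) points per direction. *)
Definition Qfine (N n : nat) (f : site L N -> R) : site L N -> R :=
  Qop (N - n) f.

Definition Pfine (N n : nat) (f : site L N -> R) (x : site L N) : R :=
  Qfine n f x - Qfine n.-1 f x.

Definition minus_Laplacian (N : nat) (u : site L N -> R) (x : site L N) : R :=
  \sum_(1 <= n < N.+1) L%:R ^+ (2 * n) * Pfine n u x.

End UnitLattice.

Section Torus.
Context {R : realType} (L : nat).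

Definition torus : set (R * R) :=
  `[- 2^-1, 2^-1[%classic `*` `[- 2^-1, 2^-1[%classic.

Definition leb2 := (@lebesgue_measure R \x @lebesgue_measure R)%E.

Definition lattice_coord (n : nat) (i : 'I_(L ^ n)) : R :=
  (L%:R ^+ n)^-1 * (i%:R - (L%:R ^+ n - 1) / 2).

Definition side (n : nat) (i : 'I_(L ^ n)) : set R :=
  let h := (L%:R ^+ n)^-1 / 2 in `[lattice_coord i - h, lattice_coord i + h[%classic.

Definition cube (n : nat) (x : site L n) : set (R * R) :=
  side x.1 `*` side x.2.

(* The cube of side L^{-n} containing the point z of the torus. *)
Definition cell (n : nat) (z : R * R) : set (R * R) :=
  [set y | exists x : site L n, cube x z /\ cube x y].

Definition Qtorus (n : nat) (w : R * R -> R) (z : R * R) : R :=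
  L%:R ^+ (2 * n) * \int[leb2]_(y in cell n z) w y.

Definition Ptorus (n : nat) (w : R * R -> R) (z : R * R) : R :=
  Qtorus n w z - Qtorus n.-1 w z.

Definition holder_norm (beta : R) (w : R * R -> R) : \bar R :=
  (`|Qtorus 0 w (0, 0)|%:E +
   ereal_sup [set ((L%:R `^ (beta * n%:R))%R%:E *
                   ereal_sup [set `|Ptorus n w z|%:E | z in torus])%E
             | n in [set n : nat | (1 <= n)%N]])%E.

(* The function on the torus with value u x on the cube centred at x. *)
Definition embed (n : nat) (u : site L n -> R) (z : R * R) : R :=
  \sum_(x : site L n) u x * \1_(cube x) z.

(* Completion, for [holder_norm beta], of the locally constant functions: the
   smooth functions of the hierarchical geometry.  It is meant for
   0 < beta < 1, where the completion consists of functions.  It then contains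
   every smooth function w on the torus, because
   |P_{-m} w| <= C L^{-m} makes [embed] of Q_{-n} w converge to w. *)
Definition holder_space (beta : R) (w : R * R -> R) : Prop :=
  leb2.-integrable torus (EFin \o w) /\
  forall e : R, 0 < e -> exists (n : nat) (v : site L n -> R),
    (holder_norm beta (w \- embed v)%R < e%:E)%E.

End Torus.

Section Noise.
Context {R : realType} {d : measure_display} {T : measurableType d}.
Variable P : probability T R.

Definition square_integrable (f : R * R -> R) : Prop :=
  measurable_fun (@torus R) f /\
  leb2.-integrable (@torus R) (fun z => (f z ^+ 2)%:E).

(* [normal_prob 0 0] is not a Dirac mass in the library. *)
Definition centred_normal (v : R) : set R -> \bar R :=
  if v == 0 then \d_(0 : R) else normal_prob 0 (Num.sqrt v).

(* A white noise, as a Gaussian random linear functional on L^2 of the torus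
   with xi f ~ N(0, |f|_2 ^ 2).  By linearity this forces all finite families
   (xi f_i) to be jointly Gaussian with covariance (f_i, f_j)_2.  Linearity is
   required for each omega, so that the averages Q_{-n} xi (omega) of one
   realisation are consistent for different n. *)
Definition white_noise (xi : (R * R -> R) -> T -> R) : Prop :=
  [/\ forall f, square_integrable f -> measurable_fun [set: T] (xi f),
      forall (a : R) f g (omega : T),
        square_integrable f -> square_integrable g ->
        xi (fun z => a * f z + g z) omega = a * xi f omega + xi g omega
    & forall f, square_integrable f ->
      forall A : set R, measurable A ->
        P (xi f @^-1` A) =
        centred_normal (\int[leb2]_(z in @torus R) (f z ^+ 2)) A].

Variables (L : nat) (xi : (R * R -> R) -> T -> R).

(* Q_{-N} xi *)
Definition xi_fine (N : nat) (x : site L N) (omega : T) : R :=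
  L%:R ^+ (2 * N) * xi (\1_(cube x)) omega.

(* L ^ ((-2 + alpha) n) = L ^ (- n) *)
Definition xi_unit (n : nat) (x : site L n) (omega : T) : R :=
  (L%:R ^+ n)^-1 * xi_fine x omega.

Definition wick (X Y : T -> R) (omega : T) : R :=
  X omega * Y omega - fine ('E_P[X \* Y]%R)%E.

(* T^{(N)}_{-n}; the prefactor L ^ ((2 - 2 alpha) (N - n)) equals 1. *)
Definition noise2 (N n : nat) (x : site L n) (omega : T) : R :=
  if (n <= N)%N then
    SQop (N - n)
      (fun y : site L N =>
         wick (xi_unit y)
              (fun omega' => Gamma (N - n) (fun y' => xi_unit y' omega') y)
              omega) x
  else 0.

Definition noise1 (N n : nat) (x : site L n) (omega : T) : R :=
  if (n <= N)%N then xi_unit x omega else 0.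

Definition Omega_event (kappa_s g : R) : set T :=
  [set omega |
    (ereal_sup [set ereal_sup [set
       (L%:R `^ (- kappa_s * n%:R) *
        Num.max (\big[Num.max/0]_(x : site L n) `|noise1 N x omega|)
          (\big[Num.max/0]_(x : site L n) Num.sqrt `|noise2 N x omega|))%:E
       | n in [set: nat]] | N in [set: nat]]
     <= ((2 * g)^-1)%:E)%E].

Definition mass (r g : R) (N : nat) : R :=
  r - (1 - (L%:R ^+ 2)^-1) * N%:R * g ^+ 2.

Definition solves (r g : R) (omega : T) (N : nat) (u : site L N -> R) : Prop :=
  forall x : site L N,
    minus_Laplacian u x = (g * xi_fine x omega + mass r g N) * u x + 1.

End Noise.

(* Main.v *)
Require Import Defs.
From mathcomp Require Import all_boot all_order all_algebra.
From mathcomp Require Import all_classical all_reals all_analysis.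
From mathcomp Require Import measurable_realfun ring lra zify.
Import Order.TTheory GRing.Theory Num.Theory.
Import numFieldNormedType.Exports.

Set Implicit Arguments.
Unset Strict Implicit.
Unset Printing Implicit Defensive.

Local Open Scope classical_set_scope.
Local Open Scope ring_scope.

(** The hierarchical structure makes the renormalisation group exact.  Let u_n be
    the average of the unknown over cubes of side L^-n.  If u_n solves an equation
    with potential L^2n V_n, then averaging over a block and eliminating the
    fluctuations inside it shows that u_{n-1} solves an equation of the same form with
      V_{n-1} = L^2 (1 - 1 / (block mean of 1 / (1 - V_n))),
    while u_n = u_{n-1} h / (block mean of h) with h = 1 / (1 - V_n).  At scale 0 the
    equation is V_0 u_0 = -1.  Hence existence and uniqueness of the solution follow as
    soon as V_n stays away from 1 for n > 0 and V_0 from 0 ([sol_solves],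
    [solves_sol]), and the solution is an explicit product over scales.

    To control V_n, write V_n = g L^-n X_n + L^-2n Y_n with X_n the unit lattice noise.
    To second order in V the recursion replaces V by its block mean plus its
    variance in the block.  The mean reproduces the noise term at the coarser scale;
    the block variance of the noise has expectation 1 - L^-2, which the running mass
    r_n compensates, and its fluctuations build up the second chaos T_n.  Therefore
    Y_n = r_n + g^2 T_n + rho_n, where rho_n is fed by terms of third order in the noise and
    stays below 1/8 ([remainder_bound]).  This needs that g X_n and g^2 T_n are at most
    small powers of L^n, which is what the good event says, and that L is large
    depending on r.  The comparison of two cutoffs N and M in a weighted supremum norm
    is a contraction ([remainder_diff]), so V_n, and with it u_n, converges as N grows
    whenever the second chaos does.  The increments u_n - u_{n-1} are of the order of
    V_n, that is of L^(-(1 - kappa) n) if X_n = O(L^(kappa n)); uniformly in N this gives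
    convergence in the Hoelder spaces of exponent below 1 ([holder_limit]).

    For the probability, T_n is a linear combination of averages of squares of the
    noise over blocks of side L^k, centred ([noise2E]).  The deviation B_k of
    such an average has an exponential upper tail at scale L^k by a moment
    generating function computed with the Hubbard--Stratonovich identity
    ([gaussian_chi_mgf]), and is bounded below by -1.  With lam = L^(2 kappa n) g^-2 the sum
    of |B_k| over k is at most lam / 8, except on an event of probability
    O(exp (- c lam)): the first lam / 64 terms need no lower bound beyond -1,
    and for larger k a crude first moment bound of the lower tail is
    already exponentially small in lam.  Summing over the L^2n sites and over n
    gives the estimate for the good event ([bad_event_prob]).  The same estimate with g
    tending to 0 and every kappa > 0 shows that almost surely the noise is
    O(L^(kappa n)) for every kappa > 0 and the second chaos converges
    ([ae_noise_regularity]). *)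

(** * Averages and the one-step map *)

Section Mean.
Context {R : realType}.

Definition mean (I : finType) (F : I -> R) : R := #|I|%:R^-1 * \sum_i F i.

Lemma meanD (I : finType) (F G : I -> R) :
  mean (fun i => F i + G i) = mean F + mean G.
Proof. by rewrite /mean big_split mulrDr. Qed.

Lemma meanZ (I : finType) (c : R) (F : I -> R) :
  mean (fun i => c * F i) = c * mean F.
Proof. by rewrite /mean -mulr_sumr mulrCA. Qed.

Lemma meanN (I : finType) (F : I -> R) : mean (fun i => - F i) = - mean F.
Proof. by rewrite /mean sumrN mulrN. Qed.

Lemma meanB (I : finType) (F G : I -> R) :
  mean (fun i => F i - G i) = mean F - mean G.
Proof. by rewrite meanD meanN. Qed.

Lemma eq_mean (I : finType) (F G : I -> R) : F =1 G -> mean F = mean G.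
Proof. by move=> FG; rewrite /mean; congr (_ * _); apply: eq_bigr. Qed.

Lemma mean_cst (I : finType) (c : R) : (0 < #|I|)%N ->
  mean (fun _ : I => c) = c.
Proof.
move=> I0; rewrite /mean sumr_const -[c *+ _]mulr_natl mulKf// pnatr_eq0.
by rewrite -lt0n.
Qed.

Lemma ler_mean (I : finType) (F G : I -> R) :
  (forall i, F i <= G i) -> mean F <= mean G.
Proof. by move=> FG; rewrite ler_wpM2l ?invr_ge0// ler_sum. Qed.

Lemma ler_norm_mean (I : finType) (F : I -> R) (c : R) : (0 < #|I|)%N ->
  (forall i, `|F i| <= c) -> `|mean F| <= c.
Proof.
move=> I0 Fc; rewrite -(mean_cst c I0) /mean normrM ger0_norm ?invr_ge0//.
by rewrite ler_wpM2l ?invr_ge0// (le_trans (ler_norm_sum _ _ _))// ler_sum.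
Qed.

End Mean.

Section Step.
Context {R : realType} {I : finType}.
Hypothesis I0 : (0 < #|I|)%N.
Implicit Types (v w : I -> R) (a d : R).

Definition hmean v : R := mean (fun i => (1 - v i)^-1).
(** The nonlinear part of the map v |-> 1 - 1 / mean (1 / (1 - v)) that sends
    the potential on a block to L^-2 times the potential of the next coarser
    scale. *)
Definition Phi v : R := 1 - (hmean v)^-1 - mean v.

Lemma hmean_bounds v a : 0 <= a <= 1 / 8 -> (forall i, `|v i| <= a) ->
  (1 + a)^-1 <= hmean v <= (1 - a)^-1.
Proof.
move=> a18 va; rewrite -(mean_cst (1 + a)^-1 I0) -(mean_cst (1 - a)^-1 I0).
apply/andP; split; apply: ler_mean => i; have := va i; rewrite ler_norml => ?;
  rewrite lef_pV2 ?posrE; lra.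
Qed.

Lemma inv_hmean_bounds v a : 0 <= a <= 1 / 8 -> (forall i, `|v i| <= a) ->
  0 < hmean v /\ 1 - a <= (hmean v)^-1 <= 1 + a.
Proof.
move=> a18 /(hmean_bounds a18)/andP[h1 h2].
have h0 : 0 < hmean v by apply: lt_le_trans h1; rewrite invr_gt0; lra.
split => //; rewrite -[1 - a]invrK -[1 + a]invrK !lef_pV2 ?posrE ?invr_gt0//.
- by rewrite h2.
- by lra.
- by lra.
Qed.

Lemma inv_sub_bound (x y a : R) : 0 <= a <= 1 / 8 -> `|x| <= a -> `|y| <= a ->
  `|(1 - x)^-1 - (1 - y)^-1 - (x - y)| <= 3 * a * `|x - y|.
Proof.
move=> a18; rewrite ler_norml => xa; rewrite ler_norml => ya.
have x0 : 1 - x != 0 by apply: lt0r_neq0; lra.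
have y0 : 1 - y != 0 by apply: lt0r_neq0; lra.
have -> : (1 - x)^-1 - (1 - y)^-1 - (x - y) =
          (((1 - x) * (1 - y))^-1 - 1) * (x - y).
  by field; rewrite y0.
rewrite normrM ler_wpM2r// ler_norml.
have p0 : 0 < (1 - x) * (1 - y) by rewrite mulr_gt0; lra.
have p1 : (1 - x) * (1 - y) <= (1 + a) * (1 + a) by rewrite ler_pM; lra.
have p2 : (1 - a) * (1 - a) <= (1 - x) * (1 - y) by rewrite ler_pM; lra.
apply/andP; split.
  have q1 : (1 + 3 * a)^-1 <= ((1 - x) * (1 - y))^-1.
    by rewrite lef_pV2 ?posrE; nra.
  have q2 : 1 - 3 * a <= (1 + 3 * a)^-1.
    by rewrite -[leRHS]mul1r ler_pdivlMr; nra.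
  by lra.
suff: ((1 - x) * (1 - y))^-1 <= 1 + 3 * a by lra.
rewrite -[leRHS]invrK lef_pV2 ?posrE ?invr_gt0; [|done|lra].
rewrite -[leLHS]mul1r ler_pdivrMr; last lra.
by nra.
Qed.

Lemma hmean_sub_bound v w a d : 0 <= a <= 1 / 8 ->
  (forall i, `|v i| <= a) -> (forall i, `|w i| <= a) ->
  (forall i, `|v i - w i| <= d) ->
  `|hmean v - hmean w - (mean v - mean w)| <= 3 * a * d.
Proof.
move=> a18 va wa vwd; rewrite -!meanB; apply: ler_norm_mean => // i.
rewrite (le_trans (inv_sub_bound a18 (va i) (wa i)))//.
by rewrite ler_wpM2l//; lra.
Qed.

(** The linear part of v |-> 1 - 1 / mean (1 / (1 - v)) at v = 0 is the mean,
    which Phi subtracts; the derivative of the rest is of the order of the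
    size a of v. *)
Lemma Phi_lip v w a d : 0 <= a <= 1 / 8 ->
  (forall i, `|v i| <= a) -> (forall i, `|w i| <= a) ->
  (forall i, `|v i - w i| <= d) ->
  `|Phi v - Phi w| <= 9 * a * d.
Proof.
move=> a18 va wa vwd.
have := hmean_sub_bound a18 va wa vwd.
have [v0 /andP[v1 v2]] := inv_hmean_bounds a18 va.
have [w0 /andP[w1 w2]] := inv_hmean_bounds a18 wa.
have : `|mean v - mean w| <= d by rewrite -meanB; apply: ler_norm_mean.
set m := mean v - mean w; set e := _ - m => md eb.
have d0 : 0 <= d by apply: le_trans md.
have -> : Phi v - Phi w = e * ((hmean v)^-1 * (hmean w)^-1) +
   m * ((hmean v)^-1 * (hmean w)^-1 - 1).
  rewrite /Phi /e /m.
  have hv : hmean v != 0 by rewrite gt_eqF.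
  have hw : hmean w != 0 by rewrite gt_eqF.
  by field; rewrite hw.
set p := _^-1 * _^-1.
have p0 : 0 <= p by rewrite mulr_ge0//; lra.
have p1 : p <= (1 + a) * (1 + a) by rewrite ler_pM; lra.
have p2 : (1 - a) * (1 - a) <= p by rewrite ler_pM; lra.
apply: le_trans (ler_normD _ _) _; rewrite (normrM e) (normrM m).
have -> : 9 * a * d = 3 * a * d * 2 + d * (3 * a) by ring.
have aa : a * a <= a / 8 by nra.
apply: lerD; apply: ler_pM => //; first by rewrite ger0_norm//; nra.
by rewrite ler_norml; apply/andP; split; nra.
Qed.

(** To second order the map is mean v plus the variance of v in the block. This
    variance produces the second chaos and the mass counterterm. *)
Lemma Phi_var v a : 0 <= a <= 1 / 8 -> (forall i, `|v i| <= a) ->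
  `|Phi v - (mean (fun i => v i ^+ 2) - mean v ^+ 2)| <= 20 * a ^+ 3.
Proof.
move=> a18 va; set m2 := mean (fun i => _ ^+ 2); set m1 := mean v.
pose m3 := mean (fun i => v i ^+ 3 * (1 - v i)^-1).
have vi0 i : 0 < 1 - v i by have := va i; rewrite ler_norml; lra.
have hE : hmean v = 1 + (m1 + m2 + m3).
  rewrite -[1 in RHS](mean_cst 1 I0) /m1 /m2 /m3 -!meanD; apply: eq_mean => i.
  by have := vi0 i => /lt0r_neq0 ?; field.
have [v0 /andP[v1 v2]] := inv_hmean_bounds a18 va.
have b1 : `|m1| <= a by apply: ler_norm_mean.
have b2 : `|m2| <= a ^+ 2.
  by apply: ler_norm_mean => // i; rewrite normrX lerXn2r ?nnegrE//; lra.
have b3 : `|m3| <= 2 * a ^+ 3.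
  apply: ler_norm_mean => // i; rewrite normrM normrX [leLHS]mulrC ler_pM//.
    have iv : 0 < (1 - v i)^-1 by rewrite invr_gt0.
    rewrite gtr0_norm// -[leRHS]invrK lef_pV2 ?posrE//.
    by have := va i; rewrite ler_norml; lra.
  by rewrite lerXn2r ?nnegrE//; lra.
rewrite /Phi -/m1 hE; set s := m1 + m2 + m3.
have s0 : 0 < 1 + s by rewrite -hE.
have -> : 1 - (1 + s)^-1 - m1 - (m2 - m1 ^+ 2) =
  m3 - (m2 + m3) * (s + m1) + s ^+ 3 * (1 + s)^-1.
  have : 1 + s != 0 by rewrite gt_eqF.
  by rewrite /s => ?; field.
have a2 : 0 <= a ^+ 2 by rewrite sqr_ge0.
have a3 : 0 <= a ^+ 3 by rewrite exprn_ge0//; lra.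
have e2 : a ^+ 2 <= a / 8 by nra.
have e3 : a ^+ 3 <= a ^+ 2 / 8 by rewrite exprS; nra.
have c1 : `|m2 + m3| <= 2 * a ^+ 2 by rewrite (le_trans (ler_normD _ _))//; lra.
have sb : `|s| <= 2 * a.
  rewrite (le_trans (ler_normD _ _))// (le_trans (lerD (ler_normD _ _) (lexx _)))//.
  lra.
have c2 : `|s + m1| <= 3 * a by rewrite (le_trans (ler_normD _ _))//; lra.
have c3 : `|s ^+ 3 * (1 + s)^-1| <= (2 * a) ^+ 3 * (9 / 8).
  rewrite normrM normrX ler_pM// ?exprn_ge0//.
    by rewrite lerXn2r ?nnegrE//; lra.
  rewrite -hE gtr0_norm ?invr_gt0//; lra.
have c4 : `|(m2 + m3) * (s + m1)| <= 6 * a ^+ 3.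
  have -> : 6 * a ^+ 3 = 2 * a ^+ 2 * (3 * a) by ring.
  by rewrite normrM ler_pM.
rewrite (le_trans (ler_normD _ _))// (le_trans (lerD (ler_normB _ _) (lexx _)))//.
rewrite exprMn in c3; lra.
Qed.

End Step.

(** * Blocks, the effective potential and the cascade *)

Section BlockMean.
Context {R : realType}.
Implicit Types (f : nat * nat -> R) (z : nat * nat).

(** A child of the site z after a refinement by the factor m. Sites are indexed
    by pairs of naturals without an upper bound, so that one field serves
    all scales. *)
Definition desc m z (p : 'I_m * 'I_m) : nat * nat :=
  (z.1 * m + p.1, z.2 * m + p.2)%N.

Definition anc m z : nat * nat := (z.1 %/ m, z.2 %/ m)%N.

Definition bmean m f z : R := mean (fun p : 'I_m * 'I_m => f (desc z p)).

Lemma card_block m : (0 < m)%N -> (0 < #|{: 'I_m * 'I_m}|)%N.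
Proof. by rewrite card_prod card_ord muln_gt0 => ->. Qed.

Lemma anc_desc m z (p : 'I_m * 'I_m) : anc m (desc z p) = z.
Proof.
case: z p => i j [a b]; rewrite /anc /desc /=.
have m0 : (0 < m)%N by apply: leq_ltn_trans (ltn_ord a).
by rewrite !divnMDl// !divn_small// !addn0.
Qed.

Lemma desc_anc m z : (0 < m)%N -> exists p : 'I_m * 'I_m, desc (anc m z) p = z.
Proof.
case: z => i j m0; exists (Ordinal (ltn_pmod i m0), Ordinal (ltn_pmod j m0)).
by rewrite /desc /anc /= -!divn_eq.
Qed.

Lemma bmeanE m f z : bmean m f z =
  (m%:R ^+ 2)^-1 * \sum_(a < m) \sum_(b < m) f (z.1 * m + a, z.2 * m + b)%N.
Proof.
by rewrite /bmean /mean card_prod card_ord natrM -expr2 pair_bigA.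
Qed.

(** Euclidean division as a reindexing of a double sum. *)
Lemma sum_ord_mul (F : nat -> R) m k :
  \sum_(a < m) \sum_(b < k) F (a * k + b)%N = \sum_(c < m * k) F c.
Proof.
rewrite -(big_mkord xpredT F) big_nat_mul big_mkord; apply: eq_bigr => a _.
rewrite -[X in \big[_/_]_(X <= _ < _) _]add0n big_addn mulSn addnK big_mkord.
by apply: eq_bigr => b _; rewrite addnC.
Qed.

Lemma eq_bmean m f f' z : f =1 f' -> bmean m f z = bmean m f' z.
Proof. by move=> ff'; apply: eq_mean => p. Qed.

Lemma bmean_comp m k f z : bmean m (bmean k f) z = bmean (m * k) f z.
Proof.
rewrite !bmeanE natrM exprMn (invfM (m%:R ^+ 2)) -[RHS]mulrA; congr (_ * _).
under eq_bigr => a _ do under eq_bigr => b _ do rewrite bmeanE.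
under eq_bigr => a _ do rewrite -mulr_sumr.
rewrite -mulr_sumr; congr (_ * _).
under eq_bigr => a _ do rewrite exchange_big /=.
rewrite -(sum_ord_mul (fun c => \sum_(b < m * k) f (z.1 * (m * k) + c, z.2 * (m * k) + b)%N)).
apply: eq_bigr => a _; apply: eq_bigr => a' _.
rewrite -(sum_ord_mul (fun c => f (_, z.2 * (m * k) + c)%N)).
apply: eq_bigr => b _; apply: eq_bigr => b' _ /=.
by congr f; congr pair; rewrite mulnDl mulnA addnA.
Qed.

Lemma bmean1 f z : bmean 1 f z = f z.
Proof.
rewrite bmeanE !big_ord1 expr1n invr1 mul1r !muln1 !addn0.
by case: z.
Qed.

End BlockMean.

Section Cascade.
Context {R : realType}.
Variables (L : nat) (g : R) (mass0 : R) (X : nat -> nat * nat -> R) (N : nat).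
Hypothesis L0 : (0 < L)%N.

(** Dividing (1 - V_{n+1}) u_{n+1} = u_n - (block mean of V_{n+1} u_{n+1}) by
    1 - V_{n+1} and averaging over the block eliminates u_{n+1} and leaves at
    scale n an equation of the same form; this recursion gives its potential.
    The fixpoint runs over the number of scales integrated out. *)
Fixpoint eff_pot_down (k : nat) : nat * nat -> R :=
  if k is k'.+1 then
    fun z => L%:R ^+ 2 * (1 - (bmean L (fun y => (1 - eff_pot_down k' y)^-1) z)^-1)
  else fun z => g * (L%:R ^+ N)^-1 * X N z + (L%:R ^+ (2 * N))^-1 * mass0.

Definition eff_pot n := eff_pot_down (N - n).

Lemma eff_pot_top z : eff_pot N z =
  g * (L%:R ^+ N)^-1 * X N z + (L%:R ^+ (2 * N))^-1 * mass0.
Proof. by rewrite /eff_pot subnn. Qed.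

Lemma eff_potS n z : (n < N)%N -> eff_pot n z =
  L%:R ^+ 2 * (1 - (bmean L (fun y => (1 - eff_pot n.+1 y)^-1) z)^-1).
Proof. by move=> nN; rewrite /eff_pot -(subnSK nN). Qed.

Definition hfun n y : R := (1 - eff_pot n y)^-1.

(** Inside a block the solution is proportional to 1 / (1 - V_n), normalised so
    that its block mean is the value at the next coarser scale. *)
Fixpoint sol (n : nat) : nat * nat -> R :=
  if n is n'.+1 then
    fun y => sol n' (anc L y) * (hfun n y / bmean L (hfun n) (anc L y))
  else fun z => - (eff_pot 0 z)^-1.

Hypothesis V1 : forall n z, (0 < n <= N)%N -> 1 - eff_pot n z != 0.
Hypothesis H1 : forall n z, (0 < n <= N)%N -> bmean L (hfun n) z != 0.
Hypothesis V0 : forall z, eff_pot 0 z != 0.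

Lemma bmean_sol n z : (n < N)%N -> bmean L (sol n.+1) z = sol n z.
Proof.
move=> nN /=.
rewrite /bmean (eq_mean (G := fun p => (sol n z / bmean L (hfun n.+1) z) *
   hfun n.+1 (desc z p))); last by move=> p; rewrite anc_desc -[RHS]mulrA; congr (_ * _); rewrite mulrC.
by rewrite meanZ -mulrA mulVf ?mulr1// H1.
Qed.

(** The hierarchical Laplacian truncated to the scales 1, ..., M, written in
    terms of the block averages u_n of the unknown: (Q_n - Q_{n-1}) u is the
    difference of u_n and u_{n-1} at the ancestors. *)
Definition lap_partial (u : nat -> nat * nat -> R) M y : R :=
  \sum_(1 <= n < M.+1) L%:R ^+ (2 * n) *
    (u n (anc (L ^ (M - n)) y) - u n.-1 (anc (L ^ (M - n.-1)) y)).

Lemma anc_anc m k z : anc m (anc k z) = anc (k * m) z.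
Proof. by rewrite /anc /= -!divnMA. Qed.

Lemma anc1 z : anc 1 z = z.
Proof. by rewrite /anc !divn1; case: z. Qed.

Lemma lap_partialS u M y : lap_partial u M.+1 y =
  lap_partial u M (anc L y) + L%:R ^+ (2 * M.+1) * (u M.+1 y - u M (anc L y)).
Proof.
rewrite /lap_partial big_nat_recr//= subnn expn0 anc1 subSnn expn1; congr (_ + _).
apply: eq_big_nat => n /andP[n0 nM]; rewrite !anc_anc -!expnS -!subSn//.
by rewrite (leq_trans (leq_pred _))//.
Qed.

(** By construction V_n is exactly what makes the averaged equation at scale n
    consistent with the one at scale n + 1, so the equation propagates from the
    coarsest scale, where it reads 0 = V_0 u_0 + 1. *)
Lemma sol_solves M y : (M <= N)%N -> lap_partial sol M y =
  L%:R ^+ (2 * M) * eff_pot M y * sol M y + 1.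
Proof.
elim: M y => [|M IH] y MN.
  by rewrite /lap_partial big_nil muln0 expr0 mul1r /= mulrN divff// addNr.
rewrite lap_partialS IH; last exact: ltnW.
rewrite (eff_potS _ MN) -/(hfun M.+1) /= -/(hfun M.+1 y).
have := H1 (anc L y) (n := M.+1) MN; have := V1 y (n := M.+1) MN.
set H := bmean _ _ _; set s := sol M _; rewrite /hfun; set v := eff_pot _ y.
by rewrite mulnS exprD => v0 h0; field; rewrite h0.
Qed.

(** Averaging the equation over a block and subtracting expresses u_{n+1} by its
    block mean, which solves the equation at the next coarser scale. *)
Lemma solves_sol (u : nat -> nat * nat -> R) :
  (forall n z, (n < N)%N -> u n z = bmean L (u n.+1) z) ->
  (forall y, lap_partial u N y = L%:R ^+ (2 * N) * eff_pot N y * u N y + 1) ->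
  forall n y, (n <= N)%N -> u n y = sol n y.
Proof.
move=> um uN.
have Lr : L%:R != 0 :> R by rewrite pnatr_eq0 -lt0n.
have Lx k : L%:R ^+ k != 0 :> R by rewrite expf_neq0.
have step M : (M < N)%N ->
   (forall y, lap_partial u M.+1 y =
      L%:R ^+ (2 * M.+1) * eff_pot M.+1 y * u M.+1 y + 1) ->
   (forall y, u M.+1 y = u M (anc L y) *
      (hfun M.+1 y / bmean L (hfun M.+1) (anc L y))) /\
   (forall z, lap_partial u M z = L%:R ^+ (2 * M) * eff_pot M z * u M z + 1).
  move=> MN E.
  pose A z := bmean L (fun y => eff_pot M.+1 y * u M.+1 y) z.
  have lapA z : lap_partial u M z = L%:R ^+ (2 * M.+1) * A z + 1.
    have /eqP := eq_bmean L z E.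
    rewrite /bmean meanD mean_cst ?card_block//.
    rewrite (eq_mean (F := fun p => _ * _ * _) (G := fun p : 'I_L * 'I_L =>
      L%:R ^+ (2 * M.+1) * (eff_pot M.+1 (desc z p) * u M.+1 (desc z p)))); last first.
      by move=> p; rewrite mulrA.
    rewrite meanZ => /eqP <-.
    rewrite (eq_mean (F := fun p => lap_partial u M.+1 _)
       (G := fun p : 'I_L * 'I_L => lap_partial u M z +
       L%:R ^+ (2 * M.+1) * (u M.+1 (desc z p) - u M z))); last first.
      by move=> p; rewrite lap_partialS anc_desc.
    rewrite meanD meanZ meanB !mean_cst ?card_block// (um _ _ MN).
    by rewrite /bmean subrr mulr0 addr0.
  have uV y : u M.+1 y * (1 - eff_pot M.+1 y) = u M (anc L y) - A (anc L y).
    have := E y; rewrite lap_partialS lapA => /eqP.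
    rewrite addrAC -mulrDr -subr_eq addrK => /eqP.
    by rewrite -mulrA => /(mulfI (Lx _)) e; rewrite mulrBr mulr1 mulrC -e; ring.
  have uh y : u M.+1 y = (u M (anc L y) - A (anc L y)) * hfun M.+1 y.
    by rewrite -uV /hfun mulfK// V1.
  have uH z : u M z = (u M z - A z) * bmean L (hfun M.+1) z.
    rewrite {1}(um _ _ MN) /bmean -meanZ; apply: eq_mean => p.
    by rewrite uh anc_desc.
  have uA z : u M z - A z = u M z / bmean L (hfun M.+1) z.
    by rewrite {2}uH mulfK// H1.
  split => [y|z]; first by rewrite uh uA -mulrA (mulrC (_^-1)).
  rewrite lapA (eff_potS _ MN) -/(hfun M.+1); congr (_ + 1).
  have -> : A z = u M z * (1 - (bmean L (hfun M.+1) z)^-1).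
    by rewrite mulrBr mulr1 -uA; ring.
  by rewrite mulnS exprD; ring.
have all k : (k <= N)%N ->
   (forall z, lap_partial u (N - k) z =
     L%:R ^+ (2 * (N - k)) * eff_pot (N - k) z * u (N - k)%N z + 1).
  elim: k => [|k IH] kN; first by rewrite subn0.
  have lt : (N - k.+1 < N)%N by rewrite ltn_subrL; case: N kN.
  by have [|_ //] := step _ lt; rewrite subnSK//; apply: IH; apply: ltnW.
elim=> [|n IH] y nN /=.
  have := all N (leqnn _) y; rewrite subnn /lap_partial big_nil muln0 expr0 mul1r.
  move=> /esym/eqP; rewrite addr_eq0 => /eqP e.
  by apply: (mulfI (V0 y)); rewrite e mulrN divff.
rewrite -IH; last exact: ltnW.
have [|-> //] := step n nN.
by move=> z; have := all (N - n.+1)%N (leq_subr _ _) z; rewrite subKn.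
Qed.

End Cascade.

(** * Convergence of sequences and of block means *)

Lemma cauchy_seq_cvg {R : realType} (u : nat -> R) :
  (forall e, 0 < e -> exists N0, forall N, (N0 <= N)%N -> `|u N - u N0| <= e) ->
  cvgn u.
Proof.
move=> uc; apply/cauchy_cvgP/cauchy_exP => e e0.
have [|N0 HN0] := uc (e / 2); first by rewrite divr_gt0.
exists (u N0); exists N0 => // N /= NN.
by rewrite /ball /= distrC (le_lt_trans (HN0 N NN))// ltr_pdivrMr// ltr_pMr// ltr1n.
Qed.

Lemma cvg_bmean {R : realType} m (f : nat -> nat * nat -> R) (l : nat * nat -> R) z :
  (forall y, f N y @[N --> \oo] --> l y) ->
  bmean m (f N) z @[N --> \oo] --> bmean m l z.
Proof.
move=> fl; rewrite /bmean /mean; apply: cvgM; first exact: cvg_cst.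
by apply: cvg_big => [|p _]; [exact: add_continuous|exact: fl].
Qed.

(** * Control of the effective potential *)

Section Renormalisation.
Context {R : realType}.
Variables (L : nat) (g r : R) (X : nat -> nat * nat -> R).
Hypothesis L0 : (0 < L)%N.
Hypothesis X_coarse : forall n z, X n z = L%:R * bmean L (X n.+1) z.

Definition block_sq k n z := bmean (L ^ k) (fun y => X (n + k) y ^+ 2) z.

(** The field T^(N)_{-n} of the good event. For the noise of the theorem Gamma
    is a telescoping sum over scales, and the k-th term below is the
    contribution of the scale n + k + 1 to the block mean of noise times
    Gamma noise, minus its expectation; [noise2E] below proves it. *)
Definition second_chaos N n z : R := \sum_(k < N - n)
  (block_sq k.+1 n z - (L%:R ^+ 2)^-1 * block_sq k n z - (1 - (L%:R ^+ 2)^-1)).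

Lemma block_sqS k n z : bmean L (block_sq k n.+1) z = block_sq k.+1 n z.
Proof. by rewrite /block_sq bmean_comp -expnS addSnnS. Qed.

Let Lr : L%:R != 0 :> R.
Proof. by rewrite pnatr_eq0 -lt0n. Qed.

Lemma mean_sum (I J : finType) (F : J -> I -> R) :
  mean (fun i => \sum_j F j i) = \sum_j mean (F j).
Proof. by rewrite /mean exchange_big /= mulr_sumr. Qed.

(** Going one scale up adds the block variance of the noise minus its mean 1 -
    L^-2: the quantity that [Phi_var] produces at second order. *)
Lemma second_chaosS N n z : (n < N)%N -> second_chaos N n z =
  bmean L (second_chaos N n.+1) z +
  (bmean L (fun y => X n.+1 y ^+ 2) z - bmean L (X n.+1) z ^+ 2) -
  (1 - (L%:R ^+ 2)^-1).
Proof.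
move=> nN; rewrite {1}/second_chaos -(subnSK nN) big_ord_recl /=.
have -> : bmean L (second_chaos N n.+1) z = \sum_(k < N - n.+1)
   (block_sq k.+2 n z - (L%:R ^+ 2)^-1 * block_sq k.+1 n z - (1 - (L%:R ^+ 2)^-1)).
  rewrite /second_chaos /bmean mean_sum; apply: eq_bigr => k _.
  rewrite -!block_sqS /bmean !meanB !mean_cst ?card_block//.
  by rewrite (meanZ _ (fun p => block_sq k n.+1 (desc z p))).
rewrite {1 2}/block_sq expn0 bmean1 expn1 addn0 addn1 (X_coarse n z).
by set S := \sum_(_ < _) _; field.
Qed.

(** The coefficient of L^-2n in V_n once the first order noise term is removed;
    under the linearised map the noise term and this one are both reproduced
    exactly. *)
Definition marginal N n z : R :=
  L%:R ^+ (2 * n) * (eff_pot L g (mass L r g N) X N n z - g * (L%:R ^+ n)^-1 * X n z).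

Notation V N n := (eff_pot L g (mass L r g N) X N n).

Lemma eff_potE N n z : V N n z =
  g * (L%:R ^+ n)^-1 * X n z + (L%:R ^+ (2 * n))^-1 * marginal N n z.
Proof. by rewrite /marginal mulKf ?expf_neq0// addrC subrK. Qed.

Lemma marginal_top N z : marginal N N z = mass L r g N.
Proof. by rewrite /marginal eff_pot_top addrAC subrr add0r mulVKf ?expf_neq0. Qed.

(** Block averaging turns the noise of scale n + 1 into L^-1 times that of scale
    n, which cancels the linear part of the map on the noise term. *)
Lemma marginalS N n z : (n < N)%N -> marginal N n z =
  bmean L (marginal N n.+1) z +
  L%:R ^+ (2 * n.+1) * Phi (fun p : 'I_L * 'I_L => V N n.+1 (desc z p)).
Proof.
move=> nN; rewrite {1}/marginal (eff_potS _ _ _ _ _ nN) (X_coarse n z).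
rewrite /Phi -/(bmean L (fun y => V N n.+1 y) z) /hmean -/(bmean L (fun y => (1 - V N n.+1 y)^-1) z).
set H := (bmean _ _ _)^-1.
have -> : bmean L (fun y => V N n.+1 y) z =
    g * (L%:R ^+ n.+1)^-1 * bmean L (X n.+1) z +
    (L%:R ^+ (2 * n.+1))^-1 * bmean L (marginal N n.+1) z.
  by rewrite /bmean -!meanZ -meanD; apply: eq_mean => p; rewrite eff_potE.
have := expf_neq0 (2 * n) Lr; have := expf_neq0 n Lr.
rewrite mulnS exprD (exprS _ n); set a := L%:R ^+ n; set b := L%:R ^+ (2 * n).
by move=> a0 b0; field; rewrite ?Lr ?a0 ?b0.
Qed.

(** What is left of the marginal coefficient after the running mass and the
    second chaos. The mass r_n and the second chaos absorb the block
    variance of the noise, so only terms of third order feed the remainder,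
    the noise counting as first and the marginal term as second order. *)
Definition remainder N n z : R :=
  marginal N n z - mass L r g n - g ^+ 2 * second_chaos N n z.

Lemma massS n : mass L r g n = mass L r g n.+1 + (1 - (L%:R ^+ 2)^-1) * g ^+ 2.
Proof. by rewrite /mass -(natr1 n); ring. Qed.

Definition noise_var n z : R :=
  mean (fun p : 'I_L * 'I_L => (g * (L%:R ^+ n)^-1 * X n (desc z p)) ^+ 2) -
  mean (fun p : 'I_L * 'I_L => g * (L%:R ^+ n)^-1 * X n (desc z p)) ^+ 2.

Lemma remainder_top N z : remainder N N z = 0.
Proof. by rewrite /remainder marginal_top /second_chaos subnn big_ord0 mulr0 subrr subr0. Qed.

(** The choice r_n - r_{n+1} = (1 - L^-2) g^2 of the counterterm cancels the
    expectation that [second_chaosS] subtracts from the block variance. *)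
Lemma remainderS N n z : (n < N)%N -> remainder N n z =
  bmean L (remainder N n.+1) z + L%:R ^+ (2 * n.+1) *
   (Phi (fun p : 'I_L * 'I_L => V N n.+1 (desc z p)) - noise_var n.+1 z).
Proof.
move=> nN; rewrite {1}/remainder marginalS// second_chaosS// (massS n).
have -> : bmean L (remainder N n.+1) z = bmean L (marginal N n.+1) z -
   mass L r g n.+1 - g ^+ 2 * bmean L (second_chaos N n.+1) z.
  rewrite /bmean -(meanZ (g ^+ 2)) -[mass _ _ _ _ in RHS](mean_cst _ (card_block L0)).
  by rewrite -!meanB.
have -> : noise_var n.+1 z = g ^+ 2 * (L%:R ^+ (2 * n.+1))^-1 *
   (bmean L (fun y => X n.+1 y ^+ 2) z - bmean L (X n.+1) z ^+ 2).
  rewrite mulrBr /noise_var /bmean -meanZ (meanZ _ (fun p => X n.+1 (desc z p))).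
  congr (_ - _).
    by apply: eq_mean => p; rewrite !exprMn exprVn -exprM mulnC.
  by rewrite !exprMn exprVn -exprM mulnC.
have := expf_neq0 (2 * n.+1) Lr; set a := L%:R ^+ (2 * n.+1) => a0.
by field; rewrite ?a0 ?Lr.
Qed.

Variable q : R.
Hypothesis q0 : 0 < q.
Hypothesis q8 : q ^+ 8 = L%:R^-1.
Hypothesis r1 : 1 <= r.
Hypothesis g01 : 0 < g <= 1.
Hypothesis qr : 36 * (r + 3) * q <= 1.
Hypothesis noiseB : forall n z, g * `|X n z| <= q ^- n / 2.

Let r0 : 0 <= r.
Proof. exact: le_trans r1. Qed.

Let g1 : g <= 1.
Proof. by case/andP: g01. Qed.

Let g0 : 0 < g.
Proof. by case/andP: g01. Qed.

Let q144 : q <= 1 / 144.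
Proof.
have : 0 <= (r - 1) * q by rewrite mulr_ge0 ?subr_ge0// ltW.
by have := qr; rewrite mulrBl mul1r mulrAC mulrDr mulrDl; lra.
Qed.

Let qX n : 0 < q ^+ n.
Proof. exact: exprn_gt0. Qed.

Let qXX n k : 0 <= (q ^+ n) ^+ k.
Proof. by rewrite !exprn_ge0 ?ltW. Qed.

Let qX1 n : q ^+ n <= 1.
Proof. by rewrite exprn_ile1 ?ltW//; move: q144; lra. Qed.

Lemma invLX n : (L%:R ^+ n)^-1 = (q ^+ n) ^+ 8 :> R.
Proof. by rewrite -exprVn -q8 -!exprM mulnC. Qed.

Lemma invLX2 n : (L%:R ^+ (2 * n))^-1 = (q ^+ n) ^+ 16 :> R.
Proof. by rewrite invLX -!exprM; congr (q ^+ _); lia. Qed.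

(** The running mass grows linearly in n; this dominates it by a small power of
    L^n. *)
Lemma natr_le_qVX n : n%:R <= q ^- n.
Proof.
elim: n => [|n IH]; first by rewrite expr0 invr1.
rewrite exprS invfM -natr1.
have q2 : 2 <= q^-1 by rewrite -[leLHS]invrK lef_pV2 ?posrE//; move: q144; lra.
have : 1 <= q ^- n by rewrite -[leLHS]invr1 lef_pV2 ?posrE.
by move: IH; set p := q ^- n; nra.
Qed.

Lemma noise_term_bound n z : `|g * (L%:R ^+ n)^-1 * X n z| <= (q ^+ n) ^+ 7 / 2.
Proof.
rewrite normrM (normrM g) (gtr0_norm g0) invLX (gtr0_norm (exprn_gt0 8 (qX n))).
rewrite mulrAC.
have := noiseB n z; move: (qX n); set p := q ^+ n => p0 /(ler_wpM2r (exprn_ge0 8 (ltW p0))).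
move/le_trans; apply; rewrite le_eqVlt; apply/orP; left; apply/eqP.
by field; rewrite gt_eqF.
Qed.

Section OneScale.
Variables (N : nat).
Hypothesis chaosB : forall n z, (n <= N)%N -> g ^+ 2 * `|second_chaos N n z| <= q ^- n / 4.

Lemma marginal_bound n z : (n <= N)%N -> `|remainder N n z| <= 1 / 8 ->
  `|marginal N n z| <= (r + 2) * q ^- n.
Proof.
move=> nN rb.
have -> : marginal N n z = remainder N n z + mass L r g n + g ^+ 2 * second_chaos N n z.
  by rewrite /remainder; ring.
have p1 : 1 <= q ^- n by rewrite -[leLHS]invr1 lef_pV2 ?posrE.
have mb : `|mass L r g n| <= r + n%:R.
  rewrite /mass (le_trans (ler_normB _ _))// (ger0_norm r0).
  rewrite lerD2l -mulrA mulrCA -[leRHS]mulr1 normrM ger0_norm// ler_wpM2l//.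
  have L2 : 0 < (L%:R ^+ 2 : R)^-1 <= 1.
    by rewrite invLX (exprn_gt0 8 (qX 2)) exprn_ile1 ?qX1// ltW ?qX.
  have g2 : 0 <= g ^+ 2 <= 1 by rewrite sqr_ge0 exprn_ile1 ?g1// ltW.
  by rewrite ler_norml; nra.
have := chaosB z nN; have := natr_le_qVX n.
have : `|g ^+ 2 * second_chaos N n z| = g ^+ 2 * `|second_chaos N n z|.
  by rewrite normrM ger0_norm// sqr_ge0.
have := ler_normD (remainder N n z + mass L r g n) (g ^+ 2 * second_chaos N n z).
have := ler_normD (remainder N n z) (mass L r g n).
by move: p1 r1; set p := q ^- n; nra.
Qed.

Lemma marginal_term_bound n z : (0 < n <= N)%N -> `|remainder N n z| <= 1 / 8 ->
  `|(L%:R ^+ (2 * n))^-1 * marginal N n z| <= (q ^+ n) ^+ 15 * (r + 2).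
Proof.
move=> /andP[n0 nN] /(marginal_bound nN) mb.
rewrite normrM invLX2 (gtr0_norm (exprn_gt0 16 (qX n))).
rewrite (le_trans (ler_wpM2l _ mb)) ?qXX// mulrCA (exprSr _ 15) mulfK.
  by rewrite mulrC.
by rewrite gt_eqF.
Qed.

Lemma eff_pot_bound_of n z : (0 < n <= N)%N -> `|remainder N n z| <= 1 / 8 ->
  `|V N n z| <= (q ^+ n) ^+ 7.
Proof.
move=> n0N /(marginal_term_bound n0N) mb; rewrite eff_potE.
rewrite (le_trans (ler_normD _ _))// (le_trans (lerD (noise_term_bound n z) mb))//.
have pq : q ^+ n <= q.
  by rewrite -[leRHS]expr1 ler_wiXn2l ?(ltW q0)//; [by move: q144; lra|case/andP: n0N].
rewrite (exprD _ 7 8); move: (qX n) (qX1 n) pq qr r1 q0; set p := q ^+ n => p0 p1 pq qr' r1' q0'.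
have p7 : 0 < p ^+ 7 by rewrite exprn_gt0.
have : p ^+ 8 <= p.
  by rewrite exprS ler_piMr ?(ltW p0)// exprn_ile1 ?p1// (ltW p0).
move=> p8; have pr : p ^+ 8 * (r + 2) <= q * (r + 3).
  by apply: ler_pM; rewrite ?(qXX n 8) ?(le_trans p8 pq)//; lra.
rewrite -[p ^+ 7 * p ^+ 8 * _]mulrA -[leRHS]mulr1 -mulrDr ler_wpM2l ?(ltW p7)//.
by lra.
Qed.

(** Downward induction from the finest scale. With p = q^m the error of one step
    is at most 9 p^7 p^15 (r + 2), from replacing V by its noise term in
    Phi, plus 20 (p^7 / 2)^3, from the third order of Phi; multiplied by
    L^2m = p^-16 this is a small multiple of p^4, and p^4 is small compared
    with (p / q)^4. *)
Lemma remainder_bound n z : (n <= N)%N -> `|remainder N n z| <= (q ^+ n) ^+ 4 / 8.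
Proof.
move=> nN; rewrite -(subKn nN); move: (N - n)%N (leq_subr n N) => k.
elim: k z => [|k IH] z kN.
  by rewrite subn0 remainder_top normr0 divr_ge0 ?qXX.
have lt : (N - k.+1 < N)%N by rewrite ltn_subrL; case: (N) kN.
rewrite remainderS// subnSK//; set m := (N - k)%N.
have m1 : m = (N - k.+1).+1 by rewrite subnSK.
have m0N : (0 < m <= N)%N by rewrite m1.
have {}IH y : `|remainder N m y| <= (q ^+ m) ^+ 4 / 8 by apply: IH; apply: ltnW.
rewrite -/m.
have pq : q ^+ m <= q.
  by rewrite -[leRHS]expr1 ler_wiXn2l ?(ltW q0)//; [by move: q144; lra|rewrite m1].
move: (qX m) (qX1 m); set p := q ^+ m => p0 p1.
have p48 : p ^+ 4 / 8 <= 1 / 8 by rewrite ler_wpM2r// exprn_ile1 ?p1// (ltW p0).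
have r8 y : `|remainder N m y| <= 1 / 8 by apply: le_trans (IH y) _.
pose W (i : 'I_L * 'I_L) := g * (L%:R ^+ m)^-1 * X m (desc z i).
pose Vz (i : 'I_L * 'I_L) := V N m (desc z i).
have cL := card_block L0.
have p7 : 0 <= p ^+ 7 <= 1 / 8.
  rewrite (qXX m 7) /= exprS.
  have : p ^+ 6 <= 1 by rewrite exprn_ile1 ?p1// (ltW p0).
  have := qXX m 6; rewrite -/p.
  by move: pq q144; rewrite -/p; set P := p ^+ 6; nra.
have Vb i : `|Vz i| <= p ^+ 7 by apply: eff_pot_bound_of.
have Wb i : `|W i| <= p ^+ 7 / 2 by apply: noise_term_bound.
have Wb' i : `|W i| <= p ^+ 7 by apply: le_trans (Wb i) _; lra.
have VW i : `|Vz i - W i| <= p ^+ 15 * (r + 2).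
  by rewrite /Vz eff_potE addrC addKr; apply: marginal_term_bound.
have F1 := Phi_lip cL p7 Vb Wb' VW.
have p72 : 0 <= p ^+ 7 / 2 <= 1 / 8 by lra.
have F2 := Phi_var cL p72 Wb.
have F : `|Phi Vz - noise_var m z| <= 9 * p ^+ 7 * (p ^+ 15 * (r + 2)) + 20 * (p ^+ 7 / 2) ^+ 3.
  rewrite -[Phi Vz](subrK (Phi W)) -addrA (le_trans (ler_normD _ _))// lerD//.
rewrite (le_trans (ler_normD _ _))//.
apply: (@le_trans _ _ (p ^+ 4 / 8 + p ^- 16 * (9 * p ^+ 7 * (p ^+ 15 * (r + 2)) + 20 * (p ^+ 7 / 2) ^+ 3))).
  apply: lerD; first exact: ler_norm_mean.
  have -> : L%:R ^+ (2 * m) = p ^- 16 :> R.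
    by rewrite -[LHS]invrK invLX2.
  have p16 : 0 <= p ^- 16 by rewrite invr_ge0 qXX.
  by rewrite normrM (ger0_norm p16) ler_wpM2l.
have -> : (q ^+ (N - k.+1)) = p / q.
  by rewrite /p m1 exprS mulrAC divff ?mul1r// gt_eqF.
have -> : p ^- 16 * (9 * p ^+ 7 * (p ^+ 15 * (r + 2)) + 20 * (p ^+ 7 / 2) ^+ 3) =
  p ^+ 4 * (9 * (r + 2) * p ^+ 2 + 20 / 8 * p).
  by have := lt0r_neq0 p0 => pn; field.
have -> : (p / q) ^+ 4 / 8 = p ^+ 4 * (q^-1 ^+ 4 / 8) by rewrite [RHS]mulrA -exprMn.
rewrite -mulrDr ler_wpM2l ?qXX//.
have q1 : 2 <= q^-1 by rewrite -[leLHS]invrK lef_pV2 ?posrE//; move: q144; lra.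
have : 2 ^+ 4 <= q^-1 ^+ 4 by rewrite lerXn2r// ?nnegrE//; lra.
have : (r + 2) * p ^+ 2 <= p.
  have rp : (r + 2) * p <= (r + 3) * q.
    by apply: ler_pM; rewrite ?(ltW p0)//; move: r1; lra.
  by rewrite expr2 mulrA ler_piMl ?(ltW p0)//; move: qr; lra.
by move: q144 pq; rewrite -/p; set Q := q^-1 ^+ 4; lra.
Qed.

Lemma remainder_bound8 n z : (n <= N)%N -> `|remainder N n z| <= 1 / 8.
Proof.
move=> nN; apply: le_trans (remainder_bound z nN) _.
by rewrite ler_wpM2r// exprn_ile1 ?qX1// (ltW (qX n)).
Qed.

Lemma eff_pot_bound n z : (0 < n <= N)%N -> `|V N n z| <= (q ^+ n) ^+ 7.
Proof.
by move=> n0N; apply: eff_pot_bound_of => //; apply: remainder_bound8; case/andP: n0N.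
Qed.

(** At scale 0 the noise term is at most 1/2, the chaos 1/4, the remainder 1/8,
    and the renormalised mass r is at least 1: hence V_0 stays away from 0. *)
Lemma eff_pot0_bound z : 1 / 8 <= V N 0 z.
Proof.
have -> : V N 0 z = g * X 0%N z + (remainder N 0 z + r + g ^+ 2 * second_chaos N 0 z).
  by rewrite eff_potE /remainder /mass muln0 expr0 invr1 !mulr1 mul1r; ring.
have := remainder_bound8 z (leq0n N); have := chaosB z (leq0n N); have := noiseB 0 z.
rewrite expr0 invr1.
have -> : g * `|X 0%N z| = `|g * X 0%N z| by rewrite normrM gtr0_norm.
have -> : g ^+ 2 * `|second_chaos N 0 z| = `|g ^+ 2 * second_chaos N 0 z|.
  by rewrite normrM ger0_norm ?sqr_ge0.
by move: r1; rewrite !ler_norml; lra.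
Qed.

End OneScale.

Section TwoScales.
Variables (N M : nat) (tau : R).
Hypothesis NM : (N <= M)%N.
Hypothesis chaosB : forall K n z, (n <= K)%N -> g ^+ 2 * `|second_chaos K n z| <= q ^- n / 4.
Hypothesis tau0 : 0 <= tau.
Hypothesis chaosD : forall n z, (n <= N)%N ->
  g ^+ 2 * `|second_chaos M n z - second_chaos N n z| <= tau * q ^- n ^+ 2.

Let E := tau + (q ^+ N) ^+ 4.

Let E0 : 0 <= E.
Proof. by rewrite addr_ge0 ?qXX. Qed.

(** The weight q^-2n dominates the growth q^-n of each second chaos, so that the
    differences at all scales are small together. *)
Lemma marginal_diff n z : (n <= N)%N ->
  `|remainder M n z - remainder N n z| <= E ->
  `|marginal M n z - marginal N n z| <= 2 * E * q ^- n ^+ 2.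
Proof.
move=> nN rE.
have -> : marginal M n z - marginal N n z = remainder M n z - remainder N n z +
   g ^+ 2 * (second_chaos M n z - second_chaos N n z) by rewrite /remainder; ring.
rewrite (le_trans (ler_normD _ _))// normrM (ger0_norm (sqr_ge0 g)).
have -> : 2 * E * q ^- n ^+ 2 = E * q ^- n ^+ 2 + E * q ^- n ^+ 2 by ring.
apply: lerD.
  rewrite (le_trans rE)// -[leLHS]mulr1 ler_wpM2l// expr2 mulr_ege1//;
  by rewrite -[leLHS]invr1 lef_pV2 ?posrE.
rewrite (le_trans (chaosD z nN))// ler_wpM2r ?sqr_ge0// /E lerDl qXX//.
Qed.

(** The two remainders start at scale N from 0 and from a quantity of order
    q^4N. One step of the recursion adds E times at most 18 p^5 with p =
    q^m, which the slack of (p / q)^4 over p^4 absorbs. *)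
Lemma remainder_diff n z : (n <= N)%N ->
  `|remainder M n z - remainder N n z| <= E * (1 / 8 + (q ^+ n) ^+ 4 / 2).
Proof.
move=> nN; rewrite -(subKn nN); move: (N - n)%N (leq_subr n N) => k.
elim: k z => [|k IH] z kN.
  rewrite subn0 remainder_top subr0.
  rewrite (le_trans (remainder_bound (fun n z => @chaosB M n z) z NM))//.
  have : (q ^+ N) ^+ 4 / 8 <= E / 8 by rewrite ler_wpM2r// /E lerDr.
  have := mulr_ge0 E0 (qXX N 4); lra.
have lt : (N - k.+1 < N)%N by rewrite ltn_subrL; case: (N) kN.
rewrite !remainderS ?(leq_trans lt)// subnSK//; set m := (N - k)%N.
have m1 : m = (N - k.+1).+1 by rewrite subnSK.
have m0N : (0 < m <= N)%N by rewrite m1.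
have m0M : (0 < m <= M)%N by rewrite m1 (leq_trans lt).
have {}IH y : `|remainder M m y - remainder N m y| <= E * (1 / 8 + (q ^+ m) ^+ 4 / 2).
  by apply: IH; apply: ltnW.
rewrite -/m.
have pq : q ^+ m <= q.
  by rewrite -[leRHS]expr1 ler_wiXn2l ?(ltW q0)//; [by move: q144; lra|rewrite m1].
have cL := card_block L0.
have p4 : (q ^+ m) ^+ 4 <= 1 by rewrite exprn_ile1 ?qX1// (ltW (qX m)).
have mD y : `|marginal M m y - marginal N m y| <= 2 * E * q ^- m ^+ 2.
  apply: marginal_diff; first by case/andP: m0N.
  rewrite (le_trans (IH y))// -[leRHS]mulr1 ler_wpM2l//; lra.
have VM i := eff_pot_bound (fun n z => @chaosB M n z) (desc z (i : 'I_L * 'I_L)) m0M.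
have VN i := eff_pot_bound (fun n z => @chaosB N n z) (desc z (i : 'I_L * 'I_L)) m0N.
move: (qX m) (qX1 m) IH mD pq VM VN p4; set p := q ^+ m => p0 p1 IH mD pq VM VN p4.
have p7 : 0 <= p ^+ 7 <= 1 / 8.
  rewrite (qXX m 7) /= exprS.
  have : p ^+ 6 <= 1 by rewrite exprn_ile1 ?p1// (ltW p0).
  have := qXX m 6; rewrite -/p.
  by move: pq q144; rewrite -/p; set P := p ^+ 6; nra.
have VD (i : 'I_L * 'I_L) : `|V M m (desc z i) - V N m (desc z i)| <= p ^+ 16 * (2 * E * p^-1 ^+ 2).
  rewrite !eff_potE opprD addrACA subrr add0r -mulrBr normrM invLX2 ger0_norm ?qXX//.
  by rewrite ler_wpM2l ?qXX.
have F := Phi_lip cL p7 VM VN VD.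
set PM := Phi _ in F *; set PN := Phi _ in F *; set nv := noise_var _ _.
set bM := bmean _ _ _; set bN := bmean _ _ _; set c := L%:R ^+ _.
have -> : bM + c * (PM - nv) - (bN + c * (PN - nv)) = bM - bN + c * (PM - PN) by ring.
rewrite (le_trans (ler_normD _ _))//.
apply: (@le_trans _ _ (E * (1 / 8 + p ^+ 4 / 2) + p ^- 16 * (9 * p ^+ 7 * (p ^+ 16 * (2 * E * p^-1 ^+ 2))))).
  apply: lerD; first by rewrite /bM /bN /bmean -meanB; apply: ler_norm_mean.
  have -> : c = p ^- 16 by rewrite /c -[LHS]invrK invLX2.
  have p16 : 0 <= p ^- 16 by rewrite invr_ge0 qXX.
  by rewrite normrM (ger0_norm p16) ler_wpM2l.
have -> : (q ^+ (N - k.+1)) = p / q.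
  by rewrite /p m1 exprS mulrAC divff ?mul1r// gt_eqF.
have -> : p ^- 16 * (9 * p ^+ 7 * (p ^+ 16 * (2 * E * p^-1 ^+ 2))) = E * (18 * p ^+ 4 * p).
  by have := lt0r_neq0 p0 => pn; field.
have -> : (p / q) ^+ 4 = p ^+ 4 * q^-1 ^+ 4 by rewrite -exprMn.
rewrite -mulrDr ler_wpM2l//.
have q1 : 2 <= q^-1 by rewrite -[leLHS]invrK lef_pV2 ?posrE//; move: q144; lra.
have : 2 ^+ 4 <= q^-1 ^+ 4 by rewrite lerXn2r// ?nnegrE//; lra.
by have := qXX m 4; move: q144 pq; rewrite -/p; set Q := q^-1 ^+ 4; set P4 := p ^+ 4; nra.
Qed.

Lemma marginal_diff_bound n z : (n <= N)%N ->
  `|marginal M n z - marginal N n z| <= 2 * E * q ^- n ^+ 2.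
Proof.
move=> nN; apply: marginal_diff => //; rewrite (le_trans (remainder_diff z nN))//.
have p4 : (q ^+ n) ^+ 4 <= 1 by rewrite exprn_ile1 ?qX1// (ltW (qX n)).
by rewrite -[leRHS]mulr1 ler_wpM2l//; lra.
Qed.

End TwoScales.

Section Limit.
Hypothesis chaosB : forall K n z, (n <= K)%N -> g ^+ 2 * `|second_chaos K n z| <= q ^- n / 4.
Hypothesis chaos_cauchy : forall n e, 0 < e -> exists N0, forall N M z,
  (N0 <= N <= M)%N -> g ^+ 2 * `|second_chaos M n z - second_chaos N n z| <= e.

Let qX_small e : 0 < e -> exists K, forall n, (K <= n)%N -> q ^+ n <= e.
Proof.
move=> e0; have q1 : `|q| < 1 by rewrite gtr0_norm//; move: q144; lra.
have /cvgrPdist_le/(_ e e0)[K _ HK] := cvg_expr q1.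
exists K => n Kn; have := HK n Kn.
by rewrite /= sub0r normrN ger0_norm// ltW.
Qed.

(** For n large the weighted difference is small because the chaoses grow only
    like q^-n; the finitely many remaining scales are handled by
    convergence. *)
Lemma chaos_weighted e : 0 < e -> exists N0, forall N M n z,
  (N0 <= N <= M)%N -> (n <= N)%N ->
  g ^+ 2 * `|second_chaos M n z - second_chaos N n z| <= e * q ^- n ^+ 2.
Proof.
move=> e0; have [K HK] := qX_small e0.
have q1 n : 1 <= q ^- n by rewrite -[leLHS]invr1 lef_pV2 ?posrE.
have [N0 HN0] : exists N0, forall N M n z, (N0 <= N <= M)%N -> (n < K)%N ->
    g ^+ 2 * `|second_chaos M n z - second_chaos N n z| <= e.
  elim: (K) => [|k [N1 H1]]; first by exists 0%N.
  have [N2 H2] := chaos_cauchy k e0; exists (maxn N1 N2) => N M n z.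
  rewrite geq_max -andbA => /and3P[N1N N2N NM]; rewrite ltnS leq_eqVlt => /predU1P[->|nk].
    by apply: H2; rewrite N2N.
  by apply: H1; rewrite ?N1N.
exists N0 => N M n z NM nN; have [nK|Kn] := ltnP n K.
  rewrite (le_trans (HN0 _ _ _ _ NM nK))// -[leLHS]mulr1 ler_wpM2l ?(ltW e0)//.
  by rewrite expr2 mulr_ege1.
have nM : (n <= M)%N by case/andP: NM => _; apply: leq_trans.
apply: (@le_trans _ _ (q ^- n)).
  apply: (@le_trans _ _ (g ^+ 2 * `|second_chaos M n z| + g ^+ 2 * `|second_chaos N n z|)).
    by rewrite -mulrDr ler_wpM2l ?sqr_ge0// ler_normB.
  by have := chaosB z nM; have := chaosB z nN; have := q1 n; lra.
rewrite expr2 mulrA -[leLHS]mul1r ler_wpM2r ?invr_ge0 ?(ltW (qX n))//.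
by rewrite ler_pdivlMr// mul1r HK.
Qed.

Lemma marginal_cvg n z : cvgn (fun N => marginal N n z).
Proof.
apply: cauchy_seq_cvg => e e0.
pose e' := e * q ^+ n ^+ 2 / 4.
have e'0 : 0 < e' by rewrite divr_gt0// mulr_gt0// exprn_gt0.
have [N1 H1] := chaos_weighted e'0; have [K HK] := qX_small e'0.
exists (maxn n (maxn N1 K)) => M; set N := maxn n _ => NM.
have nN : (n <= N)%N by rewrite leq_maxl.
have N1N : (N1 <= N)%N by rewrite /N maxnCA leq_maxl.
have KN : (K <= N)%N by rewrite /N maxnA leq_maxr.
have H n' z' : (n' <= N)%N -> g ^+ 2 * `|second_chaos M n' z' - second_chaos N n' z'| <=
    e' * q ^- n' ^+ 2 by apply: H1; rewrite N1N.
rewrite (le_trans (marginal_diff_bound NM chaosB (ltW e'0) H z nN))//.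
have N4 : (q ^+ N) ^+ 4 <= e'.
  by rewrite (le_trans _ (HK N KN))// exprS ler_piMr ?(ltW (qX N))// exprn_ile1 ?qX1// (ltW (qX N)).
have -> : e = 2 * (e' + e') * q ^- n ^+ 2.
  by rewrite /e'; have := lt0r_neq0 (qX n); set p := q ^+ n => p0; field.
by rewrite ler_wpM2r ?sqr_ge0// ler_wpM2l// lerD2l.
Qed.

Lemma eff_pot_cvg n z : cvgn (fun N => V N n z).
Proof.
rewrite (_ : (fun N => _) = (fun N => g * (L%:R ^+ n)^-1 * X n z + (L%:R ^+ (2 * n))^-1 * marginal N n z)).
  by apply: is_cvgD; [exact: is_cvg_cst|apply: is_cvgMl_tmp; exact: marginal_cvg].
by apply/funext => N; rewrite eff_potE.
Qed.

Lemma is_cvgV_ge (u : nat -> R) c K : 0 < c -> (forall N, (K <= N)%N -> c <= u N) ->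
  cvgn u -> cvgn (fun N => (u N)^-1).
Proof.
move=> c0 uc cu; apply: is_cvgV => //; apply: lt0r_neq0.
by apply: (lt_le_trans c0); apply: limr_ge => //; exists K.
Qed.

Let hf N n := hfun L g (mass L r g N) X N n.

Lemma eff_pot_small N n z : (0 < n <= N)%N -> `|V N n z| <= 1 / 8.
Proof.
move=> n0N; rewrite (le_trans (eff_pot_bound (fun n z => @chaosB N n z) z n0N))//.
have pq : q ^+ n <= q.
  by rewrite -[leRHS]expr1 ler_wiXn2l ?(ltW q0)//; [by move: q144; lra|case/andP: n0N].
have : (q ^+ n) ^+ 7 <= q ^+ n by rewrite exprS ler_piMr ?(ltW (qX n))// exprn_ile1 ?qX1// (ltW (qX n)).
by move: q144; lra.
Qed.

Let c18 : 0 <= (1 / 8 : R) <= 1 / 8. Proof. lra. Qed.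

Lemma bmean_hf_ge N n z : (0 < n <= N)%N -> 8 / 9 <= bmean L (hf N n) z.
Proof.
move=> n0N; have /andP[+ _] := hmean_bounds (card_block L0) c18 (v := fun p => V N n (desc z p)) (fun p => eff_pot_small _ n0N).
by apply: le_trans; rewrite -[leLHS]invrK lef_pV2 ?posrE//; lra.
Qed.

Lemma hf_cvg n z : (0 < n)%N -> cvgn (fun N => hf N n z).
Proof.
move=> n0; apply: (@is_cvgV_ge _ (7 / 8) n) => // [N nN|].
  by have := @eff_pot_small N n z; rewrite n0 nN => /(_ isT); rewrite ler_norml; lra.
by apply: is_cvgB; [exact: is_cvg_cst|exact: eff_pot_cvg].
Qed.

Lemma bmean_hf_cvg n z : (0 < n)%N -> cvgn (fun N => bmean L (hf N n) z).
Proof.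
move=> n0; apply/cvg_ex; exists (bmean L (fun y => limn (fun N => hf N n y)) z).
by apply: cvg_bmean => y; exact: hf_cvg.
Qed.

Notation s N := (sol L g (mass L r g N) X N).

Lemma sol_cvg n z : cvgn (fun N => s N n z).
Proof.
elim: n z => [|n IH] z /=.
  apply: is_cvgN; apply: (@is_cvgV_ge _ (1 / 8) 0) => // [N _|]; last exact: eff_pot_cvg.
  exact: (eff_pot0_bound (fun n z => @chaosB N n z)).
apply: is_cvgM; first exact: IH.
apply: is_cvgM; first exact: hf_cvg.
apply: (@is_cvgV_ge _ (8 / 9) n.+1) => // [N nN|]; last exact: bmean_hf_cvg.
exact: bmean_hf_ge.
Qed.

Lemma hf_ratio N n y d : (0 < n <= N)%N -> 0 <= d <= 1 / 8 ->
  (forall z, `|V N n z| <= d) -> `|hf N n y / bmean L (hf N n) (anc L y) - 1| <= 3 * d.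
Proof.
move=> n0N d8 Vd.
have [H0 /andP[H1 H2]] := inv_hmean_bounds (card_block L0) d8 (v := fun p => V N n (desc (anc L y) p)) (fun p => Vd _).
rewrite -/(bmean L (hf N n) (anc L y)) -/(hf N n) in H0 H1 H2.
have := Vd y; rewrite ler_norml => Vy.
have v0 : 0 < 1 - V N n y by lra.
have h1 : hf N n y <= (1 - d)^-1 by rewrite lef_pV2 ?posrE//; lra.
have h2 : (1 + d)^-1 <= hf N n y by rewrite lef_pV2 ?posrE//; lra.
move: H1 H2; rewrite -/(bmean L (hf N n) (anc L y)); set H := (bmean _ _ _)^-1 => H1 H2.
have h0 : 0 < hf N n y by rewrite invr_gt0.
have u : hf N n y * H <= (1 - d)^-1 * (1 + d) by rewrite ler_pM//; [exact: ltW|lra].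
have l : (1 + d)^-1 * (1 - d) <= hf N n y * H.
  by rewrite ler_pM// ?invr_ge0; lra.
have u' : (1 - d)^-1 * (1 + d) <= 1 + 3 * d by rewrite [leLHS]mulrC ler_pdivrMr; nra.
have l' : 1 - 3 * d <= (1 + d)^-1 * (1 - d) by rewrite [leRHS]mulrC ler_pdivlMr; nra.
by rewrite ler_norml; lra.
Qed.

Lemma sol_step N n y d : (n < N)%N -> 0 <= d <= 1 / 8 ->
  (forall z, `|V N n.+1 z| <= d) -> `|s N n.+1 y - s N n (anc L y)| <= `|s N n (anc L y)| * (3 * d).
Proof.
move=> nN d8 Vd /=; rewrite -[X in _ - X]mulr1 -mulrBr normrM ler_wpM2l//.
exact: (@hf_ratio N n.+1).
Qed.

(** |u_0| = 1 / V_0 is at most 8, and the relative increments are summable; 8 (2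
    - q^n) is a bound that survives the induction. *)
Lemma sol_bound N n y : (n <= N)%N -> `|s N n y| <= 16.
Proof.
move=> nN; suff : `|s N n y| <= 8 * (2 - q ^+ n) by have := qX n; lra.
elim: n y nN => [|n IH] y nN.
  have := eff_pot0_bound (fun n z => @chaosB N n z) y.
  rewrite /= expr0 normrN normfV => V0.
  rewrite ger0_norm; last by move: V0; lra.
  rewrite (_ : 8 * _ = (1 / 8)^-1); last by field.
  by rewrite lef_pV2 ?posrE//; move: V0; lra.
have d7 : 0 <= (q ^+ n.+1) ^+ 7 <= 1 / 8.
  rewrite qXX /=.
  have pq : q ^+ n.+1 <= q by rewrite -[leRHS]expr1 ler_wiXn2l ?(ltW q0)//; move: q144; lra.
  have : (q ^+ n.+1) ^+ 7 <= q ^+ n.+1 by rewrite exprS ler_piMr ?(ltW (qX _))// exprn_ile1 ?qX1// (ltW (qX _)).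
  by move: q144; lra.
have Vb z : `|V N n.+1 z| <= (q ^+ n.+1) ^+ 7.
  by apply: (eff_pot_bound (fun n z => @chaosB N n z)).
have := @sol_step N n y _ nN d7 Vb.
have := IH (anc L y) (ltnW nN).
have p7 : (q ^+ n.+1) ^+ 7 <= q ^+ n.+1.
  by rewrite exprS ler_piMr ?(ltW (qX _))// exprn_ile1 ?qX1// (ltW (qX _)).
have an : 144 * q ^+ n.+1 <= q ^+ n.
  by rewrite exprS mulrA ler_piMl ?(ltW (qX n))//; move: q144; lra.
move: p7 an (qX n) (qX1 n) (qX n.+1) d7; set w := q ^+ n.+1; set a := q ^+ n; set w7 := w ^+ 7.
set t := `|s N n _| => p7 an a0 a1 w0 d7 tb st.
have := ler_normD (s N n.+1 y - s N n (anc L y)) (s N n (anc L y)).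
rewrite subrK -/t => tri.
have : t * (3 * w7) <= 16 * (3 * w7) by rewrite ler_wpM2r//; lra.
by lra.
Qed.

End Limit.

End Renormalisation.

(** * Step functions and cubes of the torus *)

Section StepFunctions.
Context d (T : measurableType d) {R : realType} (mu : {measure set T -> \bar R}).

Lemma bounded_integrable (f : T -> R) (c : R) D :
  measurable D -> (mu D < +oo)%E -> measurable_fun D f ->
  (forall z, D z -> `|f z| <= c) -> mu.-integrable D (EFin \o f).
Proof.
move=> mD Dfin mf fc; apply: measurable_bounded_integrable => //.
exists c; split; first exact: num_real.
by move=> M M1 z Dz /=; rewrite (le_trans _ (ltW M1))// fc.
Qed.

Lemma integral_step (I : finType) (c : I -> R) (A : I -> set T) D :
  measurable D -> (forall i, measurable (A i)) -> (forall i, A i `<=` D) ->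
  (mu D < +oo)%E ->
  mu.-integrable D (EFin \o (fun z => \sum_i c i * \1_(A i) z)) /\
  \int[mu]_(z in D) (\sum_i c i * \1_(A i) z) = \sum_i c i * fine (mu (A i)).
Proof.
move=> mD mA AD Dfin.
have int0 i : mu.-integrable D (EFin \o \1_(A i)).
  apply: (bounded_integrable (c := 1)) => // z _.
  by rewrite indicE; case: (_ \in _); rewrite /= ?normr1 ?normr0.
have int1 i : mu.-integrable D (fun z => (c i * \1_(A i) z)%:E).
  apply: (eq_integrable mD (fun z => (c i)%:E * (\1_(A i) z)%:E)%E).
    by move=> z _; rewrite EFinM.
  by apply: integrableZl => //; apply: int0.
have E : EFin \o (fun z => \sum_i c i * \1_(A i) z) =
    (fun z => \sum_i (c i * \1_(A i) z)%:E)%E.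
  by apply/funext => z; rewrite /= sumEFin.
split; first by rewrite E; apply: integrable_sum.
rewrite /Rintegral -[X in integral _ _ X]/(EFin \o (fun z => \sum_i c i * \1_(A i) z)).
rewrite E integral_sum//.
transitivity (fine (\sum_i (c i * fine (mu (A i)))%:E)%E); last by rewrite sumEFin.
congr fine; apply: eq_bigr => i _.
under eq_integral do rewrite /= EFinM.
have Afin : mu (A i) \is a fin_num.
  rewrite ge0_fin_numE//; apply: le_lt_trans Dfin.
  by apply: le_measure; rewrite ?inE.
rewrite integralZl//; last exact: int0.
by rewrite integral_indic// (setIidl (@AD i)) EFinM fineK.
Qed.

Lemma Rintegral_norm_le (f : T -> R) e D : measurable D -> (mu D < +oo)%E ->
  mu.-integrable D (EFin \o f) -> (forall y, D y -> `|f y| <= e) ->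
  `|\int[mu]_(y in D) f y| <= e * fine (mu D).
Proof.
move=> mD Dfin fD fe; apply: le_trans (le_normr_Rintegral mD fD) _.
rewrite -(Rintegral_cst mu mD e); apply: le_Rintegral => //.
- exact: (integrable_norm fD).
- by apply: (bounded_integrable (c := `|e|)).
Qed.

End StepFunctions.

Section Geometry.
Context {R : realType}.
Variable L : nat.
Hypothesis L0 : (0 < L)%N.
Implicit Types (n m : nat) (p a : nat * nat) (z : R * R).

(** The index of the interval of side L^-n of the torus that contains t. *)
Definition addr1 n (t : R) : nat := Num.truncn ((t + 2^-1) * L%:R ^+ n).

Definition addr n z : nat * nat := (addr1 n z.1, addr1 n z.2).

Definition in_box n p := (p.1 < L ^ n)%N && (p.2 < L ^ n)%N.

Definition pside n (i : nat) : set R :=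
  `[i%:R / L%:R ^+ n - 2^-1, i.+1%:R / L%:R ^+ n - 2^-1[%classic.

Definition pcube n p : set (R * R) := pside n p.1 `*` pside n p.2.

Let Ln n : 0 < L%:R ^+ n :> R.
Proof. by rewrite exprn_gt0// ltr0n. Qed.

Lemma sideE n (i : 'I_(L ^ n)) : side i = pside n i :> set R.
Proof.
rewrite /side /pside /lattice_coord /= -(natr1 i).
have := lt0r_neq0 (Ln n); set l := L%:R ^+ n => l0.
have -> : l^-1 * (i%:R - (l - 1) / 2) - l^-1 / 2 = i%:R / l - 2^-1 by field.
by have -> : l^-1 * (i%:R - (l - 1) / 2) + l^-1 / 2 = (i%:R + 1) / l - 2^-1 by field.
Qed.

Lemma cubeE n (x : site L n) : cube x = pcube n (val x.1, val x.2) :> set (R * R).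
Proof. by rewrite /cube !sideE. Qed.

Lemma torus1E (t : R) : `[- 2^-1, 2^-1[%classic t = (0 <= t + 2^-1 < 1) :> Prop.
Proof.
rewrite set_itvE /=; apply: propext.
by split => /andP[a b]; apply/andP; split; lra.
Qed.

Lemma pside_addr n (t : R) : 0 <= t + 2^-1 -> forall i, pside n i t <-> addr1 n t = i.
Proof.
move=> t0 i; have := Ln n; rewrite /pside /addr1 /= in_itv /=; set l := L%:R ^+ n => l0.
have -> : (i%:R / l - 2^-1 <= t < i.+1%:R / l - 2^-1) = (i%:R <= (t + 2^-1) * l < i.+1%:R).
  by rewrite lerBlDr ltrBrDr ler_pdivrMr// ltr_pdivlMr.
have tl : 0 <= (t + 2^-1) * l by rewrite mulr_ge0// ltW.
by rewrite -truncn_eq//; split => /eqP.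
Qed.

Lemma addr1_lt n (t : R) : 0 <= t + 2^-1 < 1 -> (addr1 n t < L ^ n)%N.
Proof.
move=> /andP[t0 t1]; rewrite /addr1 truncn_lt_nat; last by rewrite mulr_ge0// ltW.
by rewrite natrX -[ltRHS]mul1r ltr_pM2r.
Qed.

Lemma addr1_anc n m (t : R) : 0 <= t + 2^-1 -> (m <= n)%N ->
  addr1 m t = (addr1 n t %/ L ^ (n - m))%N.
Proof.
move=> t0 mn; apply: truncn_def.
have tn : 0 <= (t + 2^-1) * L%:R ^+ n by rewrite mulr_ge0// ltW.
have /andP[] := truncn_itv tn; rewrite -/(addr1 n t).
have -> : L%:R ^+ n = L%:R ^+ m * L%:R ^+ (n - m) :> R by rewrite -exprD subnKC.
rewrite mulrA; set s := (t + 2^-1) * L%:R ^+ m; set k := addr1 n t => k1 k2.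
have l0 := Ln (n - m); have Lk : (0 < L ^ (n - m))%N by rewrite expn_gt0 L0.
apply/andP; split.
  rewrite -(ler_pM2r l0) (le_trans _ k1)// -natrX -natrM ler_nat.
  exact: leq_trunc_div.
rewrite -(ltr_pM2r l0) (lt_le_trans k2)// -natrX -natrM ler_nat.
exact: ltn_ceil.
Qed.

Lemma torusP z : torus z <-> 0 <= z.1 + 2^-1 < 1 /\ 0 <= z.2 + 2^-1 < 1.
Proof. by rewrite /torus /setX /= -!torus1E. Qed.

Lemma addr_anc n m z : torus z -> (m <= n)%N -> addr m z = anc (L ^ (n - m)) (addr n z).
Proof.
move=> /torusP[/andP[z1 _] /andP[z2 _]] mn.
by rewrite /addr /anc /= (addr1_anc z1 mn) (addr1_anc z2 mn).
Qed.

Lemma addr_in_box n z : torus z -> in_box n (addr n z).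
Proof. by move=> /torusP[z1 z2]; rewrite /in_box /= !addr1_lt. Qed.

Lemma pcube_addr n p z : torus z -> pcube n p z <-> addr n z = p.
Proof.
move=> /torusP[/andP[z1 _] /andP[z2 _]]; case: p => i j; rewrite /pcube /setX /= /addr.
by rewrite !pside_addr//; split=> [[<- <-]|[<- <-]].
Qed.

Lemma pside_torus n i (t : R) : (i < L ^ n)%N -> pside n i t -> 0 <= t + 2^-1 < 1.
Proof.
move=> iL; rewrite /pside /= in_itv /= => /andP[t1 t2].
have i0 : 0 <= i%:R / L%:R ^+ n :> R by rewrite divr_ge0// ltW.
have i1 : i.+1%:R / L%:R ^+ n <= 1 :> R by rewrite ler_pdivrMr// mul1r -natrX ler_nat.
by apply/andP; split; lra.
Qed.

Lemma pcube_torus n p z : in_box n p -> pcube n p z -> torus z.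
Proof.
by move=> /andP[p1 p2] [z1 z2]; apply/torusP; split;
  [exact: pside_torus p1 z1|exact: pside_torus p2 z2].
Qed.

Lemma measurable_pcube n p : measurable (pcube n p).
Proof. by apply: measurableX => //; exact: measurable_itv. Qed.

Lemma measurable_torus : measurable (@torus R).
Proof. by apply: measurableX; exact: measurable_itv. Qed.

Lemma leb_pside n i : lebesgue_measure (pside n i) = ((L%:R ^+ n)^-1)%:E :> \bar R.
Proof.
rewrite /pside lebesgue_measure_itv /= lte_fin -EFinB ltrD2r ltr_pM2r ?invr_gt0//.
rewrite ltr_nat ltnSn; congr EFin; rewrite -(natr1 i).
by have := lt0r_neq0 (Ln n) => l0; field.
Qed.

Lemma leb2_pcube n p : leb2 (pcube n p) = ((L%:R ^+ (2 * n))^-1)%:E :> \bar R.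
Proof.
rewrite /leb2 /pcube product_measure1E; [|exact: measurable_itv..].
rewrite [LHS](congr2 mule (leb_pside n p.1) (leb_pside n p.2)).
by rewrite -EFinM -invfM -exprD mul2n addnn.
Qed.

Lemma pcube00 : pcube 0 (0, 0)%N = @torus R.
Proof.
rewrite /pcube /pside /torus /= expr0 !divr1 sub0r.
by have -> : 1 - 2^-1 = 2^-1 :> R by field.
Qed.

Lemma leb2_torus : leb2 (@torus R) = 1%:E.
Proof. by rewrite -pcube00 leb2_pcube muln0 expr0 invr1. Qed.

End Geometry.

(** * Block averages of locally constant functions *)

Section Averages.
Context {R : realType}.
Variable L : nat.
Hypothesis L0 : (0 < L)%N.
Implicit Types (n m : nat) (p a : nat * nat) (z : R * R) (f : nat * nat -> R).

(** The function [embed] of a lattice function, read off the address of z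
    instead of summed over all cubes. *)
Definition emb n f z : R := \1_(@torus R) z * f (addr L n z).

Lemma emb_torus n f z : torus z -> emb n f z = f (addr L n z).
Proof. by move=> tz; rewrite /emb indicE mem_set// mul1r. Qed.

Lemma emb_out n f z : ~ torus z -> emb n f z = 0.
Proof. by move=> tz; rewrite /emb indicE memNset// mul0r. Qed.

Lemma sum_indic_eq (I : finType) (c : I -> R) (A : I -> set (R * R)) i0 z :
  (forall i, A i z <-> i = i0) -> \sum_i c i * \1_(A i) z = c i0.
Proof.
move=> Ai; rewrite (bigD1 i0)//= big1 ?addr0.
  by rewrite indicE mem_set ?mulr1//; apply/Ai.
by move=> i ii0; rewrite indicE memNset ?mulr0// => /Ai /eqP; rewrite (negbTE ii0).
Qed.

Lemma embedE n f : embed (fun x : site L n => f (val x.1, val x.2)) = emb n f.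
Proof.
apply/funext => z; rewrite /embed.
have [tz|tz] := pselect (torus z).
  have /andP[a1 a2] := addr_in_box L0 n tz.
  rewrite (@sum_indic_eq _ _ _ (Ordinal a1, Ordinal a2)) ?emb_torus// => x.
  rewrite cubeE// pcube_addr// /addr; split=> [[e1 e2]|->//].
  by case: x e1 e2 => x1 x2 /= e1 e2; congr pair; apply: val_inj.
rewrite emb_out// big1// => x _; rewrite indicE memNset ?mulr0// cubeE//.
by move=> /(pcube_torus L0) h; apply/tz/h; rewrite /in_box !ltn_ord.
Qed.

Lemma cellE n z : torus z -> cell L n z = pcube L n (addr L n z).
Proof.
move=> tz; apply/seteqP; split=> [y [x [xz xy]]|y zy].
  move: xz xy; rewrite cubeE// => /pcube_addr -/(_ L0 tz) ->.
  by [].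
have ty : torus y by apply: (pcube_torus L0) zy; apply: addr_in_box.
have /andP[a1 a2] := addr_in_box L0 n tz.
exists (Ordinal a1, Ordinal a2); rewrite cubeE//=; split => //.
by apply/pcube_addr.
Qed.

Lemma desc_in_box n m a (p : 'I_(L ^ (m - n)) * 'I_(L ^ (m - n))) : (n <= m)%N ->
  in_box L n a -> in_box L m (desc a p).
Proof.
move=> nm /andP[a1 a2]; have E : (L ^ m = L ^ n * L ^ (m - n))%N by rewrite -expnD subnKC.
rewrite /in_box /desc /= E; apply/andP; split.
  by rewrite (leq_trans (n := a.1.+1 * L ^ (m - n)))// ?leq_pmul2r ?expn_gt0 ?L0// mulSn addnC ltn_add2r.
by rewrite (leq_trans (n := a.2.+1 * L ^ (m - n)))// ?leq_pmul2r ?expn_gt0 ?L0// mulSn addnC ltn_add2r.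
Qed.

Lemma leb2_pcube_lty n a : (leb2 (pcube L n a) < +oo :> \bar R)%E.
Proof. by rewrite leb2_pcube// ltry. Qed.

Lemma pcube_desc_sub n m a (p : 'I_(L ^ (m - n)) * 'I_(L ^ (m - n))) : (n <= m)%N ->
  in_box L n a -> pcube L m (desc a p) `<=` (pcube L n a : set (R * R)).
Proof.
move=> nm a0 y yp; have ty : torus y by apply: (pcube_torus L0) yp; apply: desc_in_box.
apply/pcube_addr => //; rewrite (addr_anc L0 ty nm).
by move/pcube_addr : yp => -> //; rewrite anc_desc.
Qed.

Lemma Qtorus_fine n m f z : torus z -> (n <= m)%N ->
  Qtorus L n (emb m f) z = bmean (L ^ (m - n)) f (addr L n z).
Proof.
move=> tz nm; rewrite /Qtorus cellE//; set a := addr L n z.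
have a0 : in_box L n a by exact: addr_in_box.
pose c (p : 'I_(L ^ (m - n)) * 'I_(L ^ (m - n))) := f (desc a p).
rewrite (eq_Rintegral leb2 (g := fun y => \sum_p c p * \1_(pcube L m (desc a p)) y)); last first.
  move=> y /set_mem ya; have ty : torus y by apply: (pcube_torus L0) ya.
  rewrite emb_torus//; have [p Ep] := desc_anc (addr L m y) (m := L ^ (m - n)) ltac:(by rewrite expn_gt0 L0).
  rewrite -(addr_anc L0 ty nm) in Ep.
  have ya' : addr L n y = a by apply/pcube_addr.
  rewrite ya' in Ep.
  rewrite (@sum_indic_eq _ _ _ p) ?/c ?Ep// => p'.
  rewrite pcube_addr//; split=> [|->//].
  rewrite -Ep /desc => -[] /addnI e1 /addnI e2.
    by case: p p' e1 e2 {Ep} => p1 p2 [q1 q2] /= e1 e2; congr pair; apply: val_inj.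
have [_ ->] := integral_step (mu := leb2) c (measurable_pcube L n a)
   (fun i => measurable_pcube L m (desc a i)) (fun i => @pcube_desc_sub n m a i nm a0) (leb2_pcube_lty n a).
rewrite (eq_bigr (fun i => c i * (L%:R ^+ (2 * m))^-1)); last first.
  by move=> i _; congr (_ * _); exact: (congr1 fine (leb2_pcube L0 m (desc a i))).
rewrite -mulr_suml /bmean /mean card_prod card_ord mulrCA [RHS]mulrC; congr (_ * _).
have l0 k : L%:R ^+ k != 0 :> R by rewrite expf_neq0// pnatr_eq0 -lt0n.
have -> : (2 * m = 2 * n + (m - n + (m - n)))%N by lia.
by rewrite natrM natrX !exprD; field; rewrite !l0.
Qed.

Lemma Qtorus_coarse n m f z : torus z -> (m <= n)%N ->
  Qtorus L n (emb m f) z = f (addr L m z).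
Proof.
move=> tz mn; rewrite /Qtorus cellE//; set a := addr L n z.
have a0 : in_box L n a by exact: addr_in_box.
rewrite (eq_Rintegral leb2 (g := cst (f (addr L m z)))); last first.
  move=> y /set_mem ya; have ty : torus y by apply: (pcube_torus L0) ya.
  rewrite emb_torus// (addr_anc L0 ty mn) (addr_anc L0 tz mn).
  by congr (f (anc _ _)); apply/pcube_addr.
rewrite Rintegral_cst; last exact: measurable_pcube.
transitivity (L%:R ^+ (2 * n) * (f (addr L m z) * (L%:R ^+ (2 * n))^-1)).
  by congr (_ * (_ * _)); exact: (congr1 fine (leb2_pcube L0 n a)).
by rewrite mulrCA divff ?mulr1// expf_neq0// pnatr_eq0 -lt0n.
Qed.

Lemma emb_integrable n f : leb2.-integrable (@torus R) (EFin \o emb n f).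
Proof.
rewrite -embedE; have := integral_step (mu := @leb2 R)
  (fun x : site L n => f (val x.1, val x.2)) (@measurable_torus R)
  (fun x => measurable_pcube L n (val x.1, val x.2)).
have -> : (fun z => \sum_(i : site L n) f (val i.1, val i.2) * \1_(pcube L n (val i.1, val i.2)) z) =
  embed (fun x : site L n => f (val x.1, val x.2)).
  by apply/funext => z; apply: eq_bigr => x _; rewrite cubeE.
case=> //.
- by move=> x y; apply: (pcube_torus L0); rewrite /in_box !ltn_ord.
- have : (leb2 (@torus R) < +oo)%E by rewrite (leb2_torus L0) ltry.
  by [].
Qed.

End Averages.

(** * The function with prescribed block averages *)

Section LimitFunction.
Context {R : realType}.
Variable L : nat.
Hypothesis L0 : (0 < L)%N.
Variable a : nat -> nat * nat -> R.
Hypothesis a_mean : forall n z, bmean L (a n.+1) z = a n z.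
Variables (K th : R).
Hypothesis th01 : 0 < th < 1.
Hypothesis K0 : 0 <= K.
Hypothesis a_incr : forall n y, `|a n.+1 y - a n (anc L y)| <= K * th ^+ n.

Implicit Types (z : R * R) (n m : nat).

(** Pointwise limit of the step functions attached to a consistent family of
    block averages; their increments decay geometrically, so the convergence
    is uniform. *)
Definition limit_fun (z : R * R) : R :=
  \1_(@torus R) z * limn (fun m => a m (addr L m z)).

Let tail_bound n z k : torus z ->
  `|a (n + k)%N (addr L (n + k) z) - a n (addr L n z)| <= K * th ^+ n * (1 - th ^+ k) / (1 - th).
Proof.
case/andP: th01 => th0 th1 tz; elim: k => [|k IH].
  by rewrite addn0 subrr normr0 expr0 subrr mulr0 mul0r.
rewrite addnS; have := a_incr (n + k) (addr L (n + k).+1 z).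
have -> : anc L (addr L (n + k).+1 z) = addr L (n + k) z.
  by rewrite (addr_anc L0 tz (leqnSn (n + k))) subSnn expn1.
move=> i1; rewrite -(subrK (a (n + k)%N (addr L (n + k) z)) (a (n + k).+1 _)) -addrA.
rewrite (le_trans (ler_normD _ _))// (le_trans (lerD i1 IH))//.
rewrite exprD exprS le_eqVlt; apply/orP; left; apply/eqP.
by field; apply: lt0r_neq0; lra.
Qed.

Let c := K / (1 - th).

Let c0 : 0 <= c.
Proof. by case/andP: th01 => th0 th1; rewrite divr_ge0// subr_ge0 ltW. Qed.

Let tail n m z : torus z -> (n <= m)%N -> `|a m (addr L m z) - a n (addr L n z)| <= c * th ^+ n.
Proof.
case/andP: th01 => th0 th1 tz nm; rewrite -(subnKC nm) (le_trans (tail_bound _ _ tz))//.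
rewrite /c; set A := K / (1 - th) * th ^+ n.
have A0 : 0 <= A by rewrite mulr_ge0// exprn_ge0// ltW.
rewrite [leLHS](_ : _ = A - A * th ^+ (m - n)); last by rewrite /A; ring.
by rewrite gerBl mulr_ge0// exprn_ge0// ltW.
Qed.

Let th_small e : 0 < e -> exists M, forall n, (M <= n)%N -> c * th ^+ n <= e.
Proof.
move=> e0; case/andP: th01 => th0 th1.
have nth : `|th| < 1 by rewrite gtr0_norm.
have e1 : 0 < e / (c + 1) by rewrite divr_gt0// ltr_wpDl.
have /cvgrPdist_le/(_ _ e1)[M _ HM] := cvg_expr nth.
exists M => n Mn; have := HM n Mn.
rewrite /= sub0r normrN ger0_norm; last by rewrite exprn_ge0// ltW.
rewrite ler_pdivlMr ?ltr_wpDl//; apply: le_trans.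
by rewrite mulrC ler_wpM2l ?exprn_ge0 ?(ltW th0)// lerDl.
Qed.

Let seq_cvg z : torus z -> cvgn (fun m => a m (addr L m z)).
Proof.
move=> tz; apply: cauchy_seq_cvg => e /th_small[M HM].
by exists M => N MN; rewrite (le_trans (tail tz MN))// HM.
Qed.

Lemma limit_fun_approx n z : torus z -> `|limit_fun z - a n (addr L n z)| <= c * th ^+ n.
Proof.
move=> tz; rewrite /limit_fun indicE mem_set// mul1r.
set l := limn _.
have h : (fun m => `|a m (addr L m z) - a n (addr L n z)|) @ \oo --> `|l - a n (addr L n z)|.
  apply: cvg_norm; apply: cvgB; [exact: seq_cvg|exact: cvg_cst].
rewrite -(cvg_lim _ h)//; apply: limr_le; first by apply/cvg_ex; eexists; exact: h.
by exists n => // m /= nm; apply: tail.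
Qed.

Lemma limit_fun_measurable : measurable_fun (@torus R) limit_fun.
Proof.
apply: (@measurable_fun_cvg _ _ _ _ (fun m => emb L m (a m))).
  by move=> m; have /measurable_int/measurable_EFinP := emb_integrable L0 m (a m).
move=> z tz; rewrite /limit_fun indicE mem_set// mul1r.
rewrite (_ : (fun m => _) = fun m => a m (addr L m z)); first exact: seq_cvg.
by apply/funext => m; rewrite emb_torus.
Qed.

Let leb2_lty : (leb2 (@torus R) < +oo)%E.
Proof. by rewrite (leb2_torus L0) ltry. Qed.

Lemma limit_fun_bound z : torus z -> `|limit_fun z| <= `|a 0%N (0, 0)%N| + c.
Proof.
move=> tz; have := limit_fun_approx 0 tz; rewrite expr0 mulr1.
have -> : addr L 0 z = (0, 0)%N.
  have := addr_in_box L0 0 tz; rewrite /in_box expn0 !ltnS !leqn0.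
  by case: (addr _ _ _) => i j /= /andP[/eqP-> /eqP->].
by move=> h; rewrite -[limit_fun z](subrK (a 0%N (0, 0)%N)) (le_trans (ler_normD _ _))// addrC lerD2l.
Qed.

Lemma limit_fun_integrable : leb2.-integrable (@torus R) (EFin \o limit_fun).
Proof.
apply: (bounded_integrable (c := `|a 0%N (0, 0)%N| + c)) => //.
- exact: measurable_torus.
- exact: limit_fun_measurable.
- exact: limit_fun_bound.
Qed.

Let cell_sub n z : torus z -> pcube L n (addr L n z) `<=` @torus R.
Proof. by move=> tz y; apply: (pcube_torus L0); apply: addr_in_box. Qed.

Let integrable_pcube f n z : torus z -> leb2.-integrable (@torus R) (EFin \o f) ->
  leb2.-integrable (pcube L n (addr L n z)) (EFin \o f).
Proof.
move=> tz; apply: integrableS; [exact: measurable_torus|exact: measurable_pcube|exact: cell_sub].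
Qed.

Lemma QtorusB n (f h : R * R -> R) z : torus z ->
  leb2.-integrable (@torus R) (EFin \o f) -> leb2.-integrable (@torus R) (EFin \o h) ->
  Qtorus L n (f \- h) z = Qtorus L n f z - Qtorus L n h z.
Proof.
move=> tz fi hi; rewrite /Qtorus cellE// -mulrBr; congr (_ * _).
by apply: RintegralB; [exact: measurable_pcube|exact: integrable_pcube..].
Qed.

Lemma Qtorus_bound n (f : R * R -> R) z e : torus z ->
  leb2.-integrable (@torus R) (EFin \o f) -> (forall y, torus y -> `|f y| <= e) ->
  `|Qtorus L n f z| <= e.
Proof.
move=> tz fi fe; rewrite /Qtorus cellE//; set A := pcube _ _ _.
have l0 : 0 < L%:R ^+ (2 * n) :> R by rewrite exprn_gt0// ltr0n.
have mA : measurable A by exact: measurable_pcube.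
have fA : leb2.-integrable A (EFin \o f) by exact: integrable_pcube.
have Afin : (leb2 A < +oo)%E by rewrite leb2_pcube// ltry.
have := Rintegral_norm_le (mu := leb2) mA Afin fA (fun y Ay => fe y (@cell_sub n z tz y Ay)).
have -> : fine (leb2 A) = (L%:R ^+ (2 * n))^-1 by rewrite leb2_pcube.
by move=> h; rewrite normrM (gtr0_norm l0) mulrC -ler_pdivlMr.
Qed.

Lemma bmean_iter n k (z : nat * nat) : bmean (L ^ k) (a (n + k)) z = a n z.
Proof.
elim: k z => [|k IH] z; first by rewrite expn0 bmean1 addn0.
rewrite expnSr -bmean_comp -[RHS]IH; apply: eq_bmean => y.
by rewrite addnS a_mean.
Qed.

(** The step functions of scale m >= n have the prescribed averages at scale n,
    and converge uniformly. *)
Lemma Qtorus_limit n z : torus z -> Qtorus L n limit_fun z = a n (addr L n z).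
Proof.
move=> tz; apply/eqP; rewrite -subr_eq0 -normr_le0; apply/ler_addgt0Pr => e e0.
have [M HM] := th_small e0; set m := maxn n M.
have nm : (n <= m)%N by rewrite leq_maxl.
have -> : a n (addr L n z) = Qtorus L n (emb L m (a m)) z.
  by rewrite Qtorus_fine// -{2}(subnKC nm) bmean_iter.
rewrite -QtorusB//; last 2 first.
- exact: limit_fun_integrable.
- exact: emb_integrable.
rewrite add0r; apply: Qtorus_bound => //.
  have -> : EFin \o (limit_fun \- emb L m (a m)) =
     (fun z => (EFin \o limit_fun) z - (EFin \o emb L m (a m)) z)%E by [].
  by apply: integrableB; [exact: measurable_torus|exact: limit_fun_integrable|exact: emb_integrable].
move=> y ty /=; rewrite emb_torus// (le_trans (limit_fun_approx m ty))// HM//.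
exact: leq_maxr.
Qed.

End LimitFunction.

(** * Convergence in the hierarchical Hoelder norm *)

Section HolderNorm.
Context {R : realType}.
Variable L : nat.
Hypothesis L0 : (0 < L)%N.

Lemma torus0 : torus ((0, 0) : R * R).
Proof. by apply/torusP; rewrite /= add0r invr_ge0 ler0n invf_lt1// ltr1n. Qed.

(** Both parts of the norm only involve the averages Q_n, on which bounds are
    given at each scale. *)
Lemma holder_norm_le (beta e : R) (f h : R * R -> R) :
  leb2.-integrable (@torus R) (EFin \o f) -> leb2.-integrable (@torus R) (EFin \o h) ->
  (forall z, torus z -> `|Qtorus L 0 f z - Qtorus L 0 h z| <= e) ->
  (forall n z, torus z ->
    (L%:R `^ beta) ^+ n.+1 * `|(Qtorus L n.+1 f z - Qtorus L n f z) -
                         (Qtorus L n.+1 h z - Qtorus L n h z)| <= e) ->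
  (0 <= holder_norm L beta (f \- h)%R <= (e + e)%:E)%E.
Proof.
move=> fi hi Q0 Pn; rewrite /holder_norm; apply/andP; split.
  rewrite adde_ge0 ?lee_fin//.
  apply: (@le_trans _ _ ((L%:R `^ (beta * 1%:R))%R%:E *
      ereal_sup [set `|Ptorus L 1 (f \- h) z|%:E | z in @torus R])%E).
    rewrite mule_ge0// ?lee_fin ?powR_ge0//.
    apply: (@le_trans _ _ (`|Ptorus L 1 (f \- h) (0, 0)|%:E)); first by rewrite lee_fin.
    by apply: ereal_sup_ubound; exists (0, 0) => //; exact: torus0.
  by apply: ereal_sup_ubound; exists 1%N.
rewrite EFinD leeD//.
  by rewrite lee_fin QtorusB//; [apply: Q0|]; exact: torus0.
apply: ge_ereal_sup => _ [[//|n] _ <-].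
have b0 : 0 < L%:R `^ (beta * n.+1%:R) :> R by rewrite powR_gt0// ltr0n.
rewrite -lee_pdivlMl//; apply: ge_ereal_sup => _ [z tz <-].
rewrite lee_pdivlMl// -EFinM lee_fin powRrM powR_mulrn ?powR_ge0//.
rewrite /Ptorus !QtorusB//=.
have := Pn n z tz.
set A := Qtorus L n.+1 f z; set B := Qtorus L n f z.
set C := Qtorus L n.+1 h z; set D := Qtorus L n h z.
by have -> : A - B - (C - D) = A - C - (B - D) by ring.
Qed.

Lemma cvg_unif_box (u : nat -> nat * nat -> R) (l : nat * nat -> R) n e : 0 < e ->
  (forall p, u N p @[N --> \oo] --> l p) ->
  exists N0, forall N, (N0 <= N)%N -> forall p, in_box L n p -> `|u N p - l p| <= e.
Proof.
move=> e0 ul.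
have [N0 _ HN0] : \forall N \near \oo, forall x : site L n,
    `|u N (val x.1, val x.2) - l (val x.1, val x.2)| <= e.
  apply: filter_forall => x; have /cvgrPdist_le/(_ e e0) := ul (val x.1, val x.2).
  by apply: filterS => N; rewrite distrC.
exists N0 => N NN [i j] /andP[/= i0 j0].
exact: (HN0 N NN (Ordinal i0, Ordinal j0)).
Qed.

Lemma cvg_unif_boxes (u : nat -> nat -> nat * nat -> R) (l : nat -> nat * nat -> R) M e : 0 < e ->
  (forall n p, u N n p @[N --> \oo] --> l n p) ->
  exists N0, forall N, (N0 <= N)%N -> forall n p, (n <= M)%N -> in_box L n p -> `|u N n p - l n p| <= e.
Proof.
move=> e0 ul; elim: M => [|M [N1 H1]].
  have [N0 H0] := cvg_unif_box 0 e0 (ul 0%N); exists N0 => N NN n p.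
  by rewrite leqn0 => /eqP ->; apply: H0.
have [N2 H2] := cvg_unif_box M.+1 e0 (ul M.+1); exists (maxn N1 N2) => N.
rewrite geq_max => /andP[n1 n2] n p; rewrite leq_eqVlt => /predU1P[->|nM].
  exact: H2.
exact: H1.
Qed.

End HolderNorm.

Section HolderLimit.
Context {R : realType}.
Variable L : nat.
Hypothesis L1 : (1 < L)%N.
Variable a : nat -> nat -> nat * nat -> R.
Hypothesis a_mean : forall N n z, (n < N)%N -> bmean L (a N n.+1) z = a N n z.
Hypothesis a_cvg : forall n z, cvgn (fun N => a N n z).
Hypothesis a_incr : forall kappa, 0 < kappa < 1 -> exists2 K, 0 <= K &
  forall N n y, (n < N)%N ->
    `|a N n.+1 y - a N n (anc L y)| <= K * (L%:R `^ (1 - kappa)) ^- n.+1.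

Let L0 : (0 < L)%N. Proof. exact: ltnW. Qed.

Let ainf n z := limn (fun N => a N n z).

Let ainf_mean n z : bmean L (ainf n.+1) z = ainf n z.
Proof.
have h1 : bmean L (a N n.+1) z @[N --> \oo] --> bmean L (ainf n.+1) z.
  by apply: cvg_bmean => y; exact: a_cvg.
have h2 : bmean L (a N n.+1) z @[N --> \oo] --> ainf n z.
  apply: (@cvg_trans _ (a N n z @[N --> \oo])); last exact: a_cvg.
  by apply: near_eq_cvg; exists n.+1 => // N /= nN; rewrite a_mean.
exact: (cvg_unique _ h1 h2).
Qed.

Let ainf_incr n y c : (forall N, (n < N)%N -> `|a N n.+1 y - a N n (anc L y)| <= c) ->
  `|ainf n.+1 y - ainf n (anc L y)| <= c.
Proof.
move=> ac.
have h : `|a N n.+1 y - a N n (anc L y)| @[N --> \oo] --> `|ainf n.+1 y - ainf n (anc L y)|.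
  by apply: cvg_norm; apply: cvgB; exact: a_cvg.
rewrite -(cvg_lim _ h)//; apply: limr_le; first by apply/cvg_ex; eexists; exact: h.
by exists n.+1 => // N /= nN; apply: ac.
Qed.

Let base_gt1 s : 0 < s -> 1 < L%:R `^ s :> R.
Proof. by move=> s0; rewrite /powR pnatr_eq0 gtn_eqF// expR_gt1 mulr_gt0// ln_gt0// ltr1n. Qed.

Let half01 : 0 < (1 / 2 : R) < 1. Proof. lra. Qed.

Definition holder_limit_fun := limit_fun L ainf.

Let limit_setup : exists K th : R, [/\ 0 <= K, 0 < th < 1 &
  forall n y, `|ainf n.+1 y - ainf n (anc L y)| <= K * th ^+ n].
Proof.
have [K K0 HK] := a_incr half01; have b1 := @base_gt1 (1 - 1 / 2) ltac:(lra).
have b0 : 0 < L%:R `^ (1 - 1 / 2) :> R by apply: lt_trans b1.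
exists K, (L%:R `^ (1 - 1 / 2))^-1; split => //.
  by rewrite invr_gt0 b0 invf_lt1.
move=> n y; apply: ainf_incr => N nN; rewrite (le_trans (HK N n y nN))//.
rewrite ler_wpM2l// exprVn lef_pV2 ?posrE ?exprn_gt0// exprS ler_peMl ?exprn_ge0 ?(ltW b0)//.
exact: ltW.
Qed.

Let lf_integrable : leb2.-integrable (@torus R) (EFin \o holder_limit_fun).
Proof.
have [K [th [K0 th01 HK]]] := limit_setup.
exact: (limit_fun_integrable L0 th01 K0 HK).
Qed.

Let Qlf n z : torus z -> Qtorus L n holder_limit_fun z = ainf n (addr L n z).
Proof.
have [K [th [K0 th01 HK]]] := limit_setup.
exact: (Qtorus_limit L0 ainf_mean th01 K0 HK).
Qed.

Let Qemb N n z : torus z -> Qtorus L n (emb L N (a N N)) z =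
  if (n <= N)%N then a N n (addr L n z) else a N N (addr L N z).
Proof.
move=> tz; case: ifPn => [nN|]; last by rewrite -ltnNge => /ltnW Nn; rewrite Qtorus_coarse.
rewrite Qtorus_fine//; have : forall k, (k <= N - n)%N -> forall z, bmean (L ^ k) (a N (n + k)%N) z = a N n z.
  elim=> [|k IH] kN y; first by rewrite expn0 bmean1 addn0.
  rewrite expnSr -bmean_comp -[RHS]IH; last exact: ltnW.
  by apply: eq_bmean => y'; rewrite addnS a_mean//; lia.
by move=> /(_ (N - n)%N (leqnn _)); rewrite subnKC.
Qed.

(** On the scales n >= M both increments are O(L^(-(1 - kappa/2) n)), and the
    spare exponent kappa / 2 makes their weighted norm small. Only finitely
    many blocks live on the scales n < M, where the convergence in N is
    uniform. *)
Let main_estimate kappa e : 0 < kappa < 1 -> 0 < e -> exists N0, forall N, (N0 <= N)%N ->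
  (forall z, torus z -> `|Qtorus L 0 (emb L N (a N N)) z - Qtorus L 0 holder_limit_fun z| <= e) /\
  (forall n z, torus z -> (L%:R `^ (1 - kappa)) ^+ n.+1 *
    `|(Qtorus L n.+1 (emb L N (a N N)) z - Qtorus L n (emb L N (a N N)) z) -
      (Qtorus L n.+1 holder_limit_fun z - Qtorus L n holder_limit_fun z)| <= e).
Proof.
move=> k01 e0; have k2 : 0 < kappa / 2 < 1 by lra.
have [K K0 HK] := a_incr k2.
set B := L%:R `^ (1 - kappa); set B' := L%:R `^ (1 - kappa / 2) in HK.
have B1 : 1 < B by apply: base_gt1; lra.
have B0 : 0 < B by apply: lt_trans B1.
have B'1 : 1 < B' by apply: base_gt1; lra.
have B'0 : 0 < B' by apply: lt_trans B'1.
pose t := B / B'.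
have t01 : 0 < t < 1.
  rewrite divr_gt0//= ltr_pdivrMr// mul1r /B' (_ : 1 - kappa / 2 = 1 - kappa + kappa / 2); last by field.
  rewrite powRD; last by rewrite pnatr_eq0 gtn_eqF ?implybT.
  by rewrite -/B ltr_pMr// base_gt1//; lra.
have [M HM] : exists M, forall n, (M <= n)%N -> 2 * K * t ^+ n <= e.
  have nt : `|t| < 1 by rewrite gtr0_norm; case/andP: t01.
  have e1 : 0 < e / (2 * K + 1) by rewrite divr_gt0// ltr_wpDl// mulr_ge0.
  have /cvgrPdist_le/(_ _ e1)[M _ HM] := cvg_expr nt.
  exists M => n Mn; have := HM n Mn.
  have tn : 0 <= t ^+ n by rewrite exprn_ge0//; case/andP: t01 => /ltW.
  rewrite /= sub0r normrN ger0_norm// ler_pdivlMr; last by rewrite ltr_wpDl// mulr_ge0.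
  by lra.
have c0 : 0 < e / (2 * B ^+ M) by rewrite divr_gt0// mulr_gt0// exprn_gt0.
have [N1 HN1] := @cvg_unif_boxes R L a ainf M _ c0 a_cvg.
have BM : 1 <= B ^+ M by rewrite exprn_ege1// ltW.
have ce : e / (2 * B ^+ M) * 2 * B ^+ M = e.
  by have := lt0r_neq0 (exprn_gt0 M B0) => ?; field.
exists (maxn N1 M) => N; rewrite geq_max => /andP[N1N MN]; split=> [z tz|n z tz].
  rewrite Qlf// Qemb// leq0n (le_trans (HN1 _ N1N 0 _ _ _)) ?addr_in_box//.
  by rewrite ler_pdivrMr ?mulr_gt0 ?exprn_gt0//; nra.
rewrite !Qlf// !Qemb//.
have tail d : (M <= n)%N -> `|d| <= 2 * (K * B' ^- n.+1) -> B ^+ n.+1 * `|d| <= e.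
  move=> Mn de; apply: le_trans (HM n.+1 (leqW Mn)).
  rewrite /t expr_div_n mulrCA -[2 * K * _]mulrA ler_wpM2l ?exprn_ge0 ?(ltW B0)//.
have ai : `|ainf n.+1 (addr L n.+1 z) - ainf n (addr L n z)| <= K * B' ^- n.+1.
  have -> : addr L n z = anc L (addr L n.+1 z).
    by rewrite (addr_anc L0 tz (leqnSn n)) subSnn expn1.
  by apply: ainf_incr => N' nN'; apply: HK.
have KB : 0 <= K * B' ^- n.+1 by rewrite mulr_ge0// invr_ge0 exprn_ge0// ltW.
case: ifPn => [nN|]; last first.
  rewrite -ltnNge ltnS => Nn; have -> : (if (n <= N)%N then a N n (addr L n z) else a N N (addr L N z)) = a N N (addr L N z).
    by case: ifPn => // nN; have -> : n = N by apply/eqP; rewrite eqn_leq nN.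
  rewrite subrr sub0r normrN; apply: tail => //; first exact: leq_trans Nn.
  by lra.
rewrite (ltnW nN); have [nM|Mn] := ltnP n M; last first.
  apply: tail => //; rewrite (le_trans (ler_normB _ _))// mulr_natl mulr2n lerD//.
  have -> : addr L n z = anc L (addr L n.+1 z).
    by rewrite (addr_anc L0 tz (leqnSn n)) subSnn expn1.
  exact: HK.
have i1 := HN1 _ N1N n.+1 (addr L n.+1 z) nM (addr_in_box L0 _ tz).
have i2 := HN1 _ N1N n (addr L n z) (ltnW nM) (addr_in_box L0 _ tz).
have -> : a N n.+1 (addr L n.+1 z) - a N n (addr L n z) - (ainf n.+1 (addr L n.+1 z) - ainf n (addr L n z)) =
  (a N n.+1 (addr L n.+1 z) - ainf n.+1 (addr L n.+1 z)) - (a N n (addr L n z) - ainf n (addr L n z)) by ring.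
rewrite -[leRHS]ce mulrC; apply: ler_pM => //.
  by rewrite exprn_ge0 ?ltW.
  rewrite (le_trans (ler_normB _ _))//; move: i1 i2; rewrite /ainf; lra.
by rewrite ler_weXn2l// ltW.
Qed.

(** The family a N n is the family of block averages of one function for each N.
    The bound on increments, uniform in N, controls the fine scales
    together, and so upgrades convergence of every single block average to
    convergence in every Hoelder norm of exponent below 1. *)
Lemma holder_limit : exists ustar : R * R -> R, forall kappa : R, 0 < kappa < 1 ->
  holder_space L (1 - kappa) ustar /\
  holder_norm L (1 - kappa) (emb L N (a N N) \- ustar) @[N --> \oo] --> 0%E.
Proof.
exists holder_limit_fun => kappa k01; split.
  split; first exact: lf_integrable.
  move=> e e0; have e4 : 0 < e / 4 by rewrite divr_gt0.
  have [N HN] := main_estimate k01 e4; have [Q0 Pn] := HN N (leqnn N).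
  exists N, (fun x : site L N => a N N (val x.1, val x.2)); rewrite embedE//.
  have /andP[_ le] : (0 <= holder_norm L (1 - kappa) (holder_limit_fun \- emb L N (a N N))%R <= (e / 4 + e / 4)%:E)%E.
    apply: holder_norm_le => //; first exact: emb_integrable.
    - by move=> z tz; rewrite distrC; apply: Q0.
    - by move=> n z tz; rewrite distrC; apply: Pn.
  by apply: le_lt_trans le _; rewrite lte_fin; lra.
have bd e : 0 < e -> \forall N \near \oo,
    (0 <= holder_norm L (1 - kappa) (emb L N (a N N) \- holder_limit_fun)%R <= e%:E)%E.
  move=> e0; have e2 : 0 < e / 2 by rewrite divr_gt0.
  have [N0 HN] := main_estimate k01 e2; exists N0 => // N /= NN.
  have [Q0 Pn] := HN N NN; have -> : e = e / 2 + e / 2 by field.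
  by apply: holder_norm_le => //; exact: emb_integrable.
apply/fine_cvgP; split.
  apply: filterS (bd 1 ltr01) => N /andP[h0 h1].
  by rewrite ge0_fin_numE// (le_lt_trans h1)// ltry.
apply/cvgrPdist_le => e e0; apply: filterS (bd e e0) => N /andP[h0 h1] /=.
rewrite sub0r normrN ger0_norm ?fine_ge0// -lee_fin fineK//.
by rewrite ge0_fin_numE// (le_lt_trans h1)// ltry.
Qed.

End HolderLimit.

(** * Exponential moments of Gaussian variables *)

Section NormalIntegrals.
Context {R : realType}.
Local Notation lam := (@lebesgue_measure R).

(** Change of density: the normal law has density [normal_pdf] with respect to
    the Lebesgue measure, as its Radon-Nikodym derivative is determined
    almost everywhere. *)
Lemma integral_normal_prob m s (f : R -> \bar R) :
  (forall x, 0 <= f x)%E -> measurable_fun setT f ->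
  (\int[normal_prob m s]_x f x = \int[lam]_x (f x * (normal_pdf m s x)%:E))%E.
Proof.
move=> f0 mf.
have dom := @normal_prob_dominates R m s.
rewrite -(Radon_Nikodym_SigmaFinite.change_of_variables dom)//.
apply: ae_eq_integral => //.
- apply: emeasurable_funM => //.
  exact: measurable_int (Radon_Nikodym_SigmaFinite.f_integrable dom).
- by apply: emeasurable_funM => //; apply/measurable_EFinP; exact: measurable_normal_pdf.
- apply: ae_eqe_mul2l; apply: integral_ae_eq => //.
  + exact: Radon_Nikodym_SigmaFinite.f_integrable.
  + by apply/measurable_EFinP; exact: measurable_normal_pdf.
  + by move=> A _ mA; rewrite -Radon_Nikodym_SigmaFinite.f_integral.
Qed.

Lemma normal_mgf (s t : R) : s != 0 ->
  (\int[normal_prob 0 s]_x (expR (t * x))%:E = (expR (s ^+ 2 * t ^+ 2 / 2))%:E)%E.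
Proof.
move=> s0; rewrite integral_normal_prob; last 2 first.
- by move=> x; rewrite lee_fin expR_ge0.
- apply/measurable_EFinP/measurableT_comp => //; exact: measurable_funM.
have E x : expR (t * x) * normal_pdf 0 s x =
     expR (s ^+ 2 * t ^+ 2 / 2) * normal_pdf (s ^+ 2 * t) s x.
  rewrite !normal_pdfE// mulrCA [RHS]mulrCA; congr (_ * _).
  by rewrite /normal_fun -!expRD; congr expR; field.
under eq_integral do rewrite -EFinM E EFinM.
rewrite ge0_integralZl//.
- by rewrite integral_normal_pdf mule1.
- by apply/measurable_EFinP; exact: measurable_normal_pdf.
- by move=> x _; rewrite lee_fin normal_pdf_ge0.
Qed.

(** The moment generating function of the square of a standard normal variable. *)
Definition chi_mgf (u : R) : R := (Num.sqrt (1 - 2 * u))^-1.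

(** exp (u x^2) times a centred normal density is a multiple of another one. *)
Lemma normal_chi_mgf (s u : R) : 0 < s -> 2 * u * s ^+ 2 < 1 ->
  (\int[normal_prob 0 s]_x (expR (u * x ^+ 2))%:E = (chi_mgf (u * s ^+ 2))%:E)%E.
Proof.
move=> s0 us; rewrite integral_normal_prob; last 2 first.
- by move=> x; rewrite lee_fin expR_ge0.
- apply/measurable_EFinP/measurableT_comp => //; apply: measurable_funM => //.
set c := chi_mgf _.
have w0 : 0 < 1 - 2 * (u * s ^+ 2) by rewrite mulrA; lra.
have c0 : 0 < c by rewrite invr_gt0 sqrtr_gt0.
have cE : c ^+ 2 * (1 - 2 * (u * s ^+ 2)) = 1.
  by rewrite /c /chi_mgf exprVn sqr_sqrtr ?ltW// mulVf// gt_eqF.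
have pk : normal_peak s = c * normal_peak (c * s).
  have S : Num.sqrt ((c * s) ^+ 2 * pi *+ 2) = c * Num.sqrt (s ^+ 2 * pi *+ 2).
    have -> : (c * s) ^+ 2 * pi *+ 2 = c ^+ 2 * (s ^+ 2 * pi *+ 2) by ring.
    by rewrite sqrtrM ?sqr_ge0// sqrtr_sqr gtr0_norm.
  by rewrite /normal_peak S (invfM c) mulVKf ?gt_eqF.
have fn x : expR (u * x ^+ 2) * normal_fun 0 s x = normal_fun 0 (c * s) x.
  rewrite /normal_fun -!expRD; congr expR; rewrite !subr0.
  have sn := lt0r_neq0 s0; have cn := lt0r_neq0 c0.
  have -> : u = (1 - (c ^+ 2)^-1) / (2 * s ^+ 2).
    have -> : (c ^+ 2)^-1 = 1 - 2 * (u * s ^+ 2).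
      have c2 : c ^+ 2 != 0 by rewrite expf_neq0.
      by apply: (mulfI c2); rewrite cE divff.
    by field.
  by field; rewrite ?cn ?sn.
have E x : expR (u * x ^+ 2) * normal_pdf 0 s x = c * normal_pdf 0 (c * s) x.
  by rewrite !normal_pdfE ?mulf_neq0 ?gt_eqF//= mulrCA fn {1}pk mulrA.
under eq_integral do rewrite -EFinM E EFinM.
rewrite ge0_integralZl//.
- by rewrite integral_normal_pdf mule1.
- by apply/measurable_EFinP; exact: measurable_normal_pdf.
- by move=> x _; rewrite lee_fin normal_pdf_ge0.
- by rewrite lee_fin ltW.
Qed.

Lemma chi_mgf_le_expR u : 0 <= u <= 1 / 4 -> chi_mgf u <= expR (u + 4 * u ^+ 2).
Proof.
move=> u4; have w0 : 0 < 1 - 2 * u by lra.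
set E := u + _; have h : expR (- (2 * E)) <= 1 - 2 * u.
  rewrite expRN -[leLHS]mul1r ler_pdivrMr ?expR_gt0//.
  apply: (@le_trans _ _ ((1 - 2 * u) * (1 + 2 * E))); first by rewrite /E; nra.
  by rewrite ler_wpM2l ?(ltW w0)// expR_ge1Dx.
have -> : expR E = (expR (- E))^-1 by rewrite expRN invrK.
rewrite /chi_mgf lef_pV2 ?posrE ?sqrtr_gt0 ?expR_gt0//.
rewrite -[leLHS]gtr0_norm ?expR_gt0// -sqrtr_sqr ler_sqrt ?(ltW w0)//.
by rewrite -expRM_natl mulrN.
Qed.

Lemma chi_mgf_le u : - (1 / 4) <= u <= 1 / 4 -> chi_mgf u <= 1 + u + 4 * u ^+ 2.
Proof.
move=> u4; have w0 : 0 < 1 - 2 * u by lra.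
have p0 : 0 < 1 + u + 4 * u ^+ 2 by nra.
rewrite /chi_mgf -[leRHS]invrK lef_pV2 ?posrE ?sqrtr_gt0 ?invr_gt0//.
rewrite -[leLHS]gtr0_norm ?invr_gt0// -sqrtr_sqr ler_sqrt ?(ltW w0)//.
rewrite exprVn -[leLHS]mul1r ler_pdivrMr ?exprn_gt0//.
have -> : (1 - 2 * u) * (1 + u + 4 * u ^+ 2) ^+ 2 = 1 + u ^+ 2 * (5 - 10 * u - 32 * u ^+ 3) by ring.
rewrite lerDl mulr_ge0 ?sqr_ge0//.
have : u ^+ 3 <= 1 / 64.
  rewrite -subr_ge0 (_ : _ - _ = (1 / 4 - u) * ((u + 1 / 8) ^+ 2 + 3 / 64)); last by field.
  by apply: mulr_ge0; [lra|rewrite addr_ge0 ?sqr_ge0//; lra].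
by lra.
Qed.

End NormalIntegrals.

Section NormalSecondMoment.
Context {R : realType}.

(** Squeeze: from 1 + t <= exp t at t = u x^2 / s^2 and at its opposite, the
    second moment lies between s^2 (1 - 4 u) and s^2 (1 + 4 u) for every
    small u > 0. *)
Lemma normal_second_moment (s : R) : 0 < s ->
  (\int[normal_prob 0 s]_x (x ^+ 2)%:E = (s ^+ 2)%:E)%E.
Proof.
move=> s0; set mu := normal_prob 0 s; set J := (\int[mu]_x (x ^+ 2)%:E)%E.
have s2 : 0 < s ^+ 2 by rewrite exprn_gt0.
have mX2 : measurable_fun setT (fun x : R => x ^+ 2) by exact: measurable_funX.
have J0 : (0 <= J)%E by apply: integral_ge0 => x _; rewrite lee_fin sqr_ge0.
have one : (\int[mu]_x 1 = 1 :> \bar R)%E.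
  by rewrite integral_cst// mul1e; exact: (probability_setT (normal_prob 0 s)).
have ZJ t : 0 <= t -> (\int[mu]_x (t * x ^+ 2)%:E = t%:E * J)%E.
  move=> t0; under eq_integral do rewrite EFinM.
  rewrite ge0_integralZl//; first exact/measurable_EFinP.
  by move=> x _; rewrite lee_fin sqr_ge0.
have mexp (t : R) : measurable_fun setT (fun x : R => (expR (t * x ^+ 2))%:E).
  by apply/measurable_EFinP/measurableT_comp => //; exact: measurable_funM.
have mt (t : R) : measurable_fun setT (fun x : R => (t * x ^+ 2)%:E).
  by apply/measurable_EFinP; exact: measurable_funM.
have up u : 0 < u <= 1 / 4 -> (1 + (u / s ^+ 2)%:E * J <= (1 + u + 4 * u ^+ 2)%:E)%E.
  move=> u4; have t0 : 0 <= u / s ^+ 2 by rewrite divr_ge0 ?ltW//; lra.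
  have uE : u / s ^+ 2 * s ^+ 2 = u by rewrite divfK// gt_eqF.
  apply: (@le_trans _ _ (chi_mgf u)%:E); last by rewrite lee_fin chi_mgf_le//; lra.
  rewrite -{2}uE -normal_chi_mgf//; last by rewrite -mulrA uE; lra.
  rewrite -one -ZJ// -ge0_integralD//.
  - apply: ge0_le_integral => //.
    + by move=> x _; rewrite lee_fin addr_ge0// mulr_ge0// sqr_ge0.
    + by apply: emeasurable_funD => //; exact: mt.
    + exact: mexp.
    + by move=> x _; rewrite lee_fin expR_ge1Dx.
  - by move=> x _; rewrite lee_fin mulr_ge0// sqr_ge0.
  - exact: mt.
have low u : 0 < u <= 1 / 4 -> (1 <= (1 - u + 4 * u ^+ 2)%:E + (u / s ^+ 2)%:E * J)%E.
  move=> u4; have t0 : 0 <= u / s ^+ 2 by rewrite divr_ge0 ?ltW//; lra.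
  have uE : - (u / s ^+ 2) * s ^+ 2 = - u by rewrite mulNr divfK// gt_eqF.
  apply: (@le_trans _ _ ((chi_mgf (- u))%:E + (u / s ^+ 2)%:E * J)%E); last first.
    by rewrite leeD2r// lee_fin -sqrrN chi_mgf_le//; lra.
  rewrite -uE -normal_chi_mgf//; last by rewrite -mulrA uE; lra.
  rewrite -one -ZJ// -ge0_integralD//; last 3 first.
  - exact: mexp.
  - by move=> x _; rewrite lee_fin mulr_ge0// sqr_ge0.
  - exact: mt.
  apply: ge0_le_integral => //.
  + by apply: emeasurable_funD; [exact: mexp|exact: mt].
  + move=> x _; rewrite -EFinD lee_fin; have := expR_ge1Dx (- (u / s ^+ 2) * x ^+ 2).
    by rewrite mulNr; lra.
have Jfin : J \is a fin_num.
  rewrite ge0_fin_numE// ltNge leye_eq; apply/negP => /eqP Jy.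
  have h4 : 0 < (1 / 4 : R) <= 1 / 4 by lra.
  have := up _ h4; rewrite Jy gt0_muley; last by rewrite lte_fin divr_gt0.
  by rewrite addey// leye_eq.
rewrite -(fineK Jfin); congr EFin; set j := fine J.
have up' u : 0 < u <= 1 / 4 -> j <= s ^+ 2 * (1 + 4 * u).
  move=> u4; have := up u u4; rewrite -(fineK Jfin) -EFinM -EFinD lee_fin -/j -addrA lerD2l.
  rewrite mulrAC ler_pdivrMr// => h.
  have u0 : 0 < u by lra.
  by rewrite -(ler_pM2l u0) (le_trans h)// le_eqVlt; apply/orP; left; apply/eqP; ring.
have low' u : 0 < u <= 1 / 4 -> s ^+ 2 * (1 - 4 * u) <= j.
  move=> u4; have := low u u4; rewrite -(fineK Jfin) -EFinM -EFinD lee_fin -/j => h.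
  have u0 : 0 < u by lra.
  have {}h : u - 4 * u ^+ 2 <= u / s ^+ 2 * j by lra.
  rewrite mulrAC ler_pdivlMr// in h.
  by rewrite -(ler_pM2l u0) (le_trans _ h)// le_eqVlt; apply/orP; left; apply/eqP; ring.
have small e : 0 < e -> exists2 u, 0 < u <= 1 / 4 & s ^+ 2 * (4 * u) <= e.
  move=> e0; exists (Num.min (1 / 4) (e / (4 * s ^+ 2))).
    have h1 : 0 < e / (4 * s ^+ 2) by rewrite divr_gt0// mulr_gt0.
    by rewrite lt_min ge_min lexx h1 /= andbT; lra.
  rewrite mulrA [s ^+ 2 * 4]mulrC -ler_pdivlMl ?mulr_gt0// [leRHS]mulrC ge_min lexx orbT//.
apply/eqP; rewrite eq_le; apply/andP; split; apply/ler_addgt0Pr => e e0;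
  have [u u4 us] := small e e0.
  by have := up' u u4; lra.
by have := low' u u4; lra.
Qed.

End NormalSecondMoment.

Section GaussianFamily.
Context {R : realType} {d : measure_display} {T : measurableType d}.
Variable P : probability T R.

(** The case v = 0 is kept apart since the law is then a Dirac mass. *)
Lemma ge0_integral_centred_normal (X : T -> R) (v : R) (F : R -> \bar R) :
  measurable_fun setT X ->
  (forall A : set R, measurable A -> P (X @^-1` A) = centred_normal v A) ->
  (forall x, 0 <= F x)%E -> measurable_fun setT F ->
  (\int[P]_w F (X w) = if v == 0%R then F 0%R else \int[normal_prob 0 (Num.sqrt v)]_x F x)%E.
Proof.
move=> mX law F0 mF.
have mX' : measurable_fun setT (X : T -> measurableTypeR R) by exact: mX.
pose X' : {RV P >-> measurableTypeR R} := @mfun_Sub _ _ T (measurableTypeR R) X (mem_set mX').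
transitivity (\int[distribution P X']_x F x)%E.
  by rewrite (ge0_integral_distribution X' mF F0).
case: ifPn => [/eqP v0|v0].
  transitivity (\int[\d_(0%R : measurableTypeR R)]_x F x)%E.
    apply: eq_measure_integral => A mA _; apply: (eq_trans (law A mA)).
    by rewrite /centred_normal v0 eqxx.
  by rewrite integral_dirac//= diracT mul1e.
apply: eq_measure_integral => A mA _; apply: (eq_trans (law A mA)).
by rewrite /centred_normal (negbTE v0).
Qed.

(** Independent standard normal variables, described by the laws of their linear
    combinations: this is what the white noise provides, and it avoids
    product measures. *)
Definition gaussian_family (I : finType) (Y : I -> T -> R) : Prop :=
  forall a : I -> R,
    measurable_fun setT (fun w => \sum_i a i * Y i w) /\
    forall A : set R, measurable A ->
      P ((fun w => \sum_i a i * Y i w) @^-1` A) = centred_normal (\sum_i a i ^+ 2) A.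

Variables (I : finType) (Y : I -> T -> R).
Hypothesis gY : gaussian_family Y.

Let var_ge0 (a : I -> R) : 0 <= \sum_i a i ^+ 2.
Proof. by apply: sumr_ge0 => i _; exact: sqr_ge0. Qed.

Lemma gaussian_mgf a :
  (\int[P]_w (expR (\sum_i a i * Y i w))%:E = (expR ((\sum_i a i ^+ 2) / 2))%:E)%E.
Proof.
have [mX law] := gY a.
rewrite (@ge0_integral_centred_normal _ _ (fun x => (expR x)%:E) mX law); last 2 first.
- by move=> x; rewrite lee_fin expR_ge0.
- exact/measurable_EFinP.
case: ifPn => [/eqP ->|v0]; first by rewrite mul0r.
have s0 : Num.sqrt (\sum_i a i ^+ 2) != 0.
  by rewrite gt_eqF// sqrtr_gt0 lt0r v0 var_ge0.
have := normal_mgf 1 s0; rewrite expr1n mulr1 sqr_sqrtr// => <-.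
by apply: eq_integral => x _; rewrite mul1r.
Qed.

Lemma gaussian_sq a :
  (\int[P]_w ((\sum_i a i * Y i w) ^+ 2)%:E = (\sum_i a i ^+ 2)%:E)%E.
Proof.
have [mX law] := gY a.
rewrite (@ge0_integral_centred_normal _ _ (fun x => (x ^+ 2)%:E) mX law); last 2 first.
- by move=> x; rewrite lee_fin sqr_ge0.
- by apply/measurable_EFinP; exact: measurable_funX.
case: ifPn => [/eqP ->|v0]; first by rewrite expr0n.
have s0 : 0 < Num.sqrt (\sum_i a i ^+ 2).
  by rewrite sqrtr_gt0 lt0r v0 var_ge0.
by rewrite normal_second_moment// sqr_sqrtr.
Qed.

Lemma sum_delta (i : I) (f : I -> R) : \sum_j (j == i)%:R * f j = f i.
Proof.
rewrite (bigD1 i)//= eqxx mul1r big1 ?addr0// => j /negbTE ->.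
by rewrite mul0r.
Qed.

Lemma gaussian_measurable i : measurable_fun setT (Y i).
Proof.
have [mX _] := gY (fun j => (j == i)%:R); apply: eq_measurable_fun mX => w _.
by rewrite (sum_delta i (fun j => Y j w)).
Qed.

(** Hubbard--Stratonovich: a Gaussian square is removed by averaging a linear
    exponential over an independent standard normal variable. *)
Lemma gaussian_chi_mgf_seq (s : R) (J : seq I) (a : I -> R) : 0 <= s -> 2 * s < 1 ->
  uniq J -> (forall i, i \in J -> a i = 0) ->
  (\int[P]_w (expR (s * (\sum_(i <- J) Y i w ^+ 2) + \sum_i a i * Y i w))%:E =
   (chi_mgf s ^+ size J * expR ((\sum_i a i ^+ 2) / 2))%:E)%E.
Proof.
move=> s0 s1; elim: J a => [|j J IH] a uJ aJ.
  under eq_integral do rewrite big_nil mulr0 add0r.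
  by rewrite gaussian_mgf expr0 mul1r.
move: uJ => /= /andP[jJ uJ].
have aj : a j = 0 by apply: aJ; rewrite mem_head.
pose t := Num.sqrt (2 * s).
have t2 : t ^+ 2 = 2 * s by rewrite sqr_sqrtr// mulr_ge0.
(* exp (s Y_j^2) is the expectation of exp (t z Y_j) over a standard normal
   z, since t^2 = 2 s. *)
pose b z i := if i == j then t * z else a i.
have bsum z w : \sum_i b z i * Y i w = t * z * Y j w + \sum_i a i * Y i w.
  rewrite (bigD1 j)//= [X in _ = _ + X](bigD1 j)//= aj mul0r add0r /b eqxx; congr (_ + _).
  by apply: eq_bigr => i /negbTE ->.
have bsq z : \sum_i b z i ^+ 2 = 2 * s * z ^+ 2 + \sum_i a i ^+ 2.
  rewrite (bigD1 j)//= [X in _ = _ + X](bigD1 j)//= aj expr0n add0r /b eqxx exprMn t2.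
  by congr (_ + _); apply: eq_bigr => i /negbTE ->.
pose F (w : T) (z : R) := expR (s * (\sum_(i <- J) Y i w ^+ 2) + \sum_i b z i * Y i w).
have mu1 : (1 : R) != 0 by rewrite oner_eq0.
transitivity (\int[P]_w \int[normal_prob 0 1]_z (F w z)%:E)%E.
  apply: eq_integral => w _; rewrite big_cons.
  have E z : F w z = expR (s * (\sum_(i <- J) Y i w ^+ 2) + \sum_i a i * Y i w) * expR (t * Y j w * z).
    by rewrite /F bsum -expRD; congr expR; ring.
  under eq_integral do rewrite E EFinM.
  rewrite ge0_integralZl//.
    rewrite normal_mgf// -EFinM -expRD expr1n mul1r exprMn t2.
    by congr (expR _)%:E; field.
  by apply/measurable_EFinP/measurableT_comp => //; exact: measurable_funM.
have mF : measurable_fun setT (fun p : T * R => (F p.1 p.2)%:E).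
  apply/measurable_EFinP/measurableT_comp => //; apply: measurable_funD.
    apply: measurable_funM => //; apply: measurable_sum => i; apply: measurable_funX.
    by apply: measurableT_comp => //; exact: gaussian_measurable.
  apply: measurable_sum => i; apply: measurable_funM.
    rewrite /b; case: (i == j) => //; exact: measurable_funM.
  by apply: measurableT_comp => //; exact: gaussian_measurable.
rewrite (fubini_tonelli (m1 := P) (m2 := normal_prob 0 1) (fun p : T * R => (F p.1 p.2)%:E) mF); last first.
  by move=> p; rewrite lee_fin expR_ge0.
under eq_integral => z _.
  rewrite /F /= IH//; last by move=> i iJ; rewrite /b; case: eqP => [ij|_]; [move: jJ; rewrite -ij iJ|apply: aJ; rewrite in_cons iJ orbT].
  rewrite bsq (_ : _ * expR _ = chi_mgf s ^+ size J * expR ((\sum_i a i ^+ 2) / 2) * expR (s * z ^+ 2)); last first.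
    by rewrite -[RHS]mulrA -expRD; congr (_ * expR _); field.
  rewrite EFinM.
  over.
have c0 : 0 <= chi_mgf s by rewrite invr_ge0 sqrtr_ge0.
rewrite ge0_integralZl//.
- rewrite normal_chi_mgf// ?expr1n ?mulr1//.
  by rewrite -EFinM /= exprS; congr EFin; ring.
- by apply/measurable_EFinP/measurableT_comp => //; apply: measurable_funM => //; exact: measurable_funX.
- by rewrite lee_fin mulr_ge0 ?expR_ge0// exprn_ge0.
Qed.

Lemma gaussian_chi_mgf (s : R) : 0 <= s -> 2 * s < 1 ->
  (\int[P]_w (expR (s * (\sum_i Y i w ^+ 2)))%:E = (chi_mgf s ^+ #|I|)%:E)%E.
Proof.
move=> s0 s1; have := @gaussian_chi_mgf_seq s (index_enum I) (fun=> 0) s0 s1.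
rewrite index_enum_uniq => /(_ isT (fun i _ => erefl)).
rewrite big1 ?mul0r ?expR0 ?mulr1; last by move=> i _; rewrite expr0n.
rewrite -[size _](_ : #|I| = _); last by rewrite cardE enumT.
move=> <-; apply: eq_integral => w _; rewrite [X in _ + X]big1 ?addr0// => i _.
by rewrite mul0r.
Qed.

End GaussianFamily.

(** * Tails of averages of Gaussian squares *)

Section Markov.
Context {R : realType} {d : measure_display} {T : measurableType d}.
Variable P : probability T R.

Lemma ge0_markov (f : T -> R) (c b : R) (A : set T) : 0 < c ->
  measurable_fun setT f -> (forall w, 0 <= f w) -> measurable A ->
  (forall w, A w -> c <= f w) -> (\int[P]_w (f w)%:E <= b%:E)%E ->
  (P A <= (b / c)%:E)%E.
Proof.
move=> c0 mf f0 mA fc fb; rewrite EFinM lee_pdivlMr//.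
apply: le_trans fb; apply: (@le_trans _ _ (\int[P]_(w in A) (f w)%:E)%E); last first.
  apply: ge0_subset_integral => //; first exact/measurable_EFinP.
  by move=> w _; rewrite lee_fin.
rewrite muleC -integral_cst//; apply: ge0_le_integral => //.
- by move=> w Aw; rewrite /cst lee_fin ltW.
- by apply/measurable_EFinP; apply: measurable_funS mf.
Qed.

Lemma integral_prob_cst (c : R) : (\int[P]_w c%:E = c%:E)%E.
Proof.
rewrite integral_cst//.
exact: (etrans (congr1 (mule c%:E) (probability_setT P)) (mule1 _)).
Qed.

Lemma measurable_superlevel (f : T -> R) (e : R) : measurable_fun setT f ->
  measurable [set w | e <= f w].
Proof.
move=> mf; have := mf measurableT `[e, +oo[%classic (measurable_itv _).
by rewrite setTI (_ : _ @^-1` _ = [set w | e <= f w])//; apply/seteqP; split=> w /=;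
  rewrite in_itv /= andbT.
Qed.

Lemma measurable_sublevel (f : T -> R) (e : R) : measurable_fun setT f ->
  measurable [set w | f w <= e].
Proof.
move=> mf; have := mf measurableT `]-oo, e]%classic (measurable_itv _).
by rewrite setTI (_ : _ @^-1` _ = [set w | f w <= e])//; apply/seteqP; split=> w /=;
  rewrite in_itv.
Qed.

End Markov.

Section ChiSquareTails.
Context {R : realType} {d : measure_display} {T : measurableType d}.
Variables (P : probability T R) (I : finType) (Y : I -> T -> R) (l : nat).
Hypothesis gY : gaussian_family P Y.
Hypothesis l0 : (0 < l)%N.
Hypothesis cardI : #|I| = (l ^ 2)%N.

Definition deviation (w : T) : R := mean (fun i => Y i w ^+ 2) - 1.

Let lr : 0 < l%:R :> R. Proof. by rewrite ltr0n. Qed.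

Let mQ : measurable_fun setT (fun w => \sum_i Y i w ^+ 2).
Proof.
by apply: measurable_sum => i; apply: measurable_funX; apply: gaussian_measurable gY i.
Qed.

Lemma measurable_deviation : measurable_fun setT deviation.
Proof. by apply: measurable_funB => //; apply: measurable_funM. Qed.

Lemma deviation_ge w : -1 <= deviation w.
Proof.
by rewrite /deviation lerBrDr addNr mulr_ge0 ?invr_ge0// sumr_ge0// => i _; exact: sqr_ge0.
Qed.

Let dev_scaled w : l%:R * deviation w / 4 = (4 * l%:R)^-1 * (\sum_i Y i w ^+ 2) - l%:R / 4.
Proof.
rewrite /deviation /mean cardI natrX; have := lt0r_neq0 lr; set Q := \sum_i _ => ln.
by field.
Qed.

Let mexp : measurable_fun setT (fun w => expR (l%:R * deviation w / 4)).
Proof.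
apply: measurableT_comp => //; apply: measurable_funM => //; apply: measurable_funM => //.
exact: measurable_deviation.
Qed.

Lemma expR14_le2 : expR (1 / 4 : R) <= 2.
Proof.
have := expR_ge1Dx (- (1 / 4) : R); rewrite expRN => h.
have e0 := expR_gt0 (1 / 4 : R).
rewrite -[leRHS]invrK -[leLHS]invrK lef_pV2 ?posrE ?invr_gt0//; lra.
Qed.

(** A block of l^2 squares has an average with fluctuations of order 1 / l; at u
    = 1 / (4 l) the moment generating function is bounded uniformly in l. *)
Lemma deviation_exp_moment : (\int[P]_w (expR (l%:R * deviation w / 4))%:E <= 2%:E)%E.
Proof.
pose s : R := (4 * l%:R)^-1.
have l1 : 1 <= l%:R :> R by rewrite ler1n.
have s0 : 0 <= s by rewrite invr_ge0 mulr_ge0// ltW.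
have s14 : s <= 1 / 4.
  by rewrite /s -[leRHS]invrK lef_pV2 ?posrE ?invr_gt0 ?mulr_gt0//; lra.
have E w : expR (l%:R * deviation w / 4) = expR (- (l%:R / 4)) * expR (s * \sum_i Y i w ^+ 2).
  by rewrite dev_scaled addrC expRD.
under eq_integral do rewrite E EFinM.
rewrite ge0_integralZl//; last first.
  by apply/measurable_EFinP; apply: measurableT_comp => //; exact: measurable_funM.
rewrite (gaussian_chi_mgf gY s0); last by lra.
rewrite cardI -EFinM lee_fin; apply: le_trans expR14_le2.
have c1 : chi_mgf s ^+ (l ^ 2) <= expR (s + 4 * s ^+ 2) ^+ (l ^ 2).
  by rewrite lerXn2r ?nnegrE ?expR_ge0 ?invr_ge0 ?sqrtr_ge0// chi_mgf_le_expR// s0.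
apply: (le_trans (ler_wpM2l (expR_ge0 _) c1)).
rewrite -expRM_natl -expRD ler_expR natrX /s le_eqVlt; apply/orP; left; apply/eqP.
by have := lt0r_neq0 lr => ln; field.
Qed.

Lemma integral_sum_sq : (\int[P]_w (\sum_i Y i w ^+ 2)%:E = (l%:R ^+ 2)%:E)%E.
Proof.
under eq_integral do rewrite -sumEFin.
rewrite ge0_integral_sum//; last 2 first.
- move=> i; apply/measurable_EFinP; apply: measurable_funX; exact: gaussian_measurable gY i.
- by move=> i w _; rewrite lee_fin sqr_ge0.
transitivity (\sum_(i : I) 1%:E : \bar R)%E; last first.
  by rewrite sumEFin sumr_const cardI natrX.
apply: eq_bigr => i _; have := gaussian_sq gY (fun j => (j == i)%:R).
have -> : \sum_j (j == i)%:R ^+ 2 = 1 :> R.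
  transitivity (\sum_j (j == i)%:R * 1 : R); last exact: (sum_delta i (fun=> 1)).
  by apply: eq_bigr => j _; case: (j == i); rewrite ?expr1n ?mulr1 ?expr0n ?mul0r.
by move=> <-; apply: eq_integral => w _; rewrite (sum_delta i (fun j => Y j w)).
Qed.

(** The function e^u - 1 - u is nonnegative, integrates to at most 1 at
    u = l deviation / 4 since the deviation is centred, and grows linearly at
    minus infinity: hence a lower tail of order 1/l without an exponential
    moment of the negative part. *)
Lemma deviation_lower_moment :
  (\int[P]_w (expR (l%:R * deviation w / 4) - 1 - l%:R * deviation w / 4)%:E <= 1%:E)%E.
Proof.
pose h w := expR (l%:R * deviation w / 4) - 1 - l%:R * deviation w / 4.
rewrite -[X in integral _ _ X]/(fun w => (h w)%:E).
have h0 w : 0 <= h w by rewrite /h; have := expR_ge1Dx (l%:R * deviation w / 4); lra.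
have mh : measurable_fun setT h.
  apply: measurable_funB; first exact: measurable_funB.
  by apply: measurable_funM => //; apply: measurable_funM => //; exact: measurable_deviation.
pose k w := 1 + (4 * l%:R)^-1 * (\sum_i Y i w ^+ 2).
have Q0 w : 0 <= (4 * l%:R)^-1 * (\sum_i Y i w ^+ 2).
  by rewrite mulr_ge0 ?invr_ge0 ?mulr_ge0// sumr_ge0// => i _; exact: sqr_ge0.
have k0 w : 0 <= k w by rewrite addr_ge0.
have mk : measurable_fun setT k by apply: measurable_funD => //; exact: measurable_funM.
have E : (\int[P]_w (h w)%:E + \int[P]_w (k w)%:E =
   \int[P]_w (expR (l%:R * deviation w / 4))%:E + (l%:R / 4)%:E)%E.
  have -> : (l%:R / 4)%:E = (\int[P]_w (l%:R / 4 : R)%:E)%E.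
    by rewrite integral_prob_cst.
  rewrite -!ge0_integralD//; try exact/measurable_EFinP; try by move=> w _; rewrite lee_fin.
  by apply: eq_integral => w _; rewrite -!EFinD /h /k dev_scaled; congr EFin; ring.
have Ek : (\int[P]_w (k w)%:E = (1 + l%:R / 4)%:E)%E.
  under eq_integral do rewrite /k EFinD.
  rewrite ge0_integralD//; try by move=> w _; rewrite lee_fin.
    2: by apply/measurable_EFinP; exact: measurable_funM.
  rewrite integral_prob_cst.
  under eq_integral do rewrite EFinM.
  have sq0 w : (0 <= (\sum_i Y i w ^+ 2)%:E)%E.
    by rewrite lee_fin sumr_ge0// => i _; exact: sqr_ge0.
  have c0 : (0 <= ((4 * l%:R : R)^-1)%:E)%E by rewrite lee_fin invr_ge0 mulr_ge0.
  rewrite ge0_integralZl//; last exact/measurable_EFinP.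
  rewrite integral_sum_sq -EFinM -EFinD; congr (_ + _)%:E.
  by have := lt0r_neq0 lr => ln; field.
have : (\int[P]_w (h w)%:E + (1 + l%:R / 4)%:E <= 2%:E + (l%:R / 4)%:E)%E.
  by rewrite -Ek E leeD2r// deviation_exp_moment.
rewrite -leeBrDr// => /le_trans; apply.
by rewrite -!EFinD lee_fin; lra.
Qed.

Lemma deviation_upper_tail (e : R) :
  (P [set w | (e <= deviation w)%R] <= (2 * expR (- (l%:R * e / 4)))%:E)%E.
Proof.
rewrite expRN; apply: (ge0_markov (f := fun w => expR (l%:R * deviation w / 4))) => //.
- exact: expR_gt0.
- by apply: measurable_superlevel; exact: measurable_deviation.
- by move=> w /= ew; rewrite ler_expR ler_wpM2r// ler_wpM2l// ltW.
- exact: deviation_exp_moment.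
Qed.

Lemma deviation_lower_tail (e : R) : 0 < e ->
  (P [set w | (deviation w <= - e)%R] <= (8 / (l%:R * e))%:E)%E.
Proof.
move=> e0; have le0 : 0 < l%:R * e by rewrite mulr_gt0.
have [le8|le8] := ltP (l%:R * e) 8.
  apply: (le_trans (probability_le1 _ _)).
    by apply: measurable_sublevel; exact: measurable_deviation.
  by rewrite lee_fin ler_pdivlMr// mul1r ltW.
have -> : 8 / (l%:R * e) = 1 / (l%:R * e / 8) by field; rewrite ?gt_eqF.
apply: (ge0_markov (f := fun w => expR (l%:R * deviation w / 4) - 1 - l%:R * deviation w / 4)).
- by rewrite divr_gt0.
- apply: measurable_funB; first exact: measurable_funB.
  by apply: measurable_funM => //; apply: measurable_funM => //; exact: measurable_deviation.
- by move=> w; have := expR_ge1Dx (l%:R * deviation w / 4); lra.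
- by apply: measurable_sublevel; exact: measurable_deviation.
- move=> w /= dw; have := expR_ge0 (l%:R * deviation w / 4).
  have : l%:R * deviation w <= - (l%:R * e) by rewrite -mulrN ler_wpM2l// ltW.
  by lra.
- exact: deviation_lower_moment.
Qed.

End ChiSquareTails.

(** * Sequences of deviations and union bounds *)

Section Tame.
Context {R : realType}.

Definition cutoff (lam : R) : nat := Num.truncn (lam / 64).

(** A sequence of deviations B_k is controlled at level lam when it is summable
    with sum O(lam). No lower bound is asked of the first lam / 64 terms,
    for B_k >= -1 gives them a total of order lam at no cost in probability. *)
Definition tame (lam : R) (B : nat -> R) : Prop :=
  forall k, B k < 2^-1 ^+ k * (lam / 64) /\ ((cutoff lam <= k)%N -> - 2^-1 ^+ k < B k).

Lemma tame_abs lam B k : 0 <= lam -> (forall k, -1 <= B k) -> tame lam B ->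
  `|B k| <= 2^-1 ^+ k * (lam / 64 + 1) + (k < cutoff lam)%N%:R.
Proof.
move=> l0 B1 tB; have [u l] := tB k; have h0 : 0 < 2^-1 ^+ k :> R by rewrite exprn_gt0.
have hl : 0 <= 2^-1 ^+ k * (lam / 64) by rewrite mulr_ge0 ?(ltW h0)//; lra.
rewrite ler_norml mulrDr mulr1; case: ltnP l => [kc _|ck /(_ isT) l] /=.
  by have := B1 k; lra.
by lra.
Qed.

Lemma sum_half_pow m : \sum_(k < m) 2^-1 ^+ k <= 2 :> R.
Proof.
suff -> : \sum_(k < m) 2^-1 ^+ k = 2 - 2 * 2^-1 ^+ m :> R.
  by rewrite gerBl mulr_ge0// exprn_ge0.
elim: m => [|m IH]; first by rewrite big_ord0 expr0; lra.
by rewrite big_ord_recr /= IH exprS; lra.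
Qed.

Lemma sum_lt_nat m c : \sum_(k < m) (k < c)%N%:R <= c%:R :> R.
Proof.
rewrite -natr_sum ler_nat -(big_mkord xpredT (fun k => nat_of_bool (k < c)%N)).
elim: m => [|m IH]; first by rewrite big_nil.
rewrite big_nat_recr//=; case: ltnP => mc; last by rewrite addn0.
rewrite (leq_trans _ mc)// addn1 ltnS (leq_trans (n := \sum_(0 <= i < m) 1))//.
  by apply: leq_sum => i _; case: (_ < _)%N.
by rewrite sum_nat_const_nat subn0 muln1.
Qed.

Lemma tame_sum lam B m : 0 <= lam -> (forall k, -1 <= B k) -> tame lam B ->
  \sum_(k < m) `|B k| <= 3 * lam / 64 + 2.
Proof.
move=> l0 B1 tB.
apply: (@le_trans _ _ (\sum_(k < m) (2^-1 ^+ k * (lam / 64 + 1) + (k < cutoff lam)%N%:R))).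
  by apply: ler_sum => k _; exact: tame_abs.
rewrite big_split /= -mulr_suml.
have h1 := sum_lt_nat m (cutoff lam).
have l64 : 0 <= lam / 64 by lra.
have h2 : (cutoff lam)%:R <= lam / 64 by rewrite /cutoff; case/andP: (truncn_itv l64).
have h3 : (\sum_(k < m) 2^-1 ^+ k) * (lam / 64 + 1) <= 2 * (lam / 64 + 1).
  by rewrite ler_wpM2r ?sum_half_pow//; lra.
by lra.
Qed.

Lemma tame_cauchy lam B e : 0 <= lam -> (forall k, -1 <= B k) -> tame lam B -> 0 < e ->
  exists M, forall m n, (M <= m <= n)%N -> \sum_(m <= k < n) `|B k| <= e.
Proof.
move=> l0 B1 tB e0.
have cu : cvgn (series (fun k => `|B k|)).
  apply: nondecreasing_is_cvgn.
    apply/nondecreasing_seqP => n; rewrite /series /= big_nat_recr//=.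
    by rewrite lerDl.
  exists (3 * lam / 64 + 2) => _ [n _ <-]; rewrite /series /= big_mkord.
  exact: tame_sum.
have /cauchy_cvgP/cauchy_seriesP := cu => /(_ _ e0) h.
have [[M1 M2] /= [[a _ Ha] [b _ Hb]] HM] := h.
exists (maxn a b) => m n /andP[Mm mn].
have /= := HM (m, n); rewrite ger0_norm; last by apply: sumr_ge0.
move=> /(_ _)/ltW; apply; split => /=.
  by apply: Ha => /=; exact: leq_trans (leq_maxl _ _) Mm.
by apply: Hb => /=; exact: leq_trans (leq_maxr _ _) (leq_trans Mm mn).
Qed.

(** L^k 2^-k grows at least like (3/2)^k, so the upper tail beats both a
    geometric factor in k and an exponential in lam. *)
Lemma upper_tail_number (L : nat) (lam : R) k : (3 <= L)%N -> 128 <= lam ->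
  2 * expR (- ((L ^ k)%:R * (2^-1 ^+ k * (lam / 64)) / 4)) <=
  2 * (5 / 6) ^+ k * expR (- (lam / 384)).
Proof.
move=> L3 l128.
have e14 : expR (- (1 / 4)) <= 5 / 6 :> R.
  have := expR_ge1Dx (1 / 4 : R) => h; rewrite expRN -[leRHS]invrK lef_pV2 ?posrE ?expR_gt0//.
  by apply: le_trans h; lra.
have h : expR (- (k%:R * (1 / 4))) <= (5 / 6) ^+ k :> R.
  by rewrite -mulrN expRM_natl lerXn2r// nnegrE ?expR_ge0//; lra.
rewrite -[leRHS]mulrA ler_wpM2l//; apply: le_trans (ler_wpM2r (expR_ge0 _) h).
rewrite -expRD ler_expR.
have bern : 1 + k%:R / 2 <= (L ^ k)%:R * 2^-1 ^+ k :> R.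
  rewrite natrX -exprMn; have c : 3 / 2 <= L%:R * 2^-1 :> R by rewrite ler_wpM2r// ler_nat.
  apply: (@le_trans _ _ ((3 / 2) ^+ k)); last by rewrite lerXn2r ?nnegrE//; lra.
  elim: (k) => [|j IH]; first by rewrite expr0; lra.
  rewrite exprS -(natr1 j); have j0 : 0 <= j%:R :> R by []; lra.
have k0 : 0 <= k%:R :> R by [].
rewrite mulrA; set p := _ * 2^-1 ^+ k in bern *; nra.
Qed.

(** The lower tail is only of order (2 / L)^k <= (2 / 3)^k <= (5 / 6)^2k. Half
    of this decay is kept for the sum over k, the other half is
    exponentially small in lam because k >= lam / 64. *)
Lemma lower_tail_number (L : nat) (lam : R) k : (3 <= L)%N -> 0 <= lam -> (cutoff lam <= k)%N ->
  8 / ((L ^ k)%:R * 2^-1 ^+ k) <= 10 * (5 / 6) ^+ k * expR (- (lam / 384)).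
Proof.
move=> L3 l0 ck.
have c : 3 / 2 <= L%:R * 2^-1 :> R by rewrite ler_wpM2r// ler_nat.
have h1 : 8 / ((L ^ k)%:R * 2^-1 ^+ k) <= 8 * (2 / 3) ^+ k :> R.
  rewrite ler_wpM2l// natrX -exprMn -exprVn lerXn2r ?nnegrE ?invr_ge0//; try lra.
  by rewrite -[leRHS]invrK lef_pV2 ?posrE//; lra.
apply: (le_trans h1).
have h2 : (2 / 3) ^+ k <= (5 / 6) ^+ k * (5 / 6) ^+ k :> R.
  by rewrite -exprMn lerXn2r// ?nnegrE; lra.
have h56 : 5 / 6 <= expR (- (1 / 6)) :> R.
  by have := expR_ge1Dx (- (1 / 6) : R); lra.
have h3 : (5 / 6) ^+ k <= 6 / 5 * expR (- (lam / 384)) :> R.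
  have h4 : (5 / 6) ^+ k.+1 <= expR (- (lam / 384)) :> R.
    apply: (@le_trans _ _ (expR (- (1 / 6)) ^+ k.+1)).
      by rewrite lerXn2r// ?nnegrE ?expR_ge0//; lra.
    rewrite -expRM_natl ler_expR.
    have l64 : 0 <= lam / 64 by lra.
    have : lam / 64 < k.+1%:R.
      have /andP[_ /lt_le_trans] := truncn_itv l64; apply.
      by rewrite ler_nat ltnS.
    by lra.
  by move: h4; rewrite exprS; lra.
have p0 : 0 <= (5 / 6) ^+ k :> R by rewrite exprn_ge0//; lra.
have e0 := expR_ge0 (- (lam / 384) : R).
apply: (le_trans (ler_wpM2l _ h2)) => //.
have := ler_wpM2l p0 h3; set p := (5 / 6) ^+ k; set E := expR _; move=> h5.
have : 0 <= p * E by rewrite mulr_ge0.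
by lra.
Qed.

End Tame.

Section UnionBounds.
Context {R : realType} {d : measure_display} {T : measurableType d}.
Variable P : probability T R.

Lemma union_bound_geometric (A : nat -> set T) (c q : R) : 0 <= c -> 0 < q < 1 ->
  (forall k, measurable (A k)) -> (forall k, P (A k) <= (c * q ^+ k)%:E)%E ->
  (P (\bigcup_k A k) <= (c / (1 - q))%:E)%E.
Proof.
move=> c0 /andP[q0 q1] mA PA.
have mU : measurable (\bigcup_k A k) by exact: bigcupT_measurable.
apply: (@le_trans _ _ (\sum_(0 <= k <oo) P (A k))%E).
  exact: (measure_sigma_subadditive P mA mU (@subset_refl _ _)).
apply: lime_le; first exact: is_cvg_nneseries.
apply: nearW => n; apply: (@le_trans _ _ (\sum_(0 <= k < n) (c * q ^+ k)%:E)%E).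
  by apply: lee_sum => k _; exact: PA.
by rewrite sumEFin lee_fin; apply: (geometric_le_lim n c0 q0); rewrite gtr0_norm.
Qed.

Lemma union_bound_seq (I : eqType) (s : seq I) (A : I -> set T) (c : R) :
  (forall i, measurable (A i)) -> (forall i, P (A i) <= c%:E)%E ->
  measurable [set w | exists2 i, i \in s & A i w] /\
  (P [set w | exists2 i, i \in s & A i w] <= ((size s)%:R * c)%:E)%E.
Proof.
move=> mA PA; elim: s => [|i s [IHm IH]].
  rewrite (_ : [set _ | _] = set0); first by rewrite measure0 mul0r.
  by apply/seteqP; split=> w // [].
have E : [set w | exists2 j, j \in i :: s & A j w] = A i `|` [set w | exists2 j, j \in s & A j w].
  apply/seteqP; split=> w /=.
    by move=> [j]; rewrite in_cons => /predU1P[->|js] Aj; [left|right; exists j].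
  by case=> [Ai|[j js Aj]]; [exists i => //; exact: mem_head|exists j => //; rewrite in_cons js orbT].
rewrite E; split; first exact: measurableU.
apply: (le_trans (measureU2 _ _ _)) => //.
by rewrite /= -natr1 mulrDl mul1r addrC EFinD leeD.
Qed.

End UnionBounds.

(** * White noise on the hierarchical lattice *)

Section GaussianFamilyMore.
Context {R : realType} {d : measure_display} {T : measurableType d}.
Variables (P : probability T R) (I : finType) (Y : I -> T -> R).
Hypothesis gY : gaussian_family P Y.

Lemma gaussian_sq_integrable a :
  P.-integrable setT (fun w => ((\sum_i a i * Y i w) ^+ 2)%:E).
Proof.
have [mX _] := gY a; apply/integrableP; split.
  by apply/measurable_EFinP; exact: measurable_funX.
under eq_integral do rewrite gee0_abs ?lee_fin ?sqr_ge0//.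
by rewrite (gaussian_sq gY) ltry.
Qed.

Lemma gaussian_cov a b :
  (\int[P]_w ((\sum_i a i * Y i w) * (\sum_i b i * Y i w))%:E = (\sum_i a i * b i)%:E)%E.
Proof.
pose s i := a i + b i; pose t i := a i - b i.
have E w : (\sum_i a i * Y i w) * (\sum_i b i * Y i w) =
   4^-1 * ((\sum_i s i * Y i w) ^+ 2 - (\sum_i t i * Y i w) ^+ 2).
  have -> : \sum_i s i * Y i w = \sum_i a i * Y i w + \sum_i b i * Y i w.
    by rewrite -big_split; apply: eq_bigr => i _; rewrite mulrDl.
  have -> : \sum_i t i * Y i w = \sum_i a i * Y i w - \sum_i b i * Y i w.
    by rewrite -sumrB; apply: eq_bigr => i _; rewrite mulrBl.
  by field.
under eq_integral do rewrite E EFinM EFinB.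
have sI := gaussian_sq_integrable s; have tI := gaussian_sq_integrable t.
rewrite integralZl//; last exact: integrableB.
rewrite integralB// !(gaussian_sq gY) -EFinB -EFinM; congr EFin.
rewrite -sumrB mulr_sumr; apply: eq_bigr => i _; rewrite /s /t.
by field.
Qed.

Lemma gaussian_subfamily (J : finType) (phi : J -> I) : injective phi ->
  gaussian_family P (fun j => Y (phi j)).
Proof.
move=> phiI a; pose b i := \sum_(j | phi j == i) a j.
have E : (fun w => \sum_j a j * Y (phi j) w) = (fun w => \sum_i b i * Y i w).
  apply/funext => w; rewrite (partition_big phi xpredT)//=; apply: eq_bigr => i _.
  by rewrite /b mulr_suml; apply: eq_bigr => j /eqP ->.
have Ea : \sum_j a j ^+ 2 = \sum_i b i ^+ 2.
  rewrite (partition_big phi xpredT)//=; apply: eq_bigr => i _.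
  have [[j /eqP ji]|no] := pselect (exists j, phi j == i).
    rewrite /b (big_pred1 j) ?(big_pred1 j)// => j'; rewrite /= -ji;
    by apply/eqP/eqP => [/phiI|->].
  rewrite /b !big_pred0 ?expr0n// => j; apply/negP => ji; apply: no; by exists j.
by rewrite E Ea; exact: gY.
Qed.

End GaussianFamilyMore.

Section WhiteNoise.
Context {R : realType} {d : measure_display} {T : measurableType d}.
Variables (P : probability T R) (xi : (R * R -> R) -> T -> R).
Hypothesis WN : white_noise P xi.
Variable L : nat.
Hypothesis L0 : (0 < L)%N.

Let leb2_lty : (leb2 (@torus R) < +oo)%E.
Proof. by rewrite (leb2_torus L0) ltry. Qed.

Lemma step_square_integrable (I : Type) (s : seq I) (c : I -> R) (A : I -> set (R * R)) :
  (forall i, measurable (A i)) ->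
  square_integrable (fun z => \sum_(i <- s) c i * \1_(A i) z).
Proof.
move=> mA.
have mf : measurable_fun (@torus R) (fun z => \sum_(i <- s) c i * \1_(A i) z).
  by apply: measurable_sum => i; apply: measurable_funM => //; exact: measurable_indic.
split => //; apply: (bounded_integrable (mu := leb2) (c := (\sum_(i <- s) `|c i|) ^+ 2)) => //.
- exact: measurable_torus.
- exact: measurable_funX.
- move=> z _; rewrite normrX lerXn2r ?nnegrE ?sumr_ge0//.
  rewrite (le_trans (ler_norm_sum _ _ _))//; apply: ler_sum => i _.
  by rewrite normrM indicE; case: (_ \in _); rewrite /= ?normr1 ?normr0 ?mulr1 ?mulr0.
Qed.

(** Linearity holds for each realisation, so it extends to finite sums
    pointwise. *)
Lemma white_noise_sum (I : Type) (s : seq I) (c : I -> R) (A : I -> set (R * R)) w :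
  (forall i, measurable (A i)) ->
  xi (fun z => \sum_(i <- s) c i * \1_(A i) z) w = \sum_(i <- s) c i * xi (\1_(A i)) w.
Proof.
move=> mA; have [_ lin _] := WN.
have step1 i : square_integrable (\1_(A i) : R * R -> R).
  have := step_square_integrable [:: i] (fun=> 1) mA.
  by rewrite (_ : (fun z => _) = \1_(A i))//; apply/funext => z; rewrite big_seq1 mul1r.
elim: s => [|i s IH].
  have sq0 := step_square_integrable (@nil I) c mA.
  have := lin 1 _ _ w sq0 sq0.
  rewrite (_ : (fun z => 1 * _ + _) = (fun z => \sum_(i <- [::]) c i * \1_(A i) z)); last first.
    by apply/funext => z; rewrite big_nil mulr0 addr0.
  by rewrite mul1r big_nil => /eqP; rewrite -subr_eq subrr => /eqP <-.
rewrite big_cons -IH -lin; [|exact: step1|exact: step_square_integrable].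
by congr (xi _ w); apply/funext => z; rewrite big_cons.
Qed.

Let lr n : L%:R ^+ n != 0 :> R. Proof. by rewrite expf_neq0// pnatr_eq0 -lt0n. Qed.

Lemma measurable_cube n (x : site L n) : measurable (cube x : set (R * R)).
Proof. by rewrite cubeE//; exact: measurable_pcube. Qed.

Lemma xi_unitE n (x : site L n) w : xi_unit xi x w = L%:R ^+ n * xi (\1_(cube x)) w.
Proof.
rewrite /xi_unit /xi_fine mul2n -addnn exprD; have l0 := lr n.
by rewrite mulrA; congr (_ * _); field.
Qed.

(** The cubes of one scale are disjoint with volume L^-2n, so a linear
    combination of the normalised averages is the noise tested against a
    step function with norm the Euclidean norm of the coefficients. *)
Lemma xi_unit_gaussian n : gaussian_family P (fun x : site L n => xi_unit xi x).
Proof.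
move=> a; pose f := fun z : R * R => \sum_(x : site L n) (a x * L%:R ^+ n) * \1_(cube x) z.
have E : (fun w => \sum_x a x * xi_unit xi x w) = xi f.
  apply/funext => w; rewrite /f white_noise_sum; last exact: measurable_cube.
  by apply: eq_bigr => x _; rewrite xi_unitE mulrA.
have fsq : square_integrable f by apply: step_square_integrable; exact: measurable_cube.
suff var : \int[leb2]_(z in @torus R) (f z ^+ 2) = \sum_x a x ^+ 2.
  have [m1 _ m3] := WN; rewrite E -var; split; first exact: m1.
  exact: (m3 f fsq).
pose c (x : site L n) := (a x * L%:R ^+ n) ^+ 2.
have cub_eq (z : R * R) : torus z -> exists x0 : site L n, forall x, cube x z <-> x = x0.
  move=> tz; have /andP[a1 a2] := addr_in_box L0 n tz.
  exists (Ordinal a1, Ordinal a2) => x.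
  rewrite cubeE// pcube_addr// /addr; split=> [[e1 e2]|->//].
  by case: x e1 e2 => x1 x2 /= e1 e2; congr pair; apply: val_inj.
rewrite (eq_Rintegral leb2 (g := fun z : R * R => \sum_x c x * \1_(cube x) z)); last first.
  move=> z /set_mem /cub_eq [x0 Hx]; rewrite /f.
  by rewrite (sum_indic_eq c Hx) (sum_indic_eq (fun x => a x * L%:R ^+ n) Hx).
have sub (x : site L n) : (cube x : set (R * R)) `<=` @torus R.
  by rewrite (cubeE L0) => z; apply: (pcube_torus L0); rewrite /in_box !ltn_ord.
have [_ ->] := integral_step (mu := leb2) c (@measurable_torus R)
  (@measurable_cube n) sub leb2_lty.
apply: eq_bigr => x _.
have lx : leb2 (cube x : set (R * R)) = ((L%:R ^+ (2 * n))^-1)%:E.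
  by rewrite (cubeE L0); exact: (leb2_pcube L0).
rewrite /c [X in fine X]lx /= exprMn -exprM mulnC mulfK//; exact: lr.
Qed.

Let Lpos n : (0 < L ^ n)%N. Proof. by rewrite expn_gt0 L0. Qed.

(** Reducing indices modulo L^n extends functions on the sites periodically to
    all pairs of naturals, where blocks and ancestors need no side condition. *)
Definition wrap_site n (z : nat * nat) : site L n :=
  (Ordinal (ltn_pmod z.1 (Lpos n)), Ordinal (ltn_pmod z.2 (Lpos n))).

Lemma wrap_site_val n (x : site L n) : wrap_site n (val x.1, val x.2) = x.
Proof. by case: x => i j; congr pair; apply: val_inj; rewrite /= modn_small. Qed.

Definition unit_noise (w : T) n (z : nat * nat) : R := xi_unit xi (wrap_site n z) w.

End WhiteNoise.

Section NoiseHierarchy.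
Context {R : realType} {d : measure_display} {T : measurableType d}.
Variables (P : probability T R) (xi : (R * R -> R) -> T -> R).
Hypothesis WN : white_noise P xi.
Variable L : nat.
Hypothesis L0 : (0 < L)%N.

Local Notation X w := (unit_noise xi L0 w).
Local Notation wrap := (wrap_site L0).

Let Lpos n : (0 < L ^ n)%N. Proof. by rewrite expn_gt0 L0. Qed.
Let lr n : L%:R ^+ n != 0 :> R. Proof. by rewrite expf_neq0// pnatr_eq0 -lt0n. Qed.

Lemma modn_desc n k (a p : nat) : (p < L ^ k)%N ->
  ((a * L ^ k + p) %% L ^ (n + k) = a %% L ^ n * L ^ k + p)%N.
Proof.
move=> pk; rewrite {1}(divn_eq a (L ^ n)) expnD mulnDl -mulnA -addnA modnMDl modn_small//.
rewrite (leq_trans (n := (a %% L ^ n).+1 * L ^ k))//.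
  by rewrite mulSn addnC ltn_add2r.
by rewrite leq_pmul2r// ltn_mod.
Qed.

Lemma wrap_desc n k z (p : 'I_(L ^ k) * 'I_(L ^ k)) :
  val (wrap (n + k) (desc z p)).1 = ((z.1 %% L ^ n) * L ^ k + p.1)%N /\
  val (wrap (n + k) (desc z p)).2 = ((z.2 %% L ^ n) * L ^ k + p.2)%N.
Proof. by split; apply: modn_desc. Qed.

Lemma wrap_desc_inj n k z : injective (fun p : 'I_(L ^ k) * 'I_(L ^ k) => wrap (n + k) (desc z p)).
Proof.
move=> p p' e; have [e1 e2] := wrap_desc n z p; have [e1' e2'] := wrap_desc n z p'.
rewrite e in e1 e2; rewrite e1 in e1'; rewrite e2 in e2'.
move/addnI: e1' => f1; move/addnI: e2' => f2.
by rewrite (surjective_pairing p) (surjective_pairing p'); congr pair; apply: val_inj.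
Qed.

Lemma block_gaussian n k z :
  gaussian_family P (fun (p : 'I_(L ^ k) * 'I_(L ^ k)) w => X w (n + k) (desc z p)).
Proof.
have h := gaussian_subfamily (@xi_unit_gaussian _ _ _ P xi WN L L0 (n + k)) (J := ('I_(L ^ k) * 'I_(L ^ k))%type).
exact: (h _ (@wrap_desc_inj n k z)).
Qed.

(** Consistency of the averages of one realisation: a cube is the disjoint union
    of its L^2 children, and the normalisation L^n contributes the factor L. *)
Lemma unit_noise_coarse w n z : X w n z = L%:R * bmean L (X w n.+1) z.
Proof.
rewrite bmeanE.
have E : (\1_(cube (wrap n z)) : R * R -> R) = (fun y : R * R => \sum_(p : 'I_L * 'I_L)
    1 * \1_(cube (wrap n.+1 (desc z p))) y).
  have wd (p : 'I_L * 'I_L) : (val (wrap n.+1 (desc z p)).1, val (wrap n.+1 (desc z p)).2) =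
       desc (val (wrap n z).1, val (wrap n z).2) p.
    have h := @modn_desc n 1; rewrite expn1 addn1 in h.
    by rewrite /desc /= !h.
  apply/funext => y; have [ty|ty] := pselect (torus y); last first.
    have out m (x : site L m) : \1_(cube x) y = 0 :> R.
      by rewrite indicE memNset// (cubeE L0) => /(pcube_torus L0) h; apply/ty/h; rewrite /in_box !ltn_ord.
    by rewrite out big1// => p _; rewrite out mulr0.
  have anc1 : addr L n y = anc L (addr L n.+1 y).
    by rewrite (addr_anc L0 ty (leqnSn n)) subSnn expn1.
  have [yz|yz] := pselect (cube (wrap n z) y).
    rewrite indicE mem_set//; move: yz; rewrite (cubeE L0) pcube_addr// anc1 => yz.
    have [p Ep] := desc_anc (addr L n.+1 y) L0; rewrite yz in Ep.
    rewrite (@sum_indic_eq _ _ (fun=> 1) _ p)// => p'.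
    rewrite (cubeE L0) pcube_addr// wd; split=> [e|->//]; move: Ep; rewrite e.
    rewrite /desc => -[] /addnI/esym f1 /addnI/esym f2.
    by rewrite (surjective_pairing p) (surjective_pairing p'); congr pair; apply: val_inj.
  rewrite indicE memNset// big1// => p _; rewrite mul1r indicE memNset//.
  rewrite (cubeE L0) pcube_addr// wd => e; apply: yz.
  by rewrite (cubeE L0) pcube_addr// anc1 e anc_desc.
rewrite /unit_noise (xi_unitE xi L0) E (white_noise_sum WN L0); last by move=> p; exact: measurable_cube.
rewrite pair_bigA /= mulr_sumr [RHS]mulrA mulr_sumr; apply: eq_bigr => p _.
rewrite mul1r (xi_unitE xi L0) [RHS]mulrA (exprS _ n); congr (_ * _).
by have := lr 1; rewrite expr1 => l0; field.
Qed.

Lemma bmean_unit_noise w n k z : bmean (L ^ k) (X w (n + k)%N) z = (L%:R ^+ k)^-1 * X w n z.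
Proof.
elim: k z => [|k IH] z; first by rewrite expn0 bmean1 addn0 expr0 invr1 mul1r.
rewrite expnSr -bmean_comp (eq_bmean _ _ (f' := fun y => L%:R^-1 * X w (n + k)%N y)).
  by rewrite /bmean meanZ -/(bmean (L ^ k) (X w (n + k)%N) z) IH exprS invfM mulrA.
move=> y; rewrite (unit_noise_coarse w (n + k)) addnS mulKf//.
by have := lr 1; rewrite expr1.
Qed.

Lemma block_sum N n k (a : nat * nat) (f : site L N -> R) : N = (n + k)%N -> in_box L n a ->
  (L%:R ^+ (2 * k))^-1 * \sum_(y : site L N | (y.1 %/ L ^ k == a.1)%N && (y.2 %/ L ^ k == a.2)%N) f y =
  bmean (L ^ k) (fun z => f (wrap N z)) a.
Proof.
move=> NE; move: f; rewrite NE => f /andP[a1 a2]; rewrite bmeanE natrX -exprM mulnC; congr (_ * _).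
rewrite pair_bigA /=.
pose h (p : 'I_(L ^ k) * 'I_(L ^ k)) := wrap (n + k) (desc a p).
pose h' (y : site L (n + k)) : 'I_(L ^ k) * 'I_(L ^ k) :=
  (Ordinal (ltn_pmod y.1 (Lpos k)), Ordinal (ltn_pmod y.2 (Lpos k))).
have hv p : ((h p).1 = a.1 * L ^ k + p.1 :> nat)%N /\ ((h p).2 = a.2 * L ^ k + p.2 :> nat)%N.
  by have [/= e1 e2] := wrap_desc n a p; rewrite /= e1 e2 !modn_small.
have hE p : h p = wrap (n + k) (desc a p) by [].
clearbody h; rewrite (reindex_onto h h') /=; last first.
  move=> [y1 y2] /= /andP[/eqP e1 /eqP e2].
  have [f1 f2] := hv (h' (y1, y2)).
  rewrite [LHS]surjective_pairing; congr pair; apply: ord_inj.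
    by rewrite f1 /= -e1 -divn_eq.
  by rewrite f2 /= -e2 -divn_eq.
apply: eq_big => [p|p _]; last by rewrite hE.
have [f1 f2] := hv p.
rewrite f1 f2 !divnMDl// !divn_small// !addn0 !eqxx /=.
apply/eqP; rewrite [RHS]surjective_pairing; congr pair; apply: ord_inj => /=.
  by rewrite f1 modnMDl modn_small.
by rewrite f2 modnMDl modn_small.
Qed.

Lemma anc_in_box N n k (y : site L N) : N = (n + k)%N -> in_box L n (anc (L ^ k) (val y.1, val y.2)).
Proof.
by move=> E; rewrite /in_box /anc /= !ltn_divLR// -!expnD -E !ltn_ord.
Qed.

Lemma Qop_bmean N n k (f : site L N -> R) (y : site L N) : N = (n + k)%N ->
  Qop k f y = bmean (L ^ k) (fun z => f (wrap N z)) (anc (L ^ k) (val y.1, val y.2)).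
Proof.
move=> E; rewrite -(block_sum f E (anc_in_box y E)) /Qop; congr (_ * _).
by apply: eq_bigl => x; rewrite /same_block eq_sym [in Z in _ && Z]eq_sym.
Qed.

Lemma Qop_unit_noise N n k w (y : site L N) : N = (n + k)%N ->
  Qop k (fun x => xi_unit xi x w) y = (L%:R ^+ k)^-1 * X w n (anc (L ^ k) (val y.1, val y.2)).
Proof. by move=> E; move: y; rewrite E => y; rewrite (Qop_bmean _ _ (erefl _)) -bmean_unit_noise. Qed.

End NoiseHierarchy.

(** * The second chaos in terms of block averages of squares *)

Section SecondChaos.
Context {R : realType} {d : measure_display} {T : measurableType d}.
Variables (P : probability T R) (xi : (R * R -> R) -> T -> R).
Hypothesis WN : white_noise P xi.
Variable L : nat.
Hypothesis L0 : (0 < L)%N.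

Local Notation X w := (unit_noise xi L0 w).
Local Notation wrap := (wrap_site L0).

Let lr n : L%:R ^+ n != 0 :> R. Proof. by rewrite expf_neq0// pnatr_eq0 -lt0n. Qed.

(** For each k the site y itself has weight L^-2(k-1) - L^-2k in P_k, so that
    every scale contributes L^2(k-1) (L^-2(k-1) - L^-2k) = 1 - L^-2. *)
Lemma Gamma_cov N m (y : site L N) :
  (fine 'E_P[(fun w => xi_unit xi y w) \* (fun w => Gamma m (fun x => xi_unit xi x w) y)])%E =
  m%:R * (1 - (L%:R ^+ 2)^-1).
Proof.
(* Q_k and Gamma at y are linear forms with kernels bQ k and b. *)
pose bQ k x : R := (L%:R ^+ (2 * k))^-1 * (same_block k y x)%:R.
pose b x := \sum_(1 <= k < m.+1) L%:R ^+ (2 * k.-1) * (bQ k.-1 x - bQ k x).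
have QE k (f : site L N -> R) : Qop k f y = \sum_x bQ k x * f x.
  rewrite /Qop mulr_sumr big_mkcond /=; apply: eq_bigr => x _.
  by rewrite /bQ -mulrA; case: (same_block k y x); rewrite ?mul1r ?mul0r ?mulr0.
have GE (f : site L N -> R) : Gamma m f y = \sum_x b x * f x.
  rewrite /Gamma; under [RHS]eq_bigr do rewrite /b mulr_suml.
  rewrite exchange_big /=; apply: eq_bigr => k _; rewrite /Pop !QE -sumrB mulr_sumr.
  by apply: eq_bigr => x _; rewrite -mulrA mulrBl.
have -> : ('E_P[(fun w => xi_unit xi y w) \* (fun w => Gamma m (fun x => xi_unit xi x w) y)] =
   \int[P]_w ((\sum_x (x == y)%:R * xi_unit xi x w) * (\sum_x b x * xi_unit xi x w))%:E)%E.
  rewrite unlock; apply: eq_integral => w _.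
  by rewrite (sum_delta y (fun x => xi_unit xi x w)) -GE.
rewrite (gaussian_cov (@xi_unit_gaussian _ _ _ P xi WN L L0 N)) /= (sum_delta y b) /b.
rewrite (eq_big_nat _ _ (F2 := fun=> 1 - (L%:R ^+ 2)^-1)).
  by rewrite sumr_const_nat subn1 /= mulr_natl.
move=> [//|k] _; rewrite /bQ /same_block !eqxx !mulr1 /= mulnS exprD mulrBr divff// invfM.
by rewrite mulrCA divff// mulr1.
Qed.

Lemma Gamma_unit_noise n m w (y : site L (n + m)) :
  Gamma m (fun x => xi_unit xi x w) y = \sum_(k < m)
    L%:R ^+ (2 * k) * ((L%:R ^+ k)^-1 * X w (n + (m - k))%N (anc (L ^ k) (val y.1, val y.2)) -
      (L%:R ^+ k.+1)^-1 * X w (n + (m - k.+1))%N (anc (L ^ k.+1) (val y.1, val y.2))).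
Proof.
rewrite /Gamma -{1}[1%N]add0n big_addn subn1 /= big_mkord; apply: eq_bigr => k _.
rewrite addn1 /= /Pop /=; congr (_ * (_ - _)); apply: (Qop_unit_noise WN); have := ltn_ord k; lia.
Qed.

(** The coarse factor is constant on a block of side L^j, where the average of
    the fine noise is L^-j times the coarse one; the product becomes a
    square. *)
Lemma bmean_cross w n m j z : (j <= m)%N ->
  bmean (L ^ m) (fun y => X w (n + m)%N y * X w (n + (m - j))%N (anc (L ^ j) y)) z =
  (L%:R ^+ j)^-1 * block_sq L (X w) (m - j) n z.
Proof.
move=> jm; rewrite -{1}(subnK jm) expnD -bmean_comp /block_sq /bmean -meanZ; apply: eq_mean => p.
set y := desc z p; rewrite (eq_mean (G := fun p' : 'I_(L ^ j) * 'I_(L ^ j) => X w (n + (m - j))%N y * X w (n + (m - j) + j)%N (desc y p'))).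
  rewrite meanZ -/(bmean (L ^ j) (X w (n + (m - j) + j)%N) y) (bmean_unit_noise WN).
  by rewrite mulrCA expr2.
by move=> p'; rewrite anc_desc mulrC -addnA subnK.
Qed.

(** Each scale of Gamma pairs the noise with its own coarse averages, so that
    [bmean_cross] turns the block mean of the product into averages of
    squares. *)
Lemma noise2E N n (x : site L n) w : (n <= N)%N ->
  noise2 P xi N x w = second_chaos L (X w) N n (val x.1, val x.2).
Proof.
move=> nN; rewrite /noise2 nN /SQop /second_chaos; set m := (N - n)%N.
have NE : N = (n + m)%N by rewrite subnKC.
have xb : in_box L n (val x.1, val x.2) by rewrite /in_box /= !ltn_ord.
rewrite -[nat_of_ord x.1]/((val x.1, val x.2).1) -[nat_of_ord x.2]/((val x.1, val x.2).2).
move: (val x.1, val x.2) xb => a ab {x}.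
clearbody m; subst N.
rewrite (block_sum L0 _ (erefl _) ab).
pose c : R := 1 - (L%:R ^+ 2)^-1.
pose G z k := L%:R ^+ (2 * k) * ((L%:R ^+ k)^-1 * X w (n + (m - k))%N (anc (L ^ k) z) -
      (L%:R ^+ k.+1)^-1 * X w (n + (m - k.+1))%N (anc (L ^ k.+1) z)).
rewrite /bmean (eq_mean (G := fun p : 'I_(L ^ m) * 'I_(L ^ m) =>
   (\sum_(k < m) X w (n + m)%N (desc a p) * G (desc a p) k) - m%:R * c)); last first.
  move=> p; rewrite /wick Gamma_cov; congr (_ - _).
  rewrite (Gamma_unit_noise w) -mulr_sumr; congr (_ * _); apply: eq_bigr => k _.
  suff -> : (val (wrap (n + m) (desc a p)).1, val (wrap (n + m) (desc a p)).2) = desc a p by [].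
  have [-> ->] := wrap_desc L0 n a p; case/andP: ab => a1 a2.
  by rewrite !modn_small.
have m0 : (0 < L ^ m)%N by rewrite expn_gt0 L0.
rewrite meanB mean_cst ?card_block// mean_sum.
rewrite [RHS]sumrB sumr_const card_ord -[Z in _ = _ - Z]mulr_natl; congr (_ - _).
rewrite [RHS](reindex_inj rev_ord_inj) /=; apply: eq_bigr => k _.
have km := ltn_ord k.
rewrite (eq_mean (G := fun p : 'I_(L ^ m) * 'I_(L ^ m) =>
   L%:R ^+ (2 * k) * (L%:R ^+ k)^-1 * (X w (n + m)%N (desc a p) * X w (n + (m - k))%N (anc (L ^ k) (desc a p))) -
   L%:R ^+ (2 * k) * (L%:R ^+ k.+1)^-1 * (X w (n + m)%N (desc a p) * X w (n + (m - k.+1))%N (anc (L ^ k.+1) (desc a p))))); last first.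
  by move=> p; rewrite /G; ring.
rewrite meanB !meanZ.
have h1 := bmean_cross w n a (ltnW km); have h2 := bmean_cross w n a km.
rewrite /bmean in h1 h2; rewrite h1 h2 (subnSK km).
have := lr k; have := lr 1; rewrite expr1 mul2n -addnn exprD exprS.
set l := L%:R ^+ k; set b1 := block_sq _ _ _ _ _; set b2 := block_sq _ _ _ _ _.
by move=> l0 l1; field; rewrite l0 l1.
Qed.

End SecondChaos.

(** * The good event and its probability *)

Section GoodEvent.
Context {R : realType}.
Variable L : nat.
Hypothesis L0 : (0 < L)%N.
Hypothesis L3 : (3 <= L)%N.

(** The number L^2n of sites is exponential in n, while exp (- Lam^n / b) decays doubly
    exponentially. *)
Lemma superpolynomial_decay (Lam b : R) : 1 < Lam -> 0 < b -> exists2 C : R, 0 <= C &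
  forall n, ((L ^ n) ^ 2)%:R * expR (- (Lam ^+ n / b)) <= C * 2^-1 ^+ n.
Proof.
move=> Lam1 b0; have Lam0 : 0 < Lam by apply: lt_trans Lam1.
(* exp y >= (y / p)^p for any p; with Lam^p >= 2 L^2 this beats L^2n by a
   factor 2^n. *)
have [p p0 Hp] : exists2 p, (0 < p)%N & 2 * (L ^ 2)%:R <= Lam ^+ p.
  have i1 : `|Lam^-1| < 1 by rewrite gtr0_norm ?invr_gt0// invf_lt1.
  have L2 : 0 < 2 * (L ^ 2)%:R :> R by rewrite mulr_gt0// ltr0n expn_gt0 L0.
  have c0 : 0 < (2 * (L ^ 2)%:R)^-1 :> R by rewrite invr_gt0.
  have /cvgrPdist_le/(_ _ c0)[M _ HM] := cvg_expr i1.
  exists M.+1 => //; have := HM M.+1 (leqnSn M).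
  rewrite /= sub0r normrN ger0_norm ?exprn_ge0 ?invr_ge0 ?(ltW Lam0)// exprVn.
  by rewrite lef_pV2 ?posrE ?exprn_gt0.
have pr : 0 < p%:R :> R by rewrite ltr0n.
have bp : 0 < b * p%:R by rewrite mulr_gt0.
exists ((b * p%:R) ^+ p); first by rewrite exprn_ge0// ltW.
move=> n; set a := Lam ^+ n; have a0 : 0 < a by rewrite exprn_gt0.
have t0 : 0 < a / (b * p%:R) by rewrite divr_gt0.
have e1 : (a / (b * p%:R)) ^+ p <= expR (a / b).
  have -> : a / b = p%:R * (a / (b * p%:R)) by field; rewrite ?gt_eqF.
  rewrite expRM_natl lerXn2r ?nnegrE ?expR_ge0 ?(ltW t0)//.
  by apply: le_trans (expR_ge1Dx _); rewrite lerDr.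
rewrite expRN; apply: (@le_trans _ _ (((L ^ n) ^ 2)%:R * ((a / (b * p%:R)) ^+ p)^-1)).
  by rewrite ler_wpM2l// lef_pV2 ?posrE ?expR_gt0 ?exprn_gt0.
rewrite -exprVn invf_div exprMn -mulrCA ler_wpM2l ?exprn_ge0 ?(ltW bp)//.
have -> : ((L ^ n) ^ 2)%:R = (L ^ 2)%:R ^+ n :> R by rewrite -natrX -!expnM mulnC.
have -> : a^-1 ^+ p = (Lam ^+ p) ^- n by rewrite exprVn /a -!exprM mulnC.
rewrite ler_pdivrMr ?exprn_gt0// -exprMn lerXn2r ?nnegrE ?mulr_ge0 ?invr_ge0 ?exprn_ge0 ?(ltW Lam0)//.
by rewrite -ler_pdivrMl ?invr_gt0// invrK.
Qed.

Section OneNoise.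
Context {d : measure_display} {T : measurableType d}.
Variables (P : probability T R) (xi : (R * R -> R) -> T -> R).
Hypothesis WN : white_noise P xi.
Local Notation X w := (unit_noise xi L0 w).

Definition block_dev w n z k : R := block_sq L (X w) k n z - 1.

Lemma block_devE w n z k :
  block_dev w n z k = deviation (fun (p : 'I_(L ^ k) * 'I_(L ^ k)) w => X w (n + k) (desc z p)) w.
Proof. by []. Qed.

Let Lk k : (0 < L ^ k)%N. Proof. by rewrite expn_gt0 L0. Qed.

Let cardB k : #|{: 'I_(L ^ k) * 'I_(L ^ k)}| = ((L ^ k) ^ 2)%N.
Proof. by rewrite card_prod card_ord. Qed.

Lemma block_dev_ge w n z k : -1 <= block_dev w n z k.
Proof. by rewrite block_devE; exact: deviation_ge. Qed.

Lemma measurable_block_dev n z k : measurable_fun setT (fun w => block_dev w n z k).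
Proof. exact: (measurable_deviation (block_gaussian WN L0 n (k := k) z)). Qed.

(** The lower deviation is only excluded beyond the cutoff, as in [tame]. *)
Definition bad_set lam n z k : set T :=
  [set w | 2^-1 ^+ k * (lam / 64) <= block_dev w n z k] `|`
  (if (cutoff lam <= k)%N then [set w | block_dev w n z k <= - 2^-1 ^+ k] else set0).

Lemma measurable_bad_set lam n z k : measurable (bad_set lam n z k).
Proof.
apply: measurableU; first by apply: measurable_superlevel; exact: measurable_block_dev.
by case: ifP => // _; apply: measurable_sublevel; exact: measurable_block_dev.
Qed.

Lemma bad_set_prob lam n z k : 128 <= lam ->
  (P (bad_set lam n z k) <= (12 * expR (- (lam / 384)) * (5 / 6) ^+ k)%:E)%E.
Proof.
move=> l128; have gk := block_gaussian WN L0 n (k := k) z.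
have m1 : measurable [set w | 2^-1 ^+ k * (lam / 64) <= block_dev w n z k].
  by apply: measurable_superlevel; exact: measurable_block_dev.
have m2 : measurable (if (cutoff lam <= k)%N then [set w | block_dev w n z k <= - 2^-1 ^+ k] else set0).
  by case: ifP => // _; apply: measurable_sublevel; exact: measurable_block_dev.
apply: (le_trans (measureU2 P m1 m2)).
have up := deviation_upper_tail gk (Lk k) (cardB k) (2^-1 ^+ k * (lam / 64)).
have u2 := upper_tail_number k L3 l128.
have -> : 12 * expR (- (lam / 384)) * (5 / 6) ^+ k = 2 * (5 / 6) ^+ k * expR (- (lam / 384)) +
   10 * (5 / 6) ^+ k * expR (- (lam / 384)) :> R by ring.
rewrite EFinD; apply: leeD.
  by apply: (le_trans up); rewrite lee_fin.
case: ifP => ck; last by rewrite measure0 lee_fin !mulr_ge0 ?expR_ge0// exprn_ge0//; lra.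
have h0 : 0 < 2^-1 ^+ k :> R by rewrite exprn_gt0.
apply: (le_trans (deviation_lower_tail gk (Lk k) (cardB k) h0)).
by rewrite lee_fin; apply: lower_tail_number => //; lra.
Qed.

Definition bad_point lam n z : set T := \bigcup_k bad_set lam n z k.

Lemma bad_point_prob lam n z : 128 <= lam ->
  measurable (bad_point lam n z) /\ (P (bad_point lam n z) <= (72 * expR (- (lam / 384)))%:E)%E.
Proof.
move=> l128; split; first by apply: bigcupT_measurable => k; exact: measurable_bad_set.
have q01 : 0 < (5 / 6 : R) < 1 by lra.
have c0 : 0 <= 12 * expR (- (lam / 384)) by rewrite mulr_ge0 ?expR_ge0.
apply: (le_trans (union_bound_geometric c0 q01 (measurable_bad_set lam n z) (fun k => bad_set_prob n z k l128))).
by rewrite lee_fin; set e := expR _; have -> : 12 * e / (1 - 5 / 6) = 72 * e by field.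
Qed.

Lemma not_bad_tame lam n z w : ~ bad_point lam n z w -> tame lam (block_dev w n z).
Proof.
move=> nb k; split; first by rewrite ltNge; apply/negP => h; apply: nb; exists k => //; left.
by move=> ck; rewrite ltNge; apply/negP => h; apply: nb; exists k => //; right; rewrite ck.
Qed.

(** Four times the square of the threshold imposed on the noise by the good
    event, see [noise_level_sq]. *)
Definition scale_lam (kappa g : R) n : R := (L%:R `^ (2 * kappa)) ^+ n * g ^- 2.

Definition bad_event (kappa g : R) : set T :=
  \bigcup_n [set w | exists2 x : site L n, x \in enum (site L n) &
     bad_point (scale_lam kappa g n) n (val x.1, val x.2) w].

Lemma base_ge1 (kappa : R) n : 0 < kappa -> 1 <= (L%:R `^ (2 * kappa)) ^+ n.
Proof.
move=> k0; apply: exprn_ege1; rewrite -[leLHS](powRr0 L%:R).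
by apply: ler_powR; [rewrite ler1n|rewrite mulr_ge0// ltW].
Qed.

Lemma scale_lam_ge kappa g n : 0 < kappa -> g ^- 2 <= scale_lam kappa g n.
Proof.
move=> k0; rewrite /scale_lam -[leLHS]mul1r ler_wpM2r ?invr_ge0 ?sqr_ge0//.
exact: base_ge1.
Qed.

(** At scale n the probability is at most 72 L^2n exp (- lam_n / 384). As lam_n
    is the product of L^(2 kappa n) >= 1 and of g^-2, it is at least half
    their sum; one half pays for the number of sites, the other gives the
    decay in g. *)
Lemma bad_event_prob kappa g (C : R) : 0 < kappa -> 128 <= g ^- 2 ->
  0 <= C -> (forall n, ((L ^ n) ^ 2)%:R * expR (- ((L%:R `^ (2 * kappa)) ^+ n / 768)) <= C * 2^-1 ^+ n) ->
  measurable (bad_event kappa g) /\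
  (P (bad_event kappa g) <= (144 * C * expR (- (1 / 768) * g ^- 2))%:E)%E.
Proof.
move=> k0 g128 C0 HC.
pose A n := [set w | exists2 x : site L n, x \in enum (site L n) &
     bad_point (scale_lam kappa g n) n (val x.1, val x.2) w].
have ge128 n : 128 <= scale_lam kappa g n by apply: le_trans (scale_lam_ge _ _ k0).
have HA n := union_bound_seq (P := P) (enum (site L n))
  (fun x : site L n => (bad_point_prob n (val x.1, val x.2) (ge128 n)).1)
  (fun x : site L n => (bad_point_prob n (val x.1, val x.2) (ge128 n)).2).
have mA n : measurable (A n) := (HA n).1.
split; first exact: bigcupT_measurable.
have c0 : 0 <= 72 * C * expR (- (1 / 768) * g ^- 2) by rewrite !mulr_ge0 ?expR_ge0.
have h01 : 0 < (2^-1 : R) < 1 by lra.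
have -> : 144 * C * expR (- (1 / 768) * g ^- 2) = 72 * C * expR (- (1 / 768) * g ^- 2) / (1 - 2^-1) by field.
apply: (union_bound_geometric c0 h01 mA) => n.
apply: (le_trans (HA n).2); rewrite lee_fin -cardE card_prod card_ord.
(* a b >= (a + b) / 2 for a, b >= 1. *)
have S : scale_lam kappa g n / 384 >= ((L%:R `^ (2 * kappa)) ^+ n + g ^- 2) / 768.
  rewrite /scale_lam; set a := _ ^+ n; set b := g ^- 2 in g128 *.
  have a1 : 1 <= a by exact: base_ge1.
  by nra.
have := HC n; rewrite -mulnn; set K := ((L ^ n * L ^ n)%N)%:R => HCn.
apply: (@le_trans _ _ (K * (72 * (expR (- ((L%:R `^ (2 * kappa)) ^+ n / 768)) * expR (- (1 / 768) * g ^- 2))))).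
  rewrite ler_wpM2l// ler_wpM2l// -expRD ler_expR; lra.
have e0 := expR_ge0 (- (1 / 768) * g ^- 2).
have := ler_wpM2r e0 HCn; lra.
Qed.

Lemma not_bad_event_tame kappa g w : ~ bad_event kappa g w ->
  forall n z, in_box L n z -> tame (scale_lam kappa g n) (block_dev w n z).
Proof.
move=> nb n [i j] /andP[/= i0 j0]; apply: not_bad_tame => bp; apply: nb.
exists n => //; exists (Ordinal i0, Ordinal j0) => //; by rewrite mem_enum.
Qed.

Lemma block_sq_wrap w k n z : block_sq L (X w) k n z =
  block_sq L (X w) k n (val (wrap_site L0 n z).1, val (wrap_site L0 n z).2).
Proof.
rewrite /block_sq /bmean; apply: eq_mean => p; congr (_ ^+ 2).
rewrite /unit_noise; congr (xi_unit xi _ w).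
have [e1 e2] := wrap_desc L0 n z p.
have [f1 f2] := wrap_desc L0 n (val (wrap_site L0 n z).1, val (wrap_site L0 n z).2) p.
rewrite [LHS]surjective_pairing [RHS]surjective_pairing; congr pair; apply: ord_inj.
  by rewrite [LHS]e1 [RHS]f1 /= modn_mod.
by rewrite [LHS]e2 [RHS]f2 /= modn_mod.
Qed.

Lemma block_dev_wrap w n z : block_dev w n z =
  block_dev w n (val (wrap_site L0 n z).1, val (wrap_site L0 n z).2).
Proof. by apply/funext => k; rewrite /block_dev block_sq_wrap. Qed.

Lemma second_chaosE w N n z : second_chaos L (X w) N n z =
  \sum_(k < N - n) (block_dev w n z k.+1 - (L%:R ^+ 2)^-1 * block_dev w n z k).
Proof. by apply: eq_bigr => k _; rewrite /block_dev; ring. Qed.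

Lemma unit_noise_sq w n z : X w n z ^+ 2 = 1 + block_dev w n z 0.
Proof. by rewrite /block_dev /block_sq expn0 bmean1 addn0 addrC subrK. Qed.

Lemma not_bad_tame_all kappa g w : ~ bad_event kappa g w ->
  forall n z, tame (scale_lam kappa g n) (block_dev w n z).
Proof.
move=> nb n z; rewrite block_dev_wrap; apply: not_bad_event_tame => //.
by rewrite /in_box /= !ltn_pmod ?expn_gt0 ?L0.
Qed.

Let Lm2 : 0 <= (L%:R ^+ 2 : R)^-1 <= 1.
Proof.
rewrite invr_ge0 exprn_ge0//= invf_le1 ?exprn_gt0 ?ltr0n//.
by rewrite exprn_ege1// ler1n.
Qed.

Let step_le (B : nat -> R) k : `|B k.+1 - (L%:R ^+ 2)^-1 * B k| <= `|B k.+1| + `|B k|.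
Proof.
rewrite (le_trans (ler_normB _ _))// lerD2l normrM.
case/andP: Lm2 => a b; rewrite (ger0_norm a).
by rewrite ler_piMl.
Qed.

Lemma tame_second_chaos w lam N n z : 0 <= lam -> tame lam (block_dev w n z) ->
  `|second_chaos L (X w) N n z| <= 2 * (3 * lam / 64 + 2).
Proof.
move=> l0 tm; rewrite second_chaosE (le_trans (ler_norm_sum _ _ _))//.
apply: (@le_trans _ _ (\sum_(k < N - n) (`|block_dev w n z k.+1| + `|block_dev w n z k|))).
  by apply: ler_sum => k _.
rewrite big_split /= mulr_natl mulr2n lerD//; last exact: (tame_sum _ l0 (block_dev_ge w n z) tm).
apply: le_trans (tame_sum (N - n).+1 l0 (block_dev_ge w n z) tm).
by rewrite [leRHS]big_ord_recl /= lerDr.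
Qed.

Lemma second_chaos_diff w N M n z : (n <= N)%N -> (N <= M)%N ->
  second_chaos L (X w) M n z - second_chaos L (X w) N n z =
  \sum_(N - n <= k < M - n) (block_dev w n z k.+1 - (L%:R ^+ 2)^-1 * block_dev w n z k).
Proof.
move=> nN NM; rewrite !second_chaosE.
rewrite -!(big_mkord xpredT (fun k => block_dev w n z k.+1 - (L%:R ^+ 2)^-1 * block_dev w n z k)).
by rewrite (big_cat_nat (n := N - n)) ?leq_sub2r//= addrAC subrr add0r.
Qed.

(** The deviations are absolutely summable at each site, and only finitely many
    sites of scale n are distinct up to periodicity. *)
Lemma not_bad_cauchy kappa g w : 0 < kappa -> ~ bad_event kappa g w ->
  forall n e, 0 < e -> exists N0, forall N M z, (N0 <= N <= M)%N ->
    `|second_chaos L (X w) M n z - second_chaos L (X w) N n z| <= e.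
Proof.
move=> k0 nb n e e0; have tm := not_bad_tame_all nb n.
have l0 : 0 <= scale_lam kappa g n.
  by apply: le_trans (scale_lam_ge g n k0); rewrite invr_ge0 sqr_ge0.
have e2 : 0 < e / 2 by rewrite divr_gt0.
pose S z a b := \sum_(a <= k < b) `|block_dev w n z k|.
have [K _ HK] : \forall K \near \oo, forall x : site L n, forall a b, (K <= a <= b)%N ->
    S (val x.1, val x.2) a b <= e / 2.
  apply: filter_forall => x.
  have [M HM] := tame_cauchy l0 (block_dev_ge w n (val x.1, val x.2)) (tm _) e2.
  exists M => // K /= MK a b /andP[Ka ab]; apply: HM.
  by rewrite (leq_trans MK).
exists (n + K)%N => N M z /andP[KN NM].
rewrite second_chaos_diff//; last exact: leq_trans (leq_addr _ _) KN.
rewrite (le_trans (ler_norm_sum _ _ _))//.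
apply: (@le_trans _ _ (\sum_(N - n <= k < M - n) (`|block_dev w n z k.+1| + `|block_dev w n z k|))).
  by apply: ler_sum => k _.
have KNn : (K <= N - n)%N by rewrite leq_subRL// (leq_trans (leq_addr _ _) KN).
have NMn : (N - n <= M - n)%N by rewrite leq_sub2r.
have hS a b : (K <= a <= b)%N -> S z a b <= e / 2.
  by rewrite /S block_dev_wrap => /(HK K (leqnn K) (wrap_site L0 n z)).
rewrite big_split /= (_ : e = e / 2 + e / 2); last by field.
apply: lerD; last by apply: hS; rewrite KNn.
rewrite -(big_add1 _ _ (N - n) (M - n).+1 xpredT (fun k => `|block_dev w n z k|)).
by apply: hS; rewrite (leq_trans KNn)//= ltnS.
Qed.

Definition noise_level (kappa g : R) n : R := L%:R `^ (kappa * n%:R) / (2 * g).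

Lemma noise_level_sq kappa g n : 0 < g -> noise_level kappa g n ^+ 2 = scale_lam kappa g n / 4.
Proof.
move=> g0; rewrite /noise_level /scale_lam expr_div_n.
have -> : (L%:R `^ (2 * kappa)) ^+ n = (L%:R `^ (kappa * n%:R)) ^+ 2 :> R.
  rewrite -(powR_mulrn n (powR_ge0 _ _)) -(powR_mulrn 2 (powR_ge0 _ _)) -!powRrM.
  by congr (_ `^ _); ring.
by field; rewrite gt_eqF.
Qed.

Lemma noise_level_gt0 kappa g n : 0 < g -> 0 < noise_level kappa g n.
Proof. by move=> g0; rewrite divr_gt0 ?mulr_gt0// powR_gt0// ltr0n. Qed.

Let xi_unit_wrap w n (x : site L n) : xi_unit xi x w = X w n (val x.1, val x.2).
Proof. by rewrite /unit_noise wrap_site_val. Qed.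

Lemma second_chaos_wrap w N n z : second_chaos L (X w) N n z =
  second_chaos L (X w) N n (val (wrap_site L0 n z).1, val (wrap_site L0 n z).2).
Proof. by rewrite !second_chaosE block_dev_wrap. Qed.

(** The suprema over scales, sites and cutoffs amount to separate bounds, with
    the square root moved to the threshold. *)
Lemma Omega_eventP kappa g w : 0 < g ->
  Omega_event P L xi kappa g w <-> forall N n z, (n <= N)%N ->
    `|X w n z| <= noise_level kappa g n /\
    `|second_chaos L (X w) N n z| <= noise_level kappa g n ^+ 2.
Proof.
move=> g0; rewrite /Omega_event /=.
have Ln n : 0 < L%:R `^ (- kappa * n%:R) :> R by rewrite powR_gt0// ltr0n.
have LE n (c : R) : (L%:R `^ (- kappa * n%:R) * c <= (2 * g)^-1) = (c <= noise_level kappa g n).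
  rewrite mulrC -ler_pdivlMr// /noise_level mulNr powRN invrK mulrC//.
split=> [H N n z nN|H].
  have {}H : L%:R `^ (- kappa * n%:R) *
        Num.max (\big[Num.max/0]_(x : site L n) `|noise1 xi N x w|)
          (\big[Num.max/0]_(x : site L n) Num.sqrt `|noise2 P xi N x w|) <= (2 * g)^-1.
    rewrite -lee_fin; apply: le_trans H.
    apply: (le_trans _ (ereal_sup_ubound (imageT _ N))).
    by apply: (le_trans _ (ereal_sup_ubound (imageT _ n))).
  move: H; rewrite LE ge_max => /andP[/bigmax_leP[_ H1] /bigmax_leP[_ H2]].
  have := H1 (wrap_site L0 n z) isT; have := H2 (wrap_site L0 n z) isT.
  rewrite /noise1 nN (noise2E WN L0)// -second_chaos_wrap => h2 h1; split; first exact: h1.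
  rewrite -[leLHS]sqr_sqrtr// lerXn2r ?nnegrE ?sqrtr_ge0// ltW// noise_level_gt0//.
apply: ge_ereal_sup => _ [N _ <-]; apply: ge_ereal_sup => _ [n _ <-].
have nl0 := ltW (noise_level_gt0 kappa n g0).
rewrite lee_fin LE ge_max; apply/andP; split; apply/bigmax_leP; split=> // x _.
  rewrite /noise1; case: ifPn => [nN|_]; last by rewrite normr0.
  by rewrite xi_unit_wrap; case: (H N n (val x.1, val x.2) nN).
have [nN|nN] := leqP n N; last by rewrite /noise2 leqNgt nN normr0 sqrtr0.
rewrite (noise2E WN L0)//; case: (H N n (val x.1, val x.2) nN) => _ h.
by rewrite -[leRHS]ger0_norm// -[leRHS]sqrtr_sqr ler_sqrt// sqr_ge0.
Qed.

Let measurable_X n z : measurable_fun setT (fun w => X w n z).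
Proof. exact: (gaussian_measurable (@xi_unit_gaussian _ _ _ P xi WN L L0 n) (wrap_site L0 n z)). Qed.

Lemma measurable_Omega_event kappa g : 0 < g -> measurable (Omega_event P L xi kappa g).
Proof.
move=> g0.
rewrite (_ : Omega_event _ _ _ _ _ = \bigcap_N \bigcap_n \bigcap_i \bigcap_j
   (if (n <= N)%N then [set w | `|X w n (i, j)| <= noise_level kappa g n] `&`
      [set w | `|second_chaos L (X w) N n (i, j)| <= noise_level kappa g n ^+ 2] else setT)).
  apply: bigcapT_measurable => N; apply: bigcapT_measurable => n.
  apply: bigcapT_measurable => i; apply: bigcapT_measurable => j.
  have m2 : measurable_fun setT (fun w => second_chaos L (X w) N n (i, j)).
    have -> : (fun w => second_chaos L (X w) N n (i, j)) = (fun w => \sum_(k < N - n)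
        (block_dev w n (i, j) k.+1 - (L%:R ^+ 2)^-1 * block_dev w n (i, j) k)).
      by apply/funext => w; rewrite second_chaosE.
    apply: measurable_sum => k; apply: measurable_funB; first exact: measurable_block_dev.
    by apply: measurable_funM => //; exact: measurable_block_dev.
  case: ifP => // _; apply: measurableI; apply: measurable_sublevel.
    by apply: measurableT_comp => //; exact: measurable_X.
  exact: measurableT_comp.
apply/seteqP; split=> w.
  move=> /(Omega_eventP kappa w g0) H N _ n _ i _ j _; case: ifP => // nN.
  by case: (H N n (i, j) nN).
move=> H; apply/(Omega_eventP kappa w g0) => N n [i j] nN.
by have := H N I n I i I j I; rewrite nN.
Qed.

(** The sum of |B_k| is at most 3 lam / 64 + 2, so the second chaos is at most 3
    lam / 32 + 4 <= lam / 4, where 128 <= lam. *)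
Lemma not_bad_bounds kappa g w : 0 < kappa -> 0 < g -> 128 <= g ^- 2 -> ~ bad_event kappa g w ->
  forall N n z, `|X w n z| <= noise_level kappa g n /\
    `|second_chaos L (X w) N n z| <= noise_level kappa g n ^+ 2.
Proof.
move=> k0 g0 g128 nb N n z; have tm := not_bad_tame_all nb n z.
have l128 : 128 <= scale_lam kappa g n by apply: le_trans (scale_lam_ge g n k0).
have l0 : 0 <= scale_lam kappa g n by lra.
split; last first.
  by rewrite noise_level_sq//; apply: le_trans (tame_second_chaos N l0 tm) _; lra.
rewrite -(ler_pXn2r (n := 2)) ?nnegrE ?(ltW (noise_level_gt0 _ _ _))//.
rewrite noise_level_sq// -normrX ger0_norm ?sqr_ge0// unit_noise_sq.
have [h _] := tm 0%N; move: h; rewrite expr0 mul1r; lra.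
Qed.

Lemma Omega_event_sup kappa g : 0 < kappa -> 0 < g -> 128 <= g ^- 2 ->
  ~` bad_event kappa g `<=` Omega_event P L xi kappa g.
Proof.
move=> k0 g0 g128 w nb; apply/Omega_eventP => // N n z _.
exact: not_bad_bounds.
Qed.

End OneNoise.
End GoodEvent.

(** * The equation on the lattice *)

Section DiscreteEquation.
Context {R : realType}.
Variables (L : nat) (L0 : (0 < L)%N) (g mass0 : R) (Z : nat -> nat * nat -> R) (N : nat).
Local Notation wrap := (wrap_site L0).
Local Notation V := (eff_pot L g mass0 Z N).
Local Notation s := (sol L g mass0 Z N).

Let Lpos n : (0 < L ^ n)%N. Proof. by rewrite expn_gt0 L0. Qed.

Definition block_fun (u : site L N -> R) n z : R :=
  bmean (L ^ (N - n)) (fun y => u (wrap N y)) z.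

Lemma block_fun_mean u n z : (n < N)%N ->
  block_fun u n z = bmean L (block_fun u n.+1) z.
Proof.
move=> nN; rewrite /block_fun.
rewrite (bmean_comp L (L ^ (N - n.+1)) (fun y => u (wrap N y)) z).
by rewrite -expnS subnSK.
Qed.

Lemma block_fun_top u y : block_fun u N y = u (wrap N y).
Proof. by rewrite /block_fun subnn expn0 bmean1. Qed.

Lemma bmean_wrap (u : site L N -> R) n k z z' : N = (n + k)%N ->
  z.1 = z'.1 %[mod L ^ n] -> z.2 = z'.2 %[mod L ^ n] ->
  bmean (L ^ k) (fun y => u (wrap N y)) z = bmean (L ^ k) (fun y => u (wrap N y)) z'.
Proof.
move=> NE; move: u; rewrite NE => u e1 e2; apply: eq_mean => p; congr u.
have [a1 a2] := wrap_desc L0 n z p; have [b1 b2] := wrap_desc L0 n z' p.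
rewrite [LHS]surjective_pairing [RHS]surjective_pairing; congr pair; apply: val_inj.
  by rewrite a1 b1 e1.
by rewrite a2 b2 e2.
Qed.

Lemma Qfine_wrap (u : site L N -> R) n y : (n <= N)%N ->
  Qfine n u (wrap N y) = block_fun u n (anc (L ^ (N - n)) y).
Proof.
move=> nN; have NE : N = (n + (N - n))%N by rewrite subnKC.
rewrite /Qfine (Qop_bmean L0 _ _ NE) /block_fun.
have divm (a : nat) : (a %% L ^ N %/ L ^ (N - n) = a %/ L ^ (N - n) %% L ^ n)%N.
  by rewrite modn_divl -expnD -NE.
by apply: (bmean_wrap _ NE); rewrite /anc /= divm modn_mod.
Qed.

Lemma minus_Laplacian_block u y :
  minus_Laplacian u (wrap N y) = lap_partial L (block_fun u) N y.
Proof.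
rewrite /minus_Laplacian /lap_partial; apply: eq_big_nat => n /andP[n0 nN].
by rewrite /Pfine !Qfine_wrap// (leq_trans (leq_pred _)).
Qed.

Variable f : site L N -> R.
Hypothesis fV : forall y, f (wrap N y) = L%:R ^+ (2 * N) * V N y.
Hypothesis V1 : forall n z, (0 < n <= N)%N -> 1 - V n z != 0.
Hypothesis H1 : forall n z, (0 < n <= N)%N -> bmean L (hfun L g mass0 Z N n) z != 0.
Hypothesis V0 : forall z, V 0 z != 0.

(** Periodic extension turns a solution on the sites into one of the equation on
    all pairs of naturals, to which [solves_sol] applies. *)
Lemma solution_unique u : (forall x, minus_Laplacian u x = f x * u x + 1) ->
  u = fun x => s N (val x.1, val x.2).
Proof.
move=> E; apply/funext => x.
rewrite -(solves_sol L0 V1 H1 V0 (u := block_fun u)) ?leqnn//.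
- by rewrite block_fun_top wrap_site_val.
- by move=> n z; exact: block_fun_mean.
- by move=> y; rewrite -minus_Laplacian_block E fV block_fun_top.
Qed.

Lemma sol_block k z : (k <= N)%N -> in_box L (N - k) z ->
  block_fun (fun x => s N (val x.1, val x.2)) (N - k) z = s (N - k)%N z.
Proof.
elim: k z => [|k IH] z kN bz.
  rewrite subn0 block_fun_top /=; move: bz; rewrite subn0 => /andP[b1 b2].
  by rewrite !modn_small//; case: z {b1 b2}.
have lt : (N - k.+1 < N)%N by rewrite ltn_subrL; case: N kN.
rewrite block_fun_mean// -(bmean_sol H1 z lt) subnSK//.
apply: eq_mean => p; rewrite IH ?(ltnW kN)//.
move: bz => /andP[b1 b2]; rewrite -(subnSK kN) /in_box expnS; apply/andP; split => /=.
  apply: (@leq_trans (z.1.+1 * L)%N); first by rewrite mulSn addnC ltn_add2r.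
  by rewrite mulnC leq_mul2l b1 orbT.
apply: (@leq_trans (z.2.+1 * L)%N); first by rewrite mulSn addnC ltn_add2r.
by rewrite mulnC leq_mul2l b2 orbT.
Qed.

Lemma solution_exists x : minus_Laplacian (fun x : site L N => s N (val x.1, val x.2)) x =
  f x * s N (val x.1, val x.2) + 1.
Proof.
have wx := wrap_site_val L0 x; set y := (val x.1, val x.2) in wx *.
rewrite -wx fV -(sol_solves V1 H1 V0 y (leqnn N)) minus_Laplacian_block.
rewrite /lap_partial; apply: eq_big_nat => n; rewrite ltnS => /andP[n0 nN]; congr (_ * (_ - _)).
  rewrite -[in LHS](subKn nN) sol_block ?leq_subr// !subKn//.
  by apply: anc_in_box => //; rewrite subnKC.
have n1N : (n.-1 <= N)%N by rewrite (leq_trans (leq_pred _)).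
rewrite -[in LHS](subKn n1N) sol_block ?leq_subr// !subKn//.
by apply: anc_in_box => //; rewrite subnKC.
Qed.

End DiscreteEquation.

(** * Solutions for a realisation in the good event *)

Section GoodRealisation.
Context {R : realType}.
Variables (L : nat) (g r : R) (Z : nat -> nat * nat -> R).
Hypothesis L0 : (0 < L)%N.
Hypothesis Z_coarse : forall n z, Z n z = L%:R * bmean L (Z n.+1) z.
Variable q : R.
Hypothesis q0 : 0 < q.
Hypothesis q8 : q ^+ 8 = L%:R^-1.
Hypothesis r1 : 1 <= r.
Hypothesis g01 : 0 < g <= 1.
Hypothesis qr : 36 * (r + 3) * q <= 1.
Hypothesis noiseB : forall n z, g * `|Z n z| <= q ^- n / 2.
Hypothesis chaosB : forall K n z, (n <= K)%N -> g ^+ 2 * `|second_chaos L Z K n z| <= q ^- n / 4.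

Local Notation V N n := (eff_pot L g (mass L r g N) Z N n).
Local Notation s N := (sol L g (mass L r g N) Z N).

Lemma one_sub_eff_pot_neq0 N n z : (0 < n <= N)%N -> 1 - V N n z != 0.
Proof.
move=> nN; have := eff_pot_small L0 Z_coarse q0 q8 r1 g01 qr noiseB chaosB z nN.
by rewrite ler_norml => /andP[_ h]; apply: lt0r_neq0; move: h; lra.
Qed.

Lemma bmean_hfun_neq0 N n z : (0 < n <= N)%N -> bmean L (hfun L g (mass L r g N) Z N n) z != 0.
Proof.
move=> nN; have /= h := bmean_hf_ge L0 Z_coarse q0 q8 r1 g01 qr noiseB chaosB z nN.
by apply: lt0r_neq0; rewrite (lt_le_trans _ h)// divr_gt0.
Qed.

Lemma eff_pot0_neq0 N z : V N 0 z != 0.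
Proof.
have h := eff_pot0_bound L0 Z_coarse q0 q8 r1 g01 qr noiseB (fun n z => @chaosB N n z) z.
by apply: lt0r_neq0; rewrite (lt_le_trans _ h)// divr_gt0.
Qed.

(** By [eff_potE] the potential is at most g L^-n |X_n| plus a term of order
    L^-n; the bound on the noise makes it O(L^(-(1 - kappa) n)), and
    [sol_step] turns this into a bound on the increments of the solution. *)
Lemma sol_increment kappa K : 0 < kappa < 1 -> 0 <= K ->
  (forall n z, `|Z n z| <= K * (L%:R `^ kappa) ^+ n) ->
  exists2 K' : R, 0 <= K' & forall N n y, (n < N)%N ->
    `|s N n.+1 y - s N n (anc L y)| <= K' / (L%:R `^ (1 - kappa)) ^+ n.+1.
Proof.
move=> /andP[k0 k1] K0 ZK; pose A := K + r + 2.
have A0 : 0 <= A by rewrite /A; move: r1 K0; lra.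
have L1r : 1 <= L%:R :> R by rewrite ler1n.
have Lr0 : 0 < L%:R :> R by rewrite ltr0n.
set a := L%:R `^ kappa in ZK *; set b := L%:R `^ (1 - kappa).
have a0 : 0 < a by rewrite powR_gt0.
have b0 : 0 < b by rewrite powR_gt0.
have a1 : 1 <= a by rewrite -(powRr0 L%:R) ler_powR// ltW.
have ab : L%:R = a * b by rewrite /a /b -powRD ?(gt_eqF Lr0) ?implybT// addrCA subrr addr0 powRr1// ler0n.
have Vb N n z : (0 < n <= N)%N -> `|V N n z| <= A / b ^+ n.
  move=> nN; rewrite (eff_potE g r Z L0 N n z).
  apply: le_trans (ler_normD _ _) _.
  have rm := remainder_bound8 L0 Z_coarse q0 q8 r1 g01 qr noiseB (fun n z => @chaosB N n z) z
    (proj2 (andP nN)).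
  have mt := marginal_term_bound L0 q0 q8 r1 g01 qr (fun n z => @chaosB N n z) nN rm.
  rewrite /A -addrA mulrDl; apply: lerD.
    have /andP[g0 g1] := g01.
    rewrite !normrM [`|g|]gtr0_norm// ger0_norm ?invr_ge0 ?exprn_ge0 ?ler0n//.
    rewrite ab exprMn invfM.
    apply: le_trans (ler_wpM2l _ (ZK n z)) _.
      by rewrite !mulr_ge0 ?ltW// invr_gt0 exprn_gt0.
    have an : a ^+ n != 0 by rewrite expf_neq0// gt_eqF.
    have bn : b ^+ n != 0 by rewrite expf_neq0// gt_eqF.
    have -> : g * ((a ^+ n)^-1 * (b ^+ n)^-1) * (K * a ^+ n) = g * (K / b ^+ n).
      by field; rewrite an bn.
    by rewrite ler_piMl// divr_ge0// ltW// exprn_gt0.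
  apply: le_trans mt _; rewrite mulrC.
  have r20 : 0 <= r + 2 by move: r1; lra.
  apply: ler_wpM2l => //.
  have q1 : q <= 1.
    by move: qr r1 q0; nra.
  have qn1 : q ^+ n <= 1 by apply: exprn_ile1 => //; exact: ltW.
  have qn0 : 0 <= q ^+ n by rewrite exprn_ge0// ltW.
  apply: (@le_trans _ _ ((q ^+ n) ^+ 8)).
    by apply: ler_wiXn2l => //.
  rewrite -exprM mulnC exprM q8 exprVn lef_pV2 ?posrE ?exprn_gt0//.
  by rewrite ab exprMn ler_peMl ?exprn_ge0 ?exprn_ege1// ltW.
exists (48 * A); first by rewrite mulr_ge0.
move=> N n y nN; have ss := @sol_step _ L g r Z L0 N n y.
have Bn : 0 <= A / b ^+ n.+1 by rewrite divr_ge0// exprn_ge0// ltW.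
apply: le_trans (ss (Num.min (1 / 8) (A / b ^+ n.+1)) nN _ _) _.
- by rewrite le_min ge_min lexx Bn divr_ge0.
- move=> z; rewrite le_min Vb ?andbT//.
  exact: (eff_pot_small L0 Z_coarse q0 q8 r1 g01 qr noiseB chaosB).
have s16 := sol_bound L0 Z_coarse q0 q8 r1 g01 qr noiseB chaosB (anc L y) (ltnW nN).
have dA : Num.min (1 / 8) (A / b ^+ n.+1) <= A / b ^+ n.+1 by rewrite ge_min lexx orbT.
have d0 : 0 <= Num.min (1 / 8) (A / b ^+ n.+1) by rewrite le_min Bn divr_ge0.
have -> : 48 * A / b ^+ n.+1 = 16 * (3 * (A / b ^+ n.+1)) by rewrite !mulrA -natrM.
by apply: ler_pM => //; [rewrite mulr_ge0|rewrite ler_pM2l].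
Qed.

End GoodRealisation.

Section OnTheEvent.
Context {R : realType} {d : measure_display} {T : measurableType d}.
Variables (P : probability T R) (xi : (R * R -> R) -> T -> R).
Hypothesis WN : white_noise P xi.
Variables (L : nat) (L3 : (2 < L)%N) (r g kappa : R).
Hypothesis r1 : 1 <= r.
Hypothesis Lr : 36 * (r + 3) <= L%:R `^ (8^-1).
Hypothesis g01 : 0 < g <= 1.
Hypothesis k16 : kappa <= 16^-1.
Variable L0 : (0 < L)%N.
Variable w : T.
Hypothesis Ow : Omega_event P L xi kappa g w.

Local Notation Z := (unit_noise xi L0 w).
Local Notation s N := (sol L g (mass L r g N) Z N).

Let q : R := (L%:R `^ (8^-1))^-1.

Let l0 : 0 < L%:R :> R. Proof. by rewrite ltr0n. Qed.
Let l1 : 1 <= L%:R :> R. Proof. by rewrite ler1n. Qed.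
Let q0 : 0 < q. Proof. by rewrite invr_gt0 powR_gt0. Qed.
Let q8 : q ^+ 8 = L%:R^-1.
Proof. by rewrite /q exprVn -powR_mulrn ?powR_ge0// -powRrM mulVf// powRr1// ler0n. Qed.
Let qr : 36 * (r + 3) * q <= 1.
Proof. by rewrite /q ler_pdivrMr ?mul1r// powR_gt0. Qed.
Let qVn n : q ^- n = L%:R `^ (8^-1 * n%:R).
Proof. by rewrite /q exprVn invrK powRrM powR_mulrn// powR_ge0. Qed.

Let g0 : 0 < g. Proof. by have /andP[] := g01. Qed.

Let Z_coarse n z : Z n z = L%:R * bmean L (Z n.+1) z.
Proof. exact: (unit_noise_coarse WN). Qed.

Let noiseB n z : g * `|Z n z| <= q ^- n / 2.
Proof.
have [h _] := (Omega_eventP L0 WN kappa w g0).1 Ow n n z (leqnn n).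
apply: (@le_trans _ _ (g * noise_level L kappa g n)); first by rewrite ler_pM2l.
have gn := gt_eqF g0.
have -> : g * noise_level L kappa g n = L%:R `^ (kappa * n%:R) / 2.
  by rewrite /noise_level; field; rewrite gn.
rewrite ler_pM2r ?invr_gt0// qVn; apply: ler_powR => //.
by apply: ler_wpM2r => //; move: k16; lra.
Qed.

Let chaosB K n z : (n <= K)%N -> g ^+ 2 * `|second_chaos L Z K n z| <= q ^- n / 4.
Proof.
move=> nK; have [_ h] := (Omega_eventP L0 WN kappa w g0).1 Ow K n z nK.
apply: (@le_trans _ _ (g ^+ 2 * noise_level L kappa g n ^+ 2)).
  by rewrite ler_pM2l ?exprn_gt0.
have gn := gt_eqF g0.
have -> : g ^+ 2 * noise_level L kappa g n ^+ 2 = L%:R `^ (kappa * n%:R * 2%:R) / 4.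
  by rewrite powRrM powR_mulrn ?powR_ge0// /noise_level; field; rewrite gn.
rewrite ler_pM2r ?invr_gt0// qVn; apply: ler_powR => //.
rewrite mulrAC; apply: ler_wpM2r => //; move: k16; lra.
Qed.

Let fV N y : g * xi_fine xi (wrap_site L0 N y) w + mass L r g N =
  L%:R ^+ (2 * N) * eff_pot L g (mass L r g N) Z N N y.
Proof.
rewrite eff_pot_top /unit_noise /xi_unit mul2n -addnn exprD.
have ln : L%:R ^+ N != 0 :> R by rewrite expf_neq0// gt_eqF.
by field.
Qed.

Lemma solution_eq_cascade N (u : site L N -> R) : solves xi r g w u ->
  u = fun x => s N N (val x.1, val x.2).
Proof.
move=> su; apply: (solution_unique (f := fun x => g * xi_fine xi x w + mass L r g N) (fV N)) => //.
- exact: (one_sub_eff_pot_neq0 L0 Z_coarse q0 q8 r1 g01 qr noiseB chaosB).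
- exact: (bmean_hfun_neq0 L0 Z_coarse q0 q8 r1 g01 qr noiseB chaosB).
- exact: (eff_pot0_neq0 L0 Z_coarse q0 q8 r1 g01 qr noiseB chaosB).
Qed.

Lemma unique_solution N : exists! u : site L N -> R, solves xi r g w u.
Proof.
exists (fun x => s N N (val x.1, val x.2)); split; last first.
  by move=> u /solution_eq_cascade.
apply: (solution_exists (f := fun x => g * xi_fine xi x w + mass L r g N) (fV N)).
- exact: (one_sub_eff_pot_neq0 L0 Z_coarse q0 q8 r1 g01 qr noiseB chaosB).
- exact: (bmean_hfun_neq0 L0 Z_coarse q0 q8 r1 g01 qr noiseB chaosB).
- exact: (eff_pot0_neq0 L0 Z_coarse q0 q8 r1 g01 qr noiseB chaosB).
Qed.

Lemma solution_limit :
  (forall n e, 0 < e -> exists N0, forall N M z, (N0 <= N <= M)%N ->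
     `|second_chaos L Z M n z - second_chaos L Z N n z| <= e) ->
  (forall k, 0 < k < 1 -> exists2 K, 0 <= K &
     forall n z, `|Z n z| <= K * (L%:R `^ k) ^+ n) ->
  forall u : forall N, site L N -> R, (forall N, solves xi r g w (u N)) ->
  exists ustar : R * R -> R, forall k : R, 0 < k < 1 ->
    holder_space L (1 - k) ustar /\
    holder_norm L (1 - k) (embed (u N) \- ustar) @[N --> \oo] --> 0%E.
Proof.
move=> cauchy tame u su.
have cauchy' n e : 0 < e -> exists N0, forall N M z, (N0 <= N <= M)%N ->
    g ^+ 2 * `|second_chaos L Z M n z - second_chaos L Z N n z| <= e.
  move=> e0; have [N0 HN] := cauchy n e e0; exists N0 => N M z NM.
  apply: le_trans (HN N M z NM).
  by have /andP[g0' g1] := g01; apply: ler_piMl => //; apply: exprn_ile1 => //; exact: ltW.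
have [|N n z nN|n z|k k01|ustar Hu] := @holder_limit R L _ (fun N => s N).
- exact: leq_trans L3.
- apply: bmean_sol => //.
  exact: (bmean_hfun_neq0 L0 Z_coarse q0 q8 r1 g01 qr noiseB chaosB).
- exact: (sol_cvg L0 Z_coarse q0 q8 r1 g01 qr noiseB chaosB cauchy').
- have [K K0 ZK] := tame k k01.
  exact: (sol_increment L0 Z_coarse q0 q8 r1 g01 qr noiseB chaosB k01 K0 ZK).
have Eu N : embed (u N) = emb L N (s N N).
  by rewrite -(embedE L0); congr embed; exact: solution_eq_cascade.
exists ustar => k k01; have [h1 h2] := Hu k k01; split; first exact: h1.
have E : (fun N => holder_norm L (1 - k) (embed (u N) \- ustar)) =
    (fun N => holder_norm L (1 - k) (emb L N (s N N) \- ustar)).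
  by apply/funext => N; rewrite Eu.
rewrite E; exact: h2.
Qed.

End OnTheEvent.

(** * Almost sure regularity of the noise and conclusion *)

Lemma powR_gt1 {R : realType} (a p : R) : 1 < a -> 0 < p -> 1 < a `^ p.
Proof.
move=> a1 p0; have -> : 1 = 1 `^ p :> R by rewrite powR1.
apply: gt0_ltr_powR; rewrite ?nnegrE//.
by rewrite (le_trans _ (ltW a1)).
Qed.

Section AlmostSure.
Context {R : realType} {d : measure_display} {T : measurableType d}.
Variables (P : probability T R) (xi : (R * R -> R) -> T -> R).
Hypothesis WN : white_noise P xi.
Variables (L : nat) (L3 : (2 < L)%N) (L0 : (0 < L)%N).
Local Notation Z w := (unit_noise xi L0 w).

Let gs (m : nat) : R := (m%:R + 12)^-1.

Let gs_gt0 m : 0 < gs m. Proof. by rewrite invr_gt0 ltr_wpDl. Qed.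

Let gs_sq m : gs m ^- 2 = (m%:R + 12) ^+ 2.
Proof. by rewrite /gs exprVn invrK. Qed.

Let gs_small m : 128 <= gs m ^- 2.
Proof. by rewrite gs_sq; have : 0 <= m%:R :> R by []; nra. Qed.

(** For fixed kappa the probability of the bad event tends to 0 with g. *)
Lemma bad_events_negligible kappa : 0 < kappa ->
  P.-negligible (\bigcap_m bad_event L0 xi kappa (gs m)).
Proof.
move=> k0; have Lam1 : 1 < L%:R `^ (2 * kappa).
  by apply: powR_gt1; rewrite ?mulr_gt0// ltr1n ltnW.
have b0 : 0 < 768 :> R by rewrite ltr0n.
have [C C0 HC] := superpolynomial_decay L0 Lam1 b0.
have Hb m := bad_event_prob L0 L3 WN k0 (gs_small m) C0 HC.
have mB : measurable (\bigcap_m bad_event L0 xi kappa (gs m)).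
  by apply: bigcapT_measurable => m; have [] := Hb m.
apply/negligibleP => //; apply/eqP; rewrite eq_le measure_ge0 andbT.
apply/lee_addgt0Pr => e e0; rewrite add0e.
(* exp (-y) <= 1 / y with y >= m / 768. *)
pose m := (Num.truncn (144 * C * 768 / e)).+1.
have [mbm Pm] := Hb m.
apply: (le_trans _ (le_trans Pm _)).
  by apply: le_measure; rewrite ?inE// => w; apply.
rewrite lee_fin.
have -> : - (1 / 768) / gs m ^+ 2 = - ((m%:R + 12) ^+ 2 / 768).
  by rewrite gs_sq; ring.
rewrite expRN; set y := _ / 768.
have hm : 144 * C * 768 / e < m%:R.
  by rewrite /m truncnS_gt// divr_ge0 ?ltW// !mulr_ge0.
have ym : m%:R / 768 <= y.
  by rewrite /y ler_pM2r ?invr_gt0 ?ltr0n//; have : 0 <= m%:R :> R by []; nra.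
have ye : y <= expR y by rewrite (le_trans _ (expR_ge1Dx y))// lerDr.
rewrite ler_pdivrMr ?expR_gt0//.
apply: le_trans (ler_wpM2l (ltW e0) (le_trans ym ye)).
by move: hm; rewrite ltr_pdivrMr// => hm; rewrite mulrA ler_pdivlMr ?ltr0n// [e * _]mulrC ltW.
Qed.

(** Almost every realisation avoids, for each kappa, the bad event of some g.
    The threshold is then finite but the exponent kappa arbitrarily small,
    which is what the Hoelder exponents close to 1 require. *)
Lemma ae_noise_regularity : {ae P, forall w,
  (forall n e, 0 < e -> exists N0, forall N M z, (N0 <= N <= M)%N ->
     `|second_chaos L (Z w) M n z - second_chaos L (Z w) N n z| <= e) /\
  (forall k, 0 < k < 1 -> exists2 K, 0 <= K &
     forall n z, `|Z w n z| <= K * (L%:R `^ k) ^+ n)}.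
Proof.
pose ks (j : nat) : R := j.+1%:R^-1.
have ks0 j : 0 < ks j by rewrite invr_gt0 ltr0n.
have := negligible_bigcup (fun j => bad_events_negligible (ks0 j)).
apply: negligibleS => w /= nw; apply: contrapT => nb; apply: nw.
have good j : exists m, ~ bad_event L0 xi (ks j) (gs m) w.
  apply: contrapT => no; apply: nb; exists j => // m _.
  by apply: contrapT => nbm; apply: no; exists m.
split.
  have [m Hm] := good 0%N.
  by move=> n e e0; exact: (not_bad_cauchy (ks0 0%N) Hm n e0).
move=> k /andP[k0 k1].
pose j := Num.truncn k^-1.
have [m Hm] := good j.
exists (2 * gs m)^-1; first by rewrite invr_ge0 mulr_ge0// ltW.
move=> n z; have [h _] := not_bad_bounds (ks0 j) (gs_gt0 m) (gs_small m) Hm n n z.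
apply: le_trans h _; rewrite /noise_level mulrC.
apply: ler_wpM2l; first by rewrite invr_ge0 mulr_ge0// ltW.
rewrite -powR_mulrn ?powR_ge0// -powRrM; apply: ler_powR; first by rewrite ler1n.
apply: ler_wpM2r => //; rewrite -[leRHS]invrK lef_pV2 ?posrE ?invr_gt0//.
by rewrite /j ltW// truncnS_gt// invr_ge0 ltW.
Qed.

End AlmostSure.

Theorem theorem1p1 (R : realType) :
  exists2 kappa0 : R, 0 < kappa0 &
  forall r : R, 1 <= r ->
  exists L0 : nat, forall L : nat, odd L -> (3 <= L)%N -> (L0 <= L)%N ->
  forall kappa_s : R, 0 < kappa_s <= kappa0 ->
  exists c C : R, [/\ 0 < c, 0 < C &
  forall (d : measure_display) (T : measurableType d) (P : probability T R)
    (xi : (R * R -> R) -> T -> R),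
  white_noise P xi ->
  forall g : R, 0 < g <= 1 ->
  [/\ measurable (Omega_event P L xi kappa_s g),
      ((1 - C * expR (- c * g ^- 2))%:E <= P (Omega_event P L xi kappa_s g))%E,
      forall omega, Omega_event P L xi kappa_s g omega ->
        forall N : nat, exists! u : site L N -> R, solves xi r g omega u
    & {ae P, forall omega, Omega_event P L xi kappa_s g omega ->
        forall u : (forall N : nat, site L N -> R),
        (forall N, solves xi r g omega (u N)) ->
        exists ustar : R * R -> R,
        forall kappa : R, 0 < kappa < 1 ->
          holder_space L (1 - kappa) ustar /\
          holder_norm L (1 - kappa) (embed (u N) \- ustar) @[N --> \oo]
            --> 0%E}]].
Proof.
(* The second chaos is allowed to be g^-2 L^(2 kappa n) / 4 on the event; the
   deterministic analysis needs 2 kappa <= 1/8. *)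
exists 16^-1; first by rewrite invr_gt0.
move=> r r1; have r3 : 0 <= 36 * (r + 3) :> R by move: r1; lra.
(* L^(1/8) >= 36 (r + 3) is the smallness condition on q = L^(-1/8). *)
exists (Num.truncn ((36 * (r + 3)) ^+ 8)).+1 => L _ L3 LL kappa /andP[k0 k16].
have L0 : (0 < L)%N by exact: ltn_trans L3.
have Lr : 36 * (r + 3) <= L%:R `^ (8^-1).
  rewrite -(@ler_pXn2r _ 8)// ?nnegrE ?powR_ge0//.
  rewrite -[leRHS]powR_mulrn ?powR_ge0// -powRrM mulVf// powRr1//.
  by rewrite ltW// (lt_le_trans (truncnS_gt _))// ?ler_nat//.
have Lam1 : 1 < L%:R `^ (2 * kappa).
  by apply: powR_gt1; rewrite ?mulr_gt0// ltr1n ltnW.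
have b0 : 0 < 768 :> R by rewrite ltr0n.
have [C C0 HC] := superpolynomial_decay L0 Lam1 b0.
have C'0 : 0 < 144 * C + expR 6^-1 by rewrite ltr_wpDl ?mulr_ge0// expR_gt0.
(* The summand exp (1/6) = exp (128/768) makes the bound trivial when g^-2 <
   128. *)
exists (1 / 768), (144 * C + expR 6^-1); split.
- by rewrite divr_gt0 ?ltr01 ?ltr0n.
- exact: C'0.
move=> d T P xi WN g g01; have /andP[g0 g1] := g01.
have mO := measurable_Omega_event L0 WN kappa g0.
split => //.
- have [g128|g128] := leP 128 (g ^- 2); last first.
    apply: le_trans (measure_ge0 P _); rewrite lee_fin subr_le0.
    rewrite mulrDl -expRD ler_wpDl ?mulr_ge0 ?expR_ge0//.
    rewrite -[leLHS]expR0 ler_expR; move: g128; set G := g ^- 2 => g128; lra.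
  have [mb Pb] := bad_event_prob L0 L3 WN k0 g128 C0 HC.
  apply: (@le_trans _ _ (P (~` bad_event L0 xi kappa g))); last first.
    apply: le_measure; rewrite ?inE//; first exact: measurableC.
    exact: Omega_event_sup.
  rewrite probability_setC//.
  have Pf : P (bad_event L0 xi kappa g) \is a fin_num by exact: fin_num_measure.
  rewrite -(fineK Pf) -EFinB lee_fin lerD2l lerN2.
  rewrite -lee_fin fineK//; apply: le_trans Pb _; rewrite lee_fin.
  apply: ler_wpM2r; first exact: expR_ge0.
  by rewrite lerDl expR_ge0.
- by move=> w Ow N; exact: (unique_solution WN r1 Lr g01 k16 L0 Ow).
- apply: filterS (ae_noise_regularity WN L3 L0) => w [h1 h2] Ow u su.
  exact: (solution_limit WN L3 r1 Lr g01 k16 (L0 := L0) Ow h1 h2 su).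
Qed.
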